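(* Let $0<\alpha,p,q<1$ and let $\Lambda,M\subset\mathbb{R}$ be discrete. If both $\mathrm{D}^+_{G_\alpha}(\Lambda)$ and $\mathrm{D}^+_{G_\alpha}(M)$ are finite, then $(\Lambda,M)$ is a non-uniqueness pair for $(-\Delta)^{1/2}$ in $\mathcal{S}_{1/2}^{p,q}(\mathbb{R})\cap\mathscr{H}(\mathbb{R})$; that is, there exists a nonzero $f\in\mathcal{S}_{1/2}^{p,q}(\mathbb{R})\cap\mathscr{H}(\mathbb{R})$ such that $f(\lambda)=0$ for all $\lambda\in\Lambda$ and $(-\Delta)^{1/2}f(\mu)=0$ for all $\mu\in M$.
   Context: A set in $\mathbb{R}$ is discrete if it has no accumulation point in $\mathbb{R}$. $\mathscr{H}(\mathbb{R})$ is the space of (complex-valued) real-analytic functions on $\mathbb{R}$. The Fourier transform is $\widehat f(\xi)=\int_{\mathbb{R}}f(x)e^{-2\pi i\xi x}\,dx$, and for $f$ in the Schwartz space $\mathcal{S}(\mathbb{R})$ (complex-valued functions) $(-\Delta)^{1/2}f$ is the smooth function with $\widehat{(-\Delta)^{1/2}f}(\xi)=|\xi|\widehat f(\xi)$. $\mathcal{S}_{1/2}^{p,q}(\mathbb{R})$ is the space of all $f\in\mathcal{S}(\mathbb{R})$ such that $(-\Delta)^{1/2}f\in\mathcal{S}(\mathbb{R})$ and there exists $c=c_f>0$ with $\sup_{x\in\mathbb{R}}|f(x)|e^{c|x|^p}+\sup_{x\in\mathbb{R}}|(-\Delta)^{1/2}f(x)|e^{c|x|^q}<\infty$. For $\alpha>0$,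 $G_\alpha:\mathbb{R}\to\mathbb{R}$ is the bijection $G_\alpha(y)=\mathrm{sgn}(y)|y|^{1/\alpha}$, and for $\Gamma\subset\mathbb{R}$ discrete $$\mathrm{D}^+_{G_\alpha}(\Gamma)=\limsup_{r\to\infty}\ \sup\Big\{\tfrac{\#(G_\alpha(\Gamma)\cap B)}{|B|}: B\subset\mathbb{R}\text{ an interval},\ |B|=r\Big\}\in[0,\infty].$$ *)

(* Defs.v *)
From mathcomp Require Import all_boot all_order all_algebra.
From mathcomp Require Import all_classical all_reals all_analysis.
From mathcomp Require Import complex.

Set Implicit Arguments.
Unset Strict Implicit.
Unset Printing Implicit Defensive.

Import Order.TTheory GRing.Theory Num.Theory.
Import numFieldNormedType.Exports.

Local Open Scope classical_set_scope.
Local Open Scope ring_scope.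
Local Open Scope complex_scope.

(* [R[i]] carries no normed R-module structure in the library, so derivatives,
   measurability and integrals of a function [R -> R[i]] are taken on its real
   and imaginary parts. *)
Definition smooth (R : realType) (f : R -> R[i]) : Prop :=
  forall (n : nat) (x : R),
    derivable (derive1n n (fun t => complex.Re (f t))) x 1 /\
    derivable (derive1n n (fun t => complex.Im (f t))) x 1.

Definition cderive1n (R : realType) (n : nat) (f : R -> R[i]) (x : R) : R[i] :=
  derive1n n (fun t => complex.Re (f t)) x +i*
  derive1n n (fun t => complex.Im (f t)) x.

Definition schwartz (R : realType) (f : R -> R[i]) : Prop :=
  smooth f /\
  forall m n : nat, exists C : R,
    forall x : R, `|x| ^+ m * Normc.normc (cderive1n n f x) <= C.

Definition cintegrable (R : realType) (f : R -> R[i]) : Prop :=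
  (@lebesgue_measure R).-integrable setT (fun x => (complex.Re (f x))%:E) /\
  (@lebesgue_measure R).-integrable setT (fun x => (complex.Im (f x))%:E).

Definition cintegral (R : realType) (f : R -> R[i]) : R[i] :=
  Rintegral (@lebesgue_measure R) setT (fun x => complex.Re (f x)) +i*
  Rintegral (@lebesgue_measure R) setT (fun x => complex.Im (f x)).

Definition expi (R : realType) (t : R) : R[i] := cos t +i* sin t.

Definition fourier (R : realType) (f : R -> R[i]) (xi : R) : R[i] :=
  cintegral (fun x => f x * expi (- (2 * pi * xi * x))).

(* The operator $(-\Delta)^{1/2}$. For Schwartz [f] there is exactly one smooth
   integrable function with Fourier transform [|xi| * fourier f xi]: it decays
   like [1 / x^2], hence is integrable, and integrable continuous functions are
   determined by their Fourier transform. So the default value of [xget] is not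
   used for Schwartz [f]. *)
Definition half_laplacian (R : realType) (f : R -> R[i]) : R -> R[i] :=
  xget (fun _ => 0)
    [set g : R -> R[i] |
      [/\ smooth g, cintegrable g &
          forall xi : R, fourier g xi = (`|xi|)%:C * fourier f xi]].

Definition real_analytic (R : realType) (f : R -> R[i]) : Prop :=
  forall x0 : R, exists2 r : R, 0 < r &
    exists a : nat -> R[i], forall x : R, `|x - x0| < r ->
      Normc.normc (f x - \sum_(0 <= k < n) a k * ((x - x0)%:C) ^+ k)
        @[n --> \oo] --> (0 : R).

Definition weighted_sup (R : realType) (f : R -> R[i]) (c p : R) : \bar R :=
  ereal_sup (range (fun x : R =>
    (Normc.normc (f x) * expR (c * `|x| `^ p))%:E)).

Definition half_space (R : realType) (p q : R) : set (R -> R[i]) :=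
  [set f | [/\ schwartz f, schwartz (half_laplacian f) &
    exists2 c : R, 0 < c &
      (weighted_sup f c p + weighted_sup (half_laplacian f) c q < +oo)%E]].

Definition discrete_subset (R : realType) (A : set R) : Prop :=
  limit_point A = set0.

Definition Gpow (R : realType) (alpha y : R) : R :=
  Num.sg y * `|y| `^ (alpha^-1).

Definition upper_density (R : realType) (alpha : R) (A : set R) : \bar R :=
  limf_esup (fun r : R =>
    ereal_sup [set (counting ((Gpow alpha @` A) `&` B) * (r^-1)%:E)%E |
      B in [set B : set R |
        is_interval B /\ lebesgue_measure B = r%:E]]) (pinfty_nbhs R).

Definition nonuniqueness_pair (R : realType) (L M : set R)
    (X : set (R -> R[i])) : Prop :=
  exists f : R -> R[i],
    [/\ X f, exists x : R, f x != 0,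
        forall l : R, L l -> f l = 0 &
        forall m : R, M m -> half_laplacian f m = 0].

(* Main.v *)
Require Import Defs.
From mathcomp Require Import all_boot all_order all_algebra.
From mathcomp Require Import all_classical all_reals all_analysis.
From mathcomp Require Import complex measurable_realfun ring lra zify.
Import Order.TTheory GRing.Theory Num.Theory.
Import numFieldNormedType.Exports.
Set Implicit Arguments.
Unset Strict Implicit.
Unset Printing Implicit Defensive.
Local Open Scope classical_set_scope.
Local Open Scope ring_scope.
Local Open Scope complex_scope.

(* Let [lam] enumerate Lambda, and M twice over, and put [a_k = (k + 1)^s] with
   [1 < s].  The function is the infinite product over [k] of the factors
     [a_k / (a_k - i x)]   and   [(x - lam_k) / (x - lam_k + i / a_k)].
   All factors are boundary values of functions that are holomorphic and bounded
   by 1 in the upper half-plane, and so is the product [f].  Hence the Fourier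
   transform of [f] lives on a half-line, where [|xi|] is the symbol of
   [d/dx / (2 pi i)]: the half-Laplacian of [f] is [f' / (2 pi i)].  A simple zero
   of [f] at the points of Lambda and a double zero at those of M are what is
   needed.  The first kind of factors makes [f] decay like [exp (- c |x|^(1/s))],
   with [1/s] larger than [p] and [q].  The density hypothesis bounds the number
   of [lam_k] in a ball polynomially in its radius, so that near [x] the poles
   stay at a distance polynomially small in [x]; the Taylor coefficients at [x]
   then grow only polynomially in [x] and the derivatives of [f] decay as [f]. *)

(** The obstacle is that [half_laplacian] is nonlocal, so that its zeros cannot be prescribed
    directly. A spectrum in a half-line makes it a derivative, and both families of zeros become
    local conditions on one product. No holomorphic extension is ever formed. That the spectrum lies
    in a half-line is tested by integrals against [expi (x * t)] with [t > 0], and the test survives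
    multiplication by a factor because a / (a - i x) is the average of exp (i x t) against the
    density a exp (- a t) on t >= 0. Cauchy's estimates are replaced by weighted l^1 norms of Taylor
    coefficients, which multiply along the product and retain the smallness of its value. The height
    1 / a_k of the pole below lam_k is a compromise. It must be summable, whence 1 < s, for the
    zero-producing factors to tend to 1 fast enough; it must not be smaller than a power of 1 / k,
    since it bounds from below the radius of convergence at the points near lam_k. *)

Local Notation normc := Normc.normc.

(** * Sequences of complex numbers *)

Section complex_sequences.
Variable R : realType.
Implicit Types (z l : R[i]) (u v : nat -> R[i]).

(** Convergence is phrased through a real-valued distance, as in [real_analytic], so that squeeze
    arguments over [R] apply to complex sequences. *)
Definition cvgc u l := normc (l - u n) @[n --> \oo] --> (0 : R).

Lemma normc_ge0 z : 0 <= normc z.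
Proof. by case: z => a b; exact: sqrtr_ge0. Qed.

Lemma normc_Re z : `|complex.Re z| <= normc z.
Proof.
case: z => a b /=; rewrite -sqrtr_sqr ler_wsqrtr// lerDl sqr_ge0//.
Qed.

Lemma normc_Im z : `|complex.Im z| <= normc z.
Proof.
case: z => a b /=; rewrite -[`|b|]sqrtr_sqr ler_wsqrtr// lerDr sqr_ge0//.
Qed.

Lemma normc_le_ReIm z : normc z <= `|complex.Re z| + `|complex.Im z|.
Proof.
case: z => a b /=.
rewrite -[leRHS]ger0_norm ?addr_ge0// -sqrtr_sqr ler_wsqrtr//.
rewrite sqrrD !real_normK ?num_real// lerD2r lerDl.
by rewrite mulrn_wge0// mulr_ge0.
Qed.

Lemma normc_real (x : R) : normc x%:C = `|x|.
Proof. by rewrite /= expr0n /= addr0 sqrtr_sqr. Qed.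

Lemma normcX z n : normc (z ^+ n) = normc z ^+ n.
Proof.
elim: n => [|n ih]; first by rewrite !expr0 Normc.normc1.
by rewrite !exprS Normc.normcM ih.
Qed.

Lemma normcB z l : normc (z - l) = normc (l - z).
Proof. by rewrite -opprB normcN. Qed.

Lemma normc_eq0 z : (normc z == 0) = (z == 0).
Proof.
apply/eqP/eqP => [/Normc.eq0_normc//|->]; exact: Normc.normc0.
Qed.

Lemma normc_gt0 z : (0 < normc z) = (z != 0).
Proof. by rewrite lt_neqAle normc_ge0 andbT eq_sym normc_eq0. Qed.

Lemma normc_sqr z : normc z ^+ 2 = complex.Re z ^+ 2 + complex.Im z ^+ 2.
Proof. by case: z => a b /=; rewrite sqr_sqrtr// addr_ge0// sqr_ge0. Qed.

Lemma ler_normc_sub z l : normc z - normc l <= normc (z - l).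
Proof. by rewrite lerBlDr -{1}(subrK l z) le_normcD. Qed.

Lemma ler_dist_normc z l : `|normc z - normc l| <= normc (z - l).
Proof.
rewrite ler_norml ler_normc_sub andbT lerNl opprB normcB; exact: ler_normc_sub.
Qed.

Lemma ler_normc_sum I (s : seq I) (P : pred I) (F : I -> R[i]) :
  normc (\sum_(i <- s | P i) F i) <= \sum_(i <- s | P i) normc (F i).
Proof.
elim/big_ind2 : _ => //; first by rewrite Normc.normc0.
by move=> z x l y zx ly; rewrite (le_trans (le_normcD _ _))// lerD.
Qed.

Lemma normc_prod I (s : seq I) (P : pred I) (F : I -> R[i]) :
  normc (\prod_(i <- s | P i) F i) = \prod_(i <- s | P i) normc (F i).
Proof. by elim/big_ind2 : _ => [|z x l y <- <-|//]; rewrite ?Normc.normc1// Normc.normcM. Qed.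

Lemma cvgc_squeeze u l (e : nat -> R) :
  (\forall n \near \oo, normc (l - u n) <= e n) -> e @ \oo --> (0 : R) -> cvgc u l.
Proof.
move=> ue e0; apply: squeeze_cvgr; [|exact: cvg_cst|exact: e0].
by near do rewrite normc_ge0/=.
Unshelve. all: by end_near. Qed.

Lemma cvgc_ReIm u l : cvgc u l <->
  (complex.Re (u n) @[n --> \oo] --> complex.Re l) /\
  (complex.Im (u n) @[n --> \oo] --> complex.Im l).
Proof.
split=> [ul|[ul1 ul2]].
  split; apply: cvg_sub0 (cvg_cst _) => /=; apply/cvgr0Pnorm_lt => e e0;
  move/cvgr0Pnorm_lt : ul => /(_ _ e0); apply: filterS => n;
  rewrite ger0_norm ?normc_ge0//; apply: le_lt_trans; rewrite !fctE.
    rewrite distrC; case: (l) (u n) => a b [c d]; exact: (normc_Re (Complex (a-c) (b-d))).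
  rewrite distrC; case: (l) (u n) => a b [c d]; exact: (normc_Im (Complex (a-c) (b-d))).
apply: (@cvgc_squeeze _ _ (fun n => `|complex.Re l - complex.Re (u n)| +
   `|complex.Im l - complex.Im (u n)|)).
  apply: nearW => n.
  by case: (l) (u n) => a b [c d]; rewrite (le_trans (normc_le_ReIm _)).
have absB (f : nat -> R) (x : R) : f @ \oo --> x -> `|x - f n| @[n --> \oo] --> (0 : R).
  by move=> fx; rewrite -(normr0 R) -(subrr x); apply: cvg_norm; apply: cvgB => //; exact: cvg_cst.
by rewrite -[0]addr0; apply: cvgD; exact: absB.
Qed.

Lemma cvgc_unique u l l' : cvgc u l -> cvgc u l' -> l = l'.
Proof.
move=> /cvgc_ReIm[a b] /cvgc_ReIm[c d].
have Re_eq : complex.Re l = complex.Re l' by apply: cvg_unique a c.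
have Im_eq : complex.Im l = complex.Im l' by apply: cvg_unique b d.
by case: l l' Re_eq Im_eq {a b c d} => ? ? [? ?] /= -> ->.
Qed.

Lemma cvgc_cst l : cvgc (fun=> l) l.
Proof. by rewrite /cvgc subrr Normc.normc0; exact: cvg_cst. Qed.

Lemma cvgcD u v l l' : cvgc u l -> cvgc v l' -> cvgc (fun n => u n + v n) (l + l').
Proof.
move=> ul vl.
apply: (@cvgc_squeeze _ _ (fun n => normc (l - u n) + normc (l' - v n))).
  by apply: nearW => n; rewrite opprD addrACA le_normcD.
by rewrite -[0]addr0; exact: cvgD.
Qed.

Lemma cvgcZ z u l : cvgc u l -> cvgc (fun n => z * u n) (z * l).
Proof.
move=> ul; apply: (@cvgc_squeeze _ _ (fun n => normc z * normc (l - u n))).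
  by apply: nearW => n; rewrite -mulrBr Normc.normcM.
by rewrite -(mulr0 (normc z)); apply: cvgM => //; exact: cvg_cst.
Qed.

Lemma cvgc_norm u l : cvgc u l -> normc (u n) @[n --> \oo] --> normc l.
Proof.
move=> ul; apply: cvg_sub0 (cvg_cst _); apply/norm_cvg0P.
apply: squeeze_cvgr (cvg_cst _) ul.
by apply: nearW => n; rewrite normr_ge0/= -normrN opprB /=; exact: ler_dist_normc.
Qed.

Lemma cvgc_le u l (K : R) : cvgc u l -> (\forall n \near \oo, normc (u n) <= K) -> normc l <= K.
Proof. by move=> /cvgc_norm ul uK; apply: (ler_cvg_to ul (cvg_cst K) uK). Qed.

Lemma cvgc_ge u l (K : R) : cvgc u l -> (\forall n \near \oo, K <= normc (u n)) -> K <= normc l.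
Proof. by move=> /cvgc_norm ul uK; apply: (ler_cvg_to (cvg_cst K) ul uK). Qed.

Lemma cvgc_shift k u l : cvgc (fun n => u (n + k)%N) l -> cvgc u l.
Proof. by rewrite /cvgc => h; rewrite -(cvg_shiftn k). Qed.

(** The real and imaginary parts are telescoping series that converge absolutely. The index [k0] is
    there because the factors of the product are close to 1 only from some index on, which depends
    on the point. *)
Lemma cvgc_summable u (e : nat -> R) (D : R) k0 :
  (forall n, (k0 <= n)%N -> normc (u n.+1 - u n) <= e n) -> (forall n, 0 <= e n) ->
  (forall n, \sum_(0 <= k < n) e k <= D) -> exists l, cvgc u l.
Proof.
move=> ue e0 eD.
have cvg_e : cvgn (series e).
  apply: nondecreasing_is_cvgn; first by apply: nondecreasing_series => n _ _; exact: e0.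
  by exists D => _ [n _ <-]; rewrite /series/=; exact: eD.
have key (F : R[i] -> R) : (forall z l, F z - F l = F (z - l)) ->
    (forall z, `|F z| <= normc z) -> cvgn (fun n => F (u (n + k0)%N)).
  move=> FB Fn; pose v n := F (u (n + k0)%N); rewrite -/v.
  rewrite -(_ : [sequence v 0%N + series (fun n => v n.+1 - v n) n]_n = v); last first.
    apply/funext => n /=; rewrite /series/= (telescope_sumr v)//.
    by rewrite addrCA subrr addr0.
  apply: is_cvgD; first exact: is_cvg_cst.
  apply: normed_cvg; apply: (@series_le_cvg _ _ (fun n => e (n + k0)%N)) => [n|n|n|] //=.
    by rewrite FB (le_trans (Fn _))// addSn ue// leq_addl.
  rewrite -[X in cvgn X]/(series _).
  apply: nondecreasing_is_cvgn; first by apply: nondecreasing_series => n _ _; exact: e0.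
  exists D => _ [n _ <-]; rewrite /series/=; apply: le_trans (eD (n + k0)%N).
  rewrite [leRHS](big_cat_nat (n := k0))/= ?leq_addl//.
  rewrite -[X in _ <= _ + \sum_(X <= _ < _) _]add0n big_addn addnK lerDr sumr_ge0//.
have /cvg_ex[/= a ua] := key (@complex.Re R) ltac:(by move=> [? ?] [? ?]) normc_Re.
have /cvg_ex[/= b ub] := key (@complex.Im R) ltac:(by move=> [? ?] [? ?]) normc_Im.
by exists (a +i* b); apply: (@cvgc_shift k0); apply/cvgc_ReIm.
Qed.

End complex_sequences.

(** * Power series of products of Moebius factors *)

Section weighted_series.
Variable R : realType.
Implicit Types (w z : R[i]) (a b : nat -> R[i]) (r t K : R).

(** Partial sums of the weighted l^1 norm of the coefficients. A bound on them controls every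
    coefficient by a multiple of [r ^- n], which is the role of Cauchy's estimates. *)
Definition wsum r a n : R := \sum_(0 <= k < n) normc (a k) * r ^+ k.

Definition psum a t n : R[i] := \sum_(0 <= k < n) a k * t%:C ^+ k.

(* Coefficients of [(\sum_n a_n t^n) / (w + t)]. *)
Fixpoint divcoef w a n : R[i] :=
  if n is m.+1 then (a n - divcoef w a m) / w else a 0 / w.

(* Coefficients of [(u + v t / (w + t)) * \sum_n a_n t^n]. *)
Definition mobcoef (u v w : R[i]) a n : R[i] :=
  u * a n + v * (if n is m.+1 then divcoef w a m else 0).

Lemma wsum_ge0 r a n : 0 <= r -> 0 <= wsum r a n.
Proof. by move=> r0; apply: sumr_ge0 => k _; rewrite mulr_ge0 ?normc_ge0// exprn_ge0. Qed.

Lemma ler_wsum r a m n : 0 <= r -> (m <= n)%N -> wsum r a m <= wsum r a n.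
Proof.
move=> r0 mn; rewrite /wsum [leRHS](big_cat_nat (n := m))//= lerDl sumr_ge0//.
by move=> k _; rewrite mulr_ge0 ?normc_ge0// exprn_ge0.
Qed.

Lemma normc_coef_le r a n K : 0 <= r -> (forall n, wsum r a n <= K) -> normc (a n) * r ^+ n <= K.
Proof.
move=> r0 aK; apply: le_trans (aK n.+1).
by rewrite /wsum big_nat_recr//= lerDr; exact: wsum_ge0.
Qed.

Lemma wsumD r a b n : 0 <= r -> wsum r (a \+ b) n <= wsum r a n + wsum r b n.
Proof.
move=> r0; rewrite /wsum -big_split/=; apply: ler_sum => k _.
by rewrite -mulrDl ler_wpM2r ?exprn_ge0// le_normcD.
Qed.

(** The recursion w b_n = a_n - b_(n-1) gives |w| ||b|| <= ||a|| + r ||b||. It is applied to finite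
    sums, where r ||b|| may be subtracted before the norm of b is known to be finite. *)
Lemma wsum_divcoef r w a K n : 0 <= r -> r < normc w -> (forall n, wsum r a n <= K) ->
  wsum r (divcoef w a) n <= K / (normc w - r).
Proof.
move=> r0 rw aK.
have w0 : 0 < normc w by exact: le_lt_trans rw.
have K0 : 0 <= K by apply: le_trans (aK 0%N); rewrite /wsum big_nil.
rewrite ler_pdivlMr ?subr_gt0//.
case: n => [|n]; first by rewrite /wsum big_nil mul0r.
have key m : normc w * wsum r (divcoef w a) m.+1 <= wsum r a m.+1 + r * wsum r (divcoef w a) m.
  elim: m => [|m ih].
    rewrite /wsum !big_nat1 big_nil mulr0 addr0 !expr0 !mulr1 /= Normc.normcM Normc.normcV.
    by rewrite mulrCA divff ?mulr1// gt_eqF.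
  rewrite /wsum big_nat_recr//= mulrDr (le_trans (lerD ih (lexx _)))//.
  rewrite [in leRHS]big_nat_recr//= -!addrA lerD2l.
  rewrite -/(wsum r (divcoef w a) m) [X in _ <= _ + r * X]big_nat_recr//= mulrDr.
  rewrite addrCA lerD2l.
  rewrite mulrCA !mulrA [r * _]mulrC -[_ * r * _]mulrA -exprS -mulrDl ler_wpM2r ?exprn_ge0//.
  rewrite Normc.normcM Normc.normcV divfK ?gt_eqF//.
  by rewrite (le_trans (le_normcD _ _))// normcN.
rewrite mulrBr mulrC lerBlDr (le_trans (key n))// lerD// mulrC ler_wpM2r//.
exact: ler_wsum.
Qed.

Lemma wsum_mobcoef r u v w a K n : 0 <= r -> r < normc w -> (forall n, wsum r a n <= K) ->
  wsum r (mobcoef u v w a) n <= (normc u + normc v * (r / (normc w - r))) * K.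
Proof.
move=> r0 rw aK.
apply: le_trans (ler_wsum _ r0 (leqnSn n)) _.
apply: le_trans (wsumD _ _ _ r0) _; rewrite mulrDl; apply: lerD.
  apply: (@le_trans _ _ (normc u * wsum r a n.+1)); last by rewrite ler_wpM2l// normc_ge0.
  by rewrite /wsum mulr_sumr; apply: ler_sum => k _; rewrite Normc.normcM mulrA.
apply: (@le_trans _ _ (normc v * r * wsum r (divcoef w a) n)); last first.
  rewrite -!mulrA ler_wpM2l ?normc_ge0// ler_wpM2l// mulrC; exact: wsum_divcoef.
rewrite /wsum big_nat_recl//= mulr0 Normc.normc0 mul0r add0r mulr_sumr.
by apply: ler_sum => k _; rewrite Normc.normcM exprS; lra.
Qed.

(** Truncating the recursion leaves one boundary term, which [psum_cvg_coef0] sends to 0. *)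
Lemma psum_divcoef w a t n : w != 0 ->
  (w + t%:C) * psum (divcoef w a) t n.+1 = psum a t n.+1 + divcoef w a n * t%:C ^+ n.+1.
Proof.
move=> w0; elim: n => [|n ih].
  rewrite /psum !big_nat1 /= !expr0 !mulr1 mulrDl mulrC divfK// expr1.
  by rewrite [t%:C * _]mulrC.
rewrite /psum big_nat_recr//= mulrDr ih [in RHS]big_nat_recr//= -!addrA; congr (_ + _).
rewrite mulrDl; set x := t%:C.
have -> : w * ((a n.+1 - divcoef w a n) / w * x ^+ n.+1) = (a n.+1 - divcoef w a n) * x ^+ n.+1.
  by rewrite mulrA [w * _]mulrC divfK.
by rewrite [x ^+ n.+2]exprS; ring.
Qed.

Lemma psum_cvg_coef0 r a t K : `|t| < r -> (forall n, wsum r a n <= K) ->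
  cvgc (fun n => a n * t%:C ^+ n) 0.
Proof.
move=> tr aK.
have r0 : 0 < r by exact: le_lt_trans tr.
apply: (@cvgc_squeeze _ _ _ (geometric K (`|t| / r))).
  apply: nearW => n; rewrite sub0r normcN Normc.normcM normcX normc_real /= exprMn exprVn.
  rewrite mulrA ler_pdivlMr ?exprn_gt0// mulrAC ler_wpM2r ?exprn_ge0//.
  by apply: normc_coef_le => //; exact: ltW.
apply: cvg_geometric; rewrite normrM normr_id gtr0_norm ?invr_gt0//.
by rewrite ltr_pdivrMr// mul1r.
Qed.

(** The tail depends on the coefficients only through [K]; it is therefore uniform over all partial
    products, which allows two limits to be exchanged later. *)
Lemma psum_tail r a t K n m : `|t| < r -> (forall n, wsum r a n <= K) -> (n <= m)%N ->
  normc (psum a t m - psum a t n) <= K * (`|t| / r) ^+ n.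
Proof.
move=> tr aK nm; have r0 : 0 < r by exact: le_lt_trans tr.
rewrite /psum (big_cat_nat (n := n) (p := m))//= addrAC subrr add0r.
rewrite (le_trans (ler_normc_sum _ _ _))//.
apply: le_trans (ler_wpM2r _ (aK m)); last by rewrite exprn_ge0// divr_ge0// ltW.
rewrite [X in X * _](big_cat_nat (n := n) (p := m))//= mulrDl.
apply: (@le_trans _ _ ((\sum_(n <= i < m) normc (a i) * r ^+ i) * (`|t| / r) ^+ n)); last first.
  rewrite lerDr mulr_ge0 ?exprn_ge0//; last by rewrite divr_ge0// ltW.
  by apply: sumr_ge0 => i _; rewrite mulr_ge0 ?normc_ge0// exprn_ge0// ltW.
rewrite mulr_suml !big_nat; apply: ler_sum => k /andP[nk km].
rewrite Normc.normcM normcX normc_real -mulrA ler_wpM2l ?normc_ge0//.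
rewrite -[in leLHS](subnK nk) -[in X in r ^+ X](subnK nk) !exprD exprMn -mulrA exprVn.
rewrite [r ^+ n * _]mulrCA divff ?mulr1 ?expf_neq0 ?gt_eqF//.
by rewrite ler_wpM2r ?exprn_ge0// lerXn2r ?nnegrE// ltW.
Qed.

Lemma cvg_mobcoef r u v w a t K l : `|t| < r -> r < normc w -> (forall n, wsum r a n <= K) ->
  cvgc (psum a t) l -> cvgc (psum (mobcoef u v w a) t) ((u + v * t%:C / (w + t%:C)) * l).
Proof.
move=> tr rw aK al.
have r0 : 0 < r by exact: le_lt_trans tr.
have w0 : w != 0 by rewrite -normc_gt0 (lt_trans r0).
have wt0 : w + t%:C != 0.
  rewrite -normc_gt0; apply: (@lt_le_trans _ _ (normc w - `|t|)).
    by rewrite subr_gt0 (lt_trans tr).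
  by rewrite -normc_real -(normcN t%:C) -[X in w + X]opprK ler_normc_sub.
have bK := fun n => wsum_divcoef n (ltW r0) rw aK.
have bl : cvgc (psum (divcoef w a) t) (l / (w + t%:C)).
  apply: (@cvgc_shift _ 1); rewrite mulrC.
  have -> : (fun n => psum (divcoef w a) t (n + 1)) =
     (fun n => (w + t%:C)^-1 * (psum a t n.+1 + t%:C * (divcoef w a n * t%:C ^+ n))).
    apply/funext => n; rewrite addn1; apply: (mulfI wt0); rewrite psum_divcoef// mulVKf//.
    by rewrite exprS mulrCA.
  apply: cvgcZ; rewrite -[l]addr0; apply: cvgcD.
    by move: al; rewrite /cvgc -(cvg_shiftn 1); under eq_fun do rewrite addn1.
  by rewrite -(mulr0 t%:C); apply: cvgcZ; exact: psum_cvg_coef0 bK.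
apply: (@cvgc_shift _ 1).
have -> : (fun n => psum (mobcoef u v w a) t (n + 1)) =
   (fun n => u * psum a t (n + 1) + v * t%:C * psum (divcoef w a) t n).
  apply/funext => n; rewrite addn1 /psum /mobcoef.
  under eq_bigr do rewrite mulrDl -mulrA.
  rewrite big_split/= -mulr_sumr; congr (_ + _).
  rewrite big_nat_recl//= mulr0 mul0r add0r mulr_sumr; apply: eq_bigr => k _.
  by rewrite exprS; ring.
have -> : (u + v * t%:C / (w + t%:C)) * l = u * l + v * t%:C * (l / (w + t%:C)) by ring.
apply: cvgcD; last exact: cvgcZ.
apply: cvgcZ; by move: al; rewrite /cvgc -(cvg_shiftn 1).
Qed.

End weighted_series.

(** * Infinite products of Moebius factors *)

Section moebius_product.
Variables (R : realType) (u v w : nat -> R[i]).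

Fixpoint prodcoef k : nat -> R[i] :=
  if k is j.+1 then mobcoef (u j) (v j) (w j) (prodcoef j)
  else fun n => (n == 0%N)%:R.

Definition prodval (t : R) k : R[i] :=
  \prod_(0 <= j < k) (u j + v j * t%:C / (w j + t%:C)).

Variables (r D C : R) (g d : nat -> R) (k0 : nat).
Hypothesis r0 : 0 < r.
Hypothesis rw : forall k, r < normc (w k).
Hypothesis g01 : forall k, 0 <= g k <= 1.
Hypothesis d0 : forall k, 0 <= d k.
Hypothesis dD : forall n, \sum_(0 <= k < n) d k <= D.
(* The left-hand side bounds the norm of multiplication by [u + v t / (w + t)] on
   power series [a] normed by the limit of [wsum r a]. *)
Hypothesis factor_norm : forall k,
  normc (u k) + normc (v k) * (r / (normc (w k) - r)) <= g k * (1 + d k).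
Hypothesis factor_near1 : forall k, (k0 <= k)%N ->
  normc (u k - 1) + normc (v k) * (r / (normc (w k) - r)) <= C * d k.

(** The bound keeps the [g k], the sizes of the factors at the centre, so that all coefficients of
    the product inherit its smallness; the perturbations [1 + d k] together cost only the constant
    [expR D]. *)
Let K n := expR D * \prod_(0 <= k < n) g k.

Let prod_1d n : \prod_(0 <= k < n) (1 + d k) <= expR D.
Proof.
apply: (@le_trans _ _ (expR (\sum_(0 <= k < n) d k))); last by rewrite ler_expR.
rewrite expR_sum; apply: ler_prod => k _.
by rewrite addr_ge0//=; exact: expR_ge1Dx.
Qed.

Let prod_g_ge0 n : 0 <= \prod_(0 <= k < n) g k.
Proof. by apply: prodr_ge0 => k _; case/andP: (g01 k). Qed.

Let prod_g_decr m n : (m <= n)%N -> \prod_(0 <= k < n) g k <= \prod_(0 <= k < m) g k.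
Proof.
move=> mn; rewrite (big_cat_nat (n := m))//= ler_piMr//.
by rewrite big_nat; apply: prodr_ile1 => k _; exact: g01.
Qed.

Let K_decr m n : (m <= n)%N -> K n <= K m.
Proof. by move=> mn; rewrite /K ler_wpM2l ?expR_ge0// prod_g_decr. Qed.

Let K0 : K 0 = expR D. Proof. by rewrite /K big_nil mulr1. Qed.

Let wsum_prodcoef_aux k n : wsum r (prodcoef k) n <= \prod_(0 <= j < k) (g j * (1 + d j)).
Proof.
elim: k n => [|k ih] n.
  rewrite big_nil /wsum; case: n => [|n]; first by rewrite big_nil.
  rewrite big_nat_recl// (_ : prodcoef 0 0 = 1)// Normc.normc1 mul1r expr0 big1 ?addr0// => i _.
  by rewrite (_ : prodcoef 0 i.+1 = 0)// Normc.normc0 mul0r.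
rewrite big_nat_recr//= mulrC.
apply: le_trans (wsum_mobcoef _ _ _ (ltW r0) (rw k) ih) _.
rewrite ler_wpM2r//; first exact: le_trans (wsum_ge0 _ 0 (ltW r0)) (ih 0%N).
Qed.

Lemma wsum_prodcoef N k n : (N <= k)%N -> wsum r (prodcoef k) n <= K N.
Proof.
move=> Nk; apply: le_trans (K_decr Nk).
apply: le_trans (wsum_prodcoef_aux k n) _; rewrite big_split/= mulrC ler_wpM2r//.
Qed.

Lemma prodcoef_diff k n : prodcoef k.+1 n - prodcoef k n =
  mobcoef (u k - 1) (v k) (w k) (prodcoef k) n.
Proof. by rewrite /= /mobcoef; ring. Qed.

Let Cd k : (k0 <= k)%N -> C * d k <= `|C| * d k.
Proof. by move=> _; rewrite ler_wpM2r// ler_norm. Qed.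

(** Passing from [k] to [k.+1] factors adds the image of [prodcoef k] under multiplication by the
    factor minus 1, whose norm is at most [C * d k] for [k >= k0]. *)
Let prodcoef_cvg n : exists l, cvgc (fun k => prodcoef k n) l.
Proof.
apply: (@cvgc_summable _ _ (fun k => expR D / r ^+ n * `|C| * d k)
   (expR D / r ^+ n * `|C| * D) k0) => [k kk0|k|m].
- rewrite prodcoef_diff -[leRHS]mulrA mulrAC ler_pdivlMr ?exprn_gt0//.
  apply: normc_coef_le => [|m]; first exact: ltW.
  have pk j : wsum r (prodcoef k) j <= K 0 by exact: wsum_prodcoef.
  apply: le_trans (wsum_mobcoef _ _ _ (ltW r0) (rw k) pk) _.
  rewrite mulrC K0 ler_wpM2l ?expR_ge0//.
  exact: le_trans (factor_near1 kk0) (Cd kk0).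
- by rewrite !mulr_ge0 ?expR_ge0 ?invr_ge0// exprn_ge0// ltW.
- rewrite -mulr_sumr ler_wpM2l//.
  by rewrite !mulr_ge0 ?expR_ge0 ?invr_ge0// exprn_ge0// ltW.
Qed.

Let prodcoef_psum t k : `|t| < r -> cvgc (psum (prodcoef k) t) (prodval t k).
Proof.
move=> tr; elim: k => [|k ih].
  rewrite /prodval big_nil; apply: (@cvgc_shift _ 1); apply/cvgc_squeeze; last exact: cvg_cst.
  apply: nearW => n; rewrite addn1 /psum big_nat_recl//= mul1r expr0 big1 ?addr0 ?subrr ?Normc.normc0//.
  by move=> i _; rewrite mul0r.
rewrite /prodval big_nat_recr//= mulrC.
have pk j : wsum r (prodcoef k) j <= K 0 by exact: wsum_prodcoef.
exact: cvg_mobcoef tr (rw k) pk ih.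
Qed.

Let prodval_le t k : `|t| < r -> normc (prodval t k) <= expR D.
Proof.
move=> tr; apply: (cvgc_le (prodcoef_psum k tr)); apply: nearW => n.
rewrite -K0; apply: le_trans (wsum_prodcoef n (leq0n k)).
rewrite (le_trans (ler_normc_sum _ _ _))//; apply: ler_sum => i _.
rewrite Normc.normcM normcX normc_real ler_wpM2l ?normc_ge0//.
by rewrite lerXn2r ?nnegrE// ltW.
Qed.

Let prodval_cvg t : `|t| < r -> exists l, cvgc (prodval t) l.
Proof.
move=> tr.
apply: (@cvgc_summable _ _ (fun k => expR D * (`|C| * d k))
   (expR D * (`|C| * D)) k0) => [k kk0|k|m].
- have -> : prodval t k.+1 - prodval t k =
      prodval t k * ((u k - 1) + v k * (t%:C / (w k + t%:C))).
    by rewrite /prodval big_nat_recr//= -[in LHS]mulrA; ring.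
  rewrite Normc.normcM ler_pM ?normc_ge0 ?prodval_le//.
  apply: le_trans (Cd kk0); apply: le_trans (factor_near1 kk0).
  rewrite (le_trans (le_normcD _ _))// lerD2l Normc.normcM ler_wpM2l ?normc_ge0//.
  rewrite Normc.normcM Normc.normcV normc_real ler_pM ?invr_ge0 ?normc_ge0 ?(ltW tr)//.
  have wr : 0 < normc (w k) - r by rewrite subr_gt0.
  have ww : normc (w k) - r <= normc (w k + t%:C).
    apply: (@le_trans _ _ (normc (w k) - `|t|)); first by rewrite lerD2l lerN2 ltW.
    by rewrite -normc_real -(normcN t%:C) -[X in w k + X]opprK ler_normc_sub.
  by rewrite lef_pV2 ?posrE// (lt_le_trans wr).
- by rewrite !mulr_ge0 ?expR_ge0.
- by rewrite -!mulr_sumr ler_wpM2l ?expR_ge0// ler_wpM2l.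
Qed.

(** The limits over the number of factors and over the number of terms commute: all [prodcoef k]
    share the bound [K 0], so that [psum_tail] is uniform in [k]. *)
Theorem moebius_product_series : exists a : nat -> R[i],
  (forall N n, wsum r a n <= expR D * \prod_(0 <= k < N) g k) /\
  (forall t, `|t| < r -> exists2 l, cvgc (prodval t) l & cvgc (psum a t) l).
Proof.
have [a aP] := choice prodcoef_cvg.
exists a; split=> [N n|t tr].
  apply: (@ler_cvg_to _ \oo _ _ (fun k => wsum r (prodcoef k) n) (cst (K N))).
  - elim: n => [|n ih]; first by rewrite /wsum big_nil; under eq_fun do rewrite big_nil; exact: cvg_cst.
    rewrite /wsum big_nat_recr//=; under eq_fun do rewrite big_nat_recr//= .
    apply: cvgD => //; apply: cvgM; last exact: cvg_cst.
    exact: cvgc_norm.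
  - exact: cvg_cst.
  - by exists N => // k /= Nk; exact: wsum_prodcoef.
have [l lP] := prodval_cvg tr; exists l => //.
have tr1 : `| `|t| / r| < 1.
  by rewrite normrM normr_id gtr0_norm ?invr_gt0// ltr_pdivrMr// mul1r.
apply: (cvgc_squeeze (e := geometric (K 0) (`|t| / r))); last exact: cvg_geometric.
apply: nearW => n /=.
have cvgn : cvgc (fun k => prodval t k + (- 1) * psum (prodcoef k) t n) (l + (- 1) * psum a t n).
  apply: cvgcD => //; apply: cvgcZ.
  elim: n => [|n ih]; first by rewrite /psum !big_nil; under eq_fun do rewrite big_nil; exact: cvgc_cst.
  rewrite /psum big_nat_recr//=; under eq_fun do rewrite big_nat_recr//= .
  apply: cvgcD => //; rewrite mulrC; under eq_fun do rewrite mulrC; exact: cvgcZ.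
rewrite -[- psum a t n]mulN1r; apply: (cvgc_le cvgn); apply: nearW => k.
have ck : cvgc (fun m => psum (prodcoef k) t m + (- psum (prodcoef k) t n))
    (prodval t k + - psum (prodcoef k) t n).
  by apply: cvgcD; [exact: prodcoef_psum|exact: cvgc_cst].
rewrite mulN1r; apply: (cvgc_le ck); exists n => // m /= nm.
have pk j : wsum r (prodcoef k) j <= K 0 by exact: wsum_prodcoef.
exact: psum_tail pk nm.
Qed.

End moebius_product.

(** * Functions given locally by power series *)

Section local_power_series.
Variable R : realType.
Implicit Types (f : R -> R) (c : R ^nat) (x r t : R).

Definition local_pseries f x r c := forall t, `|t| < r -> pseries c t @ \oo --> f (x + t).

(** The differentiated geometric series, which serves as majorant when a power series is
    differentiated. *)
Lemma sum_arith_geo (q : R) n : 0 <= q < 1 ->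
  \sum_(0 <= k < n) k.+1%:R * q ^+ k <= ((1 - q) ^+ 2)^-1.
Proof.
move=> /andP[q0 q1].
have e : (1 - q) ^+ 2 * (\sum_(0 <= k < n) k.+1%:R * q ^+ k) = 1 - n.+1%:R * q ^+ n + n%:R * q ^+ n.+1.
  elim: n => [|n ih]; first by rewrite big_nil !expr0; ring.
  by rewrite big_nat_recr//= mulrDr ih !exprS -!natr1; ring.
rewrite -[leRHS]mul1r ler_pdivlMr ?exprn_gt0 ?subr_gt0// mulrC e.
rewrite -addrA gerDl addrC subr_le0 exprS mulrA ler_wpM2r ?exprn_ge0//.
apply: (@le_trans _ _ (n%:R * 1)); first by rewrite ler_wpM2l// ltW.
by rewrite mulr1 ler_nat.
Qed.

Lemma cvg_pseries_diffs c t z : `|t| < `|z| -> cvgn (pseries c z) ->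
  cvgn (pseries (pseries_diffs c) t).
Proof.
move=> tz /cvg_series_bounded[K [Kreal Kf]].
have z0 : 0 < `|z| by exact: le_lt_trans tz.
have cK n : `|c n| * `|z| ^+ n <= `|K| + 1.
  have := Kf (`|K| + 1); rewrite (le_lt_trans (ler_norm _)) ?ltrDl// => /(_ isT n).
  by move=> /(_ I) /=; rewrite normrM normrX.
set q := `|t| / `|z|.
have q01 : 0 <= q < 1 by rewrite divr_ge0//= ltr_pdivrMr// mul1r.
apply: normed_cvg.
apply: (@series_le_cvg _ _ (fun n => (`|K| + 1) / `|z| * (n.+1%:R * q ^+ n))) => [n|n|n|] /=.
- by rewrite normr_ge0.
- by rewrite !mulr_ge0 ?invr_ge0 ?addr_ge0// exprn_ge0//; case/andP: q01.
- rewrite /pseries_diffs !normrM normrX [`|n.+1%:R|]ger0_norm// -mulrA.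
  rewrite [leRHS]mulrCA ler_wpM2l// /q exprMn exprVn.
  have -> : (`|K| + 1) / `|z| * (`|t| ^+ n / `|z| ^+ n) = (`|K| + 1) * `|t| ^+ n / `|z| ^+ n.+1.
    by rewrite exprS invfM; ring.
  rewrite ler_pdivlMr ?exprn_gt0// mulrAC ler_wpM2r ?exprn_ge0//.
- apply: nondecreasing_is_cvgn.
    apply: nondecreasing_series => n _ _.
    by rewrite !mulr_ge0 ?invr_ge0 ?addr_ge0// exprn_ge0//; case/andP: q01.
  exists ((`|K| + 1) / `|z| * ((1 - q) ^+ 2)^-1) => _ [n _ <-].
  by rewrite /series/= -mulr_sumr ler_wpM2l//; exact: sum_arith_geo.
Qed.

Lemma is_derive_local_pseries f x r c t : local_pseries f x r c -> `|t| < r ->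
  is_derive (x + t) 1 f (limn (pseries (pseries_diffs c) t)).
Proof.
move=> fc tr.
have cvg_in s : `|s| < r -> cvgn (pseries c s) by move=> /fc fs; apply/cvg_ex; exists (f (x + s)).
(* Differentiating under the sum requires the series and its first two formal derivatives to
   converge at a point beyond [t]. Each formal derivative costs a little radius, hence three nested
   radii between [|t|] and [r]. *)
pose m1 := (`|t| + r) / 2; pose m2 := (`|t| + m1) / 2; pose m3 := (`|t| + m2) / 2.
have m1r : m1 < r by rewrite /m1; lra.
have m21 : m2 < m1 by rewrite /m2 /m1; lra.
have m32 : m3 < m2 by rewrite /m3 /m2 /m1; lra.
have tm3 : `|t| < m3 by rewrite /m3 /m2 /m1; lra.
have t0 := normr_ge0 t.
have nm1 : `|m1| = m1 by rewrite gtr0_norm//; lra.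
have nm2 : `|m2| = m2 by rewrite gtr0_norm//; lra.
have nm3 : `|m3| = m3 by rewrite gtr0_norm//; lra.
have d2 : cvgn (pseries (pseries_diffs c) m2).
  by apply: (@cvg_pseries_diffs _ _ m1); [rewrite nm1 nm2|apply: cvg_in; rewrite nm1].
have D : is_derive t 1 (fun y => limn (pseries c y)) (limn (pseries (pseries_diffs c) t)).
  apply: (@pseries_snd_diffs _ _ m3).
  - by apply: cvg_in; rewrite nm3; lra.
  - by apply: (@cvg_pseries_diffs _ _ m1); [rewrite nm1 nm3; lra|apply: cvg_in; rewrite nm1].
  - by apply: (@cvg_pseries_diffs _ _ m2) => //; rewrite nm2 nm3.
  - by rewrite nm3.
have shift1 : is_derive (x + t) 1 (fun y : R => y - x) 1.
  rewrite -[X in is_derive _ _ _ X]subr0.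
  exact: (is_deriveB (is_derive_id (x + t) (1:R)) (is_derive_cst x (x + t) (1:R))).
have D1 : is_derive (x + t) 1 ((fun y => limn (pseries c y)) \o (fun y => y - x))
    (limn (pseries (pseries_diffs c) t) * 1).
  by apply: is_derive1_comp shift1; rewrite addrAC subrr add0r; exact: D.
rewrite mulr1 in D1.
have nearE : {near (x + t), ((fun y => limn (pseries c y)) \o (fun y => y - x)) =1 f}.
  apply/nbhs_ballP; exists (r - `|t|) => /=; first by rewrite subr_gt0.
  move=> y; rewrite /ball/= => xy.
  have yr : `|y - x| < r.
    have -> : y - x = t - (x + t - y) by ring.
    by rewrite (le_lt_trans (ler_normB _ _))//; lra.
  have := fc _ yr; rewrite addrCA subrr addr0 => h.
  exact: cvg_lim h.
split; first by apply: near_eq_derivable nearE _; case: D1.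
by rewrite -(near_eq_derive _ nearE); case: D1.
Qed.

Lemma local_pseries_derive1 f x r c : local_pseries f x r c ->
  local_pseries (derive1 f) x r (pseries_diffs c).
Proof.
move=> fc t tr.
have [_ D] := is_derive_local_pseries fc tr.
rewrite derive1E D.
suff : cvgn (pseries (pseries_diffs c) t) by [].
have t0 := normr_ge0 t.
have nm : `|(`|t| + r) / 2| = (`|t| + r) / 2 by rewrite gtr0_norm//; lra.
apply: (@cvg_pseries_diffs _ _ ((`|t| + r) / 2)); first by rewrite nm; lra.
apply/cvg_ex; exists (f (x + (`|t| + r) / 2)); apply: fc; rewrite nm; lra.
Qed.

Lemma local_pseries_derive1n f x r c n : local_pseries f x r c ->
  local_pseries (derive1n n f) x r (iter n (@pseries_diffs R) c).
Proof.
by move=> fc; elim: n => // n ih; rewrite derive1nS/=; exact: local_pseries_derive1.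
Qed.

Lemma iter_pseries_diffs0 c n : iter n (@pseries_diffs R) c 0 = n`!%:R * c n.
Proof.
have key m k : iter m (@pseries_diffs R) c k = ((m + k)`!%:R / k`!%:R) * c (m + k)%N.
  elim: m k => [|m ih] k; first by rewrite /= add0n divff ?mul1r// pnatr_eq0 -lt0n fact_gt0.
  rewrite /= /pseries_diffs ih addnS addSn factS [(k.+1)`!]factS !natrM invfM.
  have k0 : k.+1%:R != 0 :> R by rewrite pnatr_eq0.
  move: k0 (k`!%:R^-1 : R) (c (m + k).+1) ((m + k).+1%:R : R) ((m + k)`!%:R : R).
  by move: (k.+1%:R : R) => A A0 B E F G; field.
by rewrite key addn0 fact0 divr1.
Qed.

Lemma local_pseries0 f x r c : 0 < r -> local_pseries f x r c -> f x = c 0.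
Proof.
move=> r0 /(_ 0); rewrite normr0 addr0 => /(_ r0) fc.
suff c0 : pseries c 0 @ \oo --> c 0 by exact: cvg_unique fc c0.
rewrite -(cvg_shiftn 1) /=.
rewrite (_ : (fun n => _) = cst (c 0)); first exact: cvg_cst.
apply/funext => n; rewrite addn1 /pseries /series/= big_nat_recl//= expr0 mulr1.
by rewrite big1 ?addr0// => i _; rewrite exprS mul0r mulr0.
Qed.

Lemma local_pseries_derive1n0 f x r c n : 0 < r -> local_pseries f x r c ->
  derive1n n f x = n`!%:R * c n.
Proof.
move=> r0 fc; rewrite -iter_pseries_diffs0.
exact: local_pseries0 r0 (local_pseries_derive1n (n := n) fc).
Qed.

Lemma derivable_local_pseries f x r c n : 0 < r -> local_pseries f x r c ->
  derivable (derive1n n f) x 1.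
Proof.
move=> r0 fc; have := is_derive_local_pseries (t := 0) (local_pseries_derive1n (n := n) fc).
by rewrite normr0 addr0 => /(_ r0)[].
Qed.

End local_power_series.

(** * Integrals over the real line *)

Section real_integrals.
Variable R : realType.
Local Notation mu := (@lebesgue_measure R).
Implicit Types (f g u : R -> R).

Definition Rintegrable f := mu.-integrable setT (EFin \o f).

(* [R] carries two convertible measurable structures, with different displays. *)
Lemma measurable_EFin_lebesgue f : measurable_fun setT f ->
  measurable_fun [set: measurableTypeR R] (EFin \o f).
Proof. by move=> mf; apply/measurable_EFinP; exact: mf. Qed.

Lemma Rintegrable_le f g : measurable_fun setT f -> (forall x, `|f x| <= g x) ->
  Rintegrable g -> Rintegrable f.
Proof.
move=> mf fg; apply: le_integrable => //; first exact: measurable_EFin_lebesgue.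
by move=> x _ /=; rewrite lee_fin (le_trans (fg x))// ler_norm.
Qed.

Lemma RintegrableD f g : Rintegrable f -> Rintegrable g -> Rintegrable (fun x => f x + g x).
Proof. by move=> If Ig; have := integrableD measurableT If Ig; apply: eq_integrable. Qed.

Lemma RintegrableB f g : Rintegrable f -> Rintegrable g -> Rintegrable (fun x => f x - g x).
Proof. by move=> If Ig; have := integrableB measurableT If Ig; apply: eq_integrable. Qed.

Lemma RintegrableZ (k : R) f : Rintegrable f -> Rintegrable (fun x => k * f x).
Proof. by move=> If; have := integrableZl measurableT k If; apply: eq_integrable. Qed.

Lemma Rintegrable_norm f : Rintegrable f -> Rintegrable (fun x => `|f x|).
Proof. by move=> If; have := integrable_abse If; apply: eq_integrable. Qed.

Lemma Rintegrable_measurable f : Rintegrable f -> measurable_fun setT f.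
Proof. by move=> /measurable_int /measurable_EFinP. Qed.

Lemma Rintegrable_Mbounded f g (M : R) : Rintegrable f -> measurable_fun setT g ->
  (forall x, `|g x| <= M) -> Rintegrable (fun x => f x * g x).
Proof.
move=> If mg gM; apply: (@Rintegrable_le _ (fun x => M * `|f x|)).
- by apply: measurable_funM => //; exact: Rintegrable_measurable.
- by move=> x; rewrite normrM mulrC ler_wpM2r.
- by apply: RintegrableZ; exact: Rintegrable_norm.
Qed.

Lemma normr_Rintegral_le f g : Rintegrable f -> Rintegrable g -> (forall x, `|f x| <= g x) ->
  `|Rintegral mu setT f| <= Rintegral mu setT g.
Proof.
move=> If Ig fg; apply: (le_trans (le_normr_Rintegral _ _)) => //.
by apply: le_Rintegral => //; exact: Rintegrable_norm.
Qed.

Lemma Rintegral_dominated (f_ : nat -> R -> R) f g :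
  (forall n, measurable_fun setT (f_ n)) -> Rintegrable g ->
  (forall x, f_ n x @[n --> \oo] --> f x) -> (forall n x, `|f_ n x| <= g x) ->
  Rintegrable f /\ Rintegral mu setT (f_ n) @[n --> \oo] --> Rintegral mu setT f.
Proof.
move=> mf Ig ff fg.
have mlim : measurable_fun setT f by apply: (measurable_fun_cvg mf) => x _; exact: ff.
have [|||||If _ cvgf] := @dominated_convergence _ _ _ mu setT measurableT
    (fun n => EFin \o f_ n) (EFin \o f) (EFin \o g).
- by move=> n; exact: measurable_EFin_lebesgue.
- exact: measurable_EFin_lebesgue.
- by apply: aeW => x _; apply: cvg_EFin; [exact: nearW|exact: ff].
- exact: Ig.
- by apply: aeW => x n _ /=; rewrite lee_fin.
split => //; apply: fine_cvg; rewrite fineK; last exact: integrable_fin_num.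
exact: cvgf.
Qed.

(** Dominated convergence for the restrictions of [f], with majorant [|f|]. *)
Lemma Rintegral_cvg_sets (D_ : nat -> set R) (D : set R) f : Rintegrable f ->
  (forall n, measurable (D_ n)) -> (forall n, D_ n `<=` D) ->
  (forall x, D x -> \forall n \near \oo, D_ n x) ->
  Rintegral mu (D_ n) f @[n --> \oo] --> Rintegral mu D f.
Proof.
move=> If mD DD Dx.
under eq_fun do rewrite Rintegral_mkcond; rewrite Rintegral_mkcond.
have mf := Rintegrable_measurable If.
apply: (proj2 (@Rintegral_dominated _ _ (fun x => `|f x|) _ _ _ _)).
- by move=> n; apply/measurable_restrict => //; exact: measurable_funTS.
- exact: Rintegrable_norm.
- move=> x; have [xD|xD] := pselect (D x).
    apply: cvg_near_cst; apply: filterS (Dx _ xD) => n xDn.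
    by rewrite !patchE !mem_set.
  apply: cvg_near_cst; apply: nearW => n; rewrite !patchE !memNset//.
  by move=> /DD.
- by move=> n x; rewrite patchE; case: ifP; rewrite ?normr0.
Qed.

Lemma continuous_FTC (f F : R -> R) a b : a < b -> continuous f ->
  (forall x, is_derive x (1 : R) F (f x)) -> Rintegral mu `[a, b] f = F b - F a.
Proof.
move=> ab cf dF.
have cF : continuous F.
  by move=> x; apply: differentiable_continuous; apply/derivable1_diffP; case: (dF x).
rewrite /Rintegral (@continuous_FTC2 _ f F)//.
- by apply: continuous_subspaceT.
- split=> [x _||]; first by case: (dF x).
  + by apply: cvg_at_right_filter; exact: cF.
  + by apply: cvg_at_left_filter; exact: cF.
- by move=> x _; rewrite derive1E; case: (dF x).
Qed.

Lemma Rintegral_derivative (f F : R -> R) l : continuous f -> Rintegrable f ->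
  (forall x, is_derive x (1 : R) F (f x)) ->
  (F n%:R - F (- n%:R) @[n --> \oo] --> l) -> Rintegral mu setT f = l.
Proof.
move=> cf If dF Fl.
(* The successor keeps the intervals nondegenerate, as [continuous_FTC] demands. *)
have := @Rintegral_cvg_sets (fun n => `[- n.+1%:R, n.+1%:R]%classic) setT f If.
move=> /(_ (fun=> measurable_itv _) (fun _ _ _ => I)) h.
apply: (cvg_unique _ (h _)) => //.
- move=> x _; near=> n; rewrite /= in_itv/= -ler_norml.
  apply: (@le_trans _ _ n%:R); last by rewrite ler_nat.
  by near: n; exact: nbhs_infty_ger.
- have E n : Rintegral mu `[- n.+1%:R, n.+1%:R] f = F n.+1%:R - F (- n.+1%:R).
    by apply: continuous_FTC => //; rewrite gtrN.
  rewrite /=; under eq_fun do rewrite E.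
  by move: Fl; rewrite -(cvg_shiftn 1); under eq_fun do rewrite addn1.
Unshelve. all: by end_near. Qed.

Lemma Rintegral_derivative_ge0 (f F : R -> R) l : continuous f ->
  Rintegrable (f \_ `[0, +oo[) ->
  (forall x, is_derive x (1 : R) F (f x)) ->
  (F n%:R @[n --> \oo] --> l) -> Rintegral mu setT (f \_ `[0, +oo[) = l - F 0.
Proof.
move=> cf If dF Fl.
have := @Rintegral_cvg_sets (fun n => `[0, n.+1%:R]%classic) `[0, +oo[%classic _ If.
move=> /(_ (fun=> measurable_itv _)) h.
have -> : f \_ `[0, +oo[ = (f \_ `[0, +oo[) \_ `[0, +oo[.
  by apply/funext => x; rewrite !patchE; case: ifP.
rewrite -Rintegral_mkcond.
suff key : Rintegral mu `[0, n.+1%:R] (f \_ `[0, +oo[) @[n --> \oo] --> l - F 0.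
  apply: (cvg_unique _ (h _ _) key) => //.
    by move=> n x; rewrite /= !in_itv/= => /andP[->].
  move=> x; rewrite /= in_itv/= andbT => x0; near=> n; rewrite /= in_itv/= x0/=.
  apply: (@le_trans _ _ n%:R); last by rewrite ler_nat.
  by near: n; exact: nbhs_infty_ger.
- have E n : Rintegral mu `[0, n.+1%:R] (f \_ `[0, +oo[) = F n.+1%:R - F 0.
    rewrite -(continuous_FTC _ cf dF)//; apply: eq_Rintegral => x.
    move=> /set_mem /=; rewrite in_itv/= => /andP[x0 _].
    by rewrite mem_set//= in_itv/= x0.
  under eq_fun do rewrite E.
  apply: cvgB; last exact: cvg_cst.
  by move: Fl; rewrite -(cvg_shiftn 1); under eq_fun do rewrite addn1.
Unshelve. all: by end_near. Qed.

End real_integrals.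

(** * Laplace transforms of sine and cosine *)

Section laplace.
Variable R : realType.
Local Notation mu := (@lebesgue_measure R).
Variable a : R.
Hypothesis a0 : 0 < a.

Lemma Rintegrable_exponential_pdf : Rintegrable (exponential_pdf a).
Proof. exact: integrable_exponential_pdf. Qed.

(** [c1] and [s1] are antiderivatives in [t] of exp (- a t) cos (x t) and exp (- a t) sin (x t),
    multiplied by [a ^+ 2 + x ^+ 2] to avoid denominators. *)
Let c1 (x t : R) := expR (- a * t) * (x * sin (x * t) - a * cos (x * t)).
Let s1 (x t : R) := - expR (- a * t) * (x * cos (x * t) + a * sin (x * t)).

Let expN0 : expR (- a * n%:R) @[n --> \oo] --> (0 : R).
Proof.
have h : geometric 1 (expR (- a)) n @[n --> \oo] --> (0 : R).
  by apply: cvg_geometric; rewrite ger0_norm ?expR_ge0// expR_lt1 oppr_lt0.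
by move: h; under eq_fun do rewrite /= mul1r -expRM_natr.
Qed.

Let trig_bound (p q y : R) : `|p * sin y + q * cos y| <= `|p| + `|q|.
Proof.
rewrite (le_trans (ler_normD _ _))// !normrM lerD// -[leRHS]mulr1 ler_wpM2l//.
  by rewrite ler_norml sin_geN1 sin_le1.
by rewrite ler_norml cos_geN1 cos_le1.
Qed.

Let is_derive_c1 x t : is_derive t (1 : R) (c1 x)
  ((a ^+ 2 + x ^+ 2) * (expR (- a * t) * cos (x * t))).
Proof. by apply: is_derive_eq; rewrite /GRing.scale/=; ring. Qed.

Let is_derive_s1 x t : is_derive t (1 : R) (s1 x)
  ((a ^+ 2 + x ^+ 2) * (expR (- a * t) * sin (x * t))).
Proof. by apply: is_derive_eq; rewrite /GRing.scale/=; ring. Qed.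

Let c1_bound x t : `|c1 x t| <= expR (- a * t) * (`|x| + a).
Proof.
rewrite normrM ger0_norm ?expR_ge0// ler_wpM2l ?expR_ge0//.
by rewrite -mulNr (le_trans (trig_bound _ _ _))// normrN (gtr0_norm a0).
Qed.

Let s1_bound x t : `|s1 x t| <= expR (- a * t) * (`|x| + a).
Proof.
rewrite /s1 normrM normrN [`|expR _|]ger0_norm ?expR_ge0// ler_wpM2l ?expR_ge0//.
by rewrite addrC (le_trans (trig_bound _ _ _))// (gtr0_norm a0) addrC.
Qed.

Let cvg0 (F : R -> R) (M : R) : (forall t, `|F t| <= expR (- a * t) * M) ->
  F n%:R @[n --> \oo] --> (0 : R).
Proof.
move=> FM; apply/norm_cvg0P.
apply: (@squeeze_cvgr _ _ _ _ (cst 0) (fun n => expR (- a * n%:R) * M)).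
- by apply: nearW => n; rewrite normr_ge0/= FM.
- exact: cvg_cst.
- by rewrite -(mul0r M); apply: cvgM => //; exact: cvg_cst.
Qed.

Lemma Rintegrable_exponential_pdfM (g : R -> R) : continuous g -> (forall t, `|g t| <= 1) ->
  Rintegrable (fun t => exponential_pdf a t * g t).
Proof.
move=> cg g1; apply: (Rintegrable_Mbounded Rintegrable_exponential_pdf _ g1).
exact: continuous_measurable_fun.
Qed.

Let expN_cont : continuous (fun t : R => expR (- a * t)).
Proof.
move=> t; apply: differentiable_continuous; apply/derivable1_diffP.
exact: ex_derive.
Qed.

Let laplace_FTC (g G : R -> R) (x M : R) : continuous g -> (forall t, `|g t| <= 1) ->
  (forall t, is_derive t (1 : R) G ((a ^+ 2 + x ^+ 2) * (expR (- a * t) * g t))) ->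
  (forall t, `|G t| <= expR (- a * t) * M) ->
  Rintegral mu setT (fun t => exponential_pdf a t * g t) = - a * G 0 / (a ^+ 2 + x ^+ 2).
Proof.
move=> cg g1 dG GM.
have Ig := Rintegrable_exponential_pdfM cg g1.
have E : (fun t => exponential_pdf a t * g t) =
    (fun t => a * (expR (- a * t) * g t)) \_ `[0, +oo[.
  apply/funext => t; rewrite /exponential_pdf !patchE; case: ifP => _; first by rewrite mulrA.
  by rewrite mul0r.
rewrite E in Ig *.
have cf : continuous (fun t => a * (expR (- a * t) * g t)).
  by move=> t; apply: cvgM; [exact: cvg_cst|apply: cvgM; [exact: expN_cont|exact: cg]].
have dGa t : is_derive t (1 : R) (fun t => a / (a ^+ 2 + x ^+ 2) * G t)
    (a * (expR (- a * t) * g t)).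
  have -> : a * (expR (- a * t) * g t) = (a / (a ^+ 2 + x ^+ 2)) *:
      ((a ^+ 2 + x ^+ 2) * (expR (- a * t) * g t)).
    by rewrite /GRing.scale/= [RHS]mulrA divfK// gt_eqF// ltr_wpDr ?sqr_ge0// exprn_gt0.
  exact: is_deriveZ.
have Ga : (fun t => a / (a ^+ 2 + x ^+ 2) * G t) n%:R @[n --> \oo] --> (0 : R).
  by rewrite -(mulr0 (a / (a ^+ 2 + x ^+ 2))); apply: cvgM; [exact: cvg_cst|exact: cvg0 GM].
by rewrite (Rintegral_derivative_ge0 cf Ig dGa Ga) sub0r; ring.
Qed.

(** With the sine version, these are the real and imaginary parts of the identity that the integral
    of a exp (- a t) exp (i x t) over t >= 0 is a / (a - i x). It presents the factors of the
    product as averages of characters of nonnegative frequency. *)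
Lemma Rintegral_exponential_cos x :
  Rintegral mu setT (fun t => exponential_pdf a t * cos (x * t)) = a ^+ 2 / (a ^+ 2 + x ^+ 2).
Proof.
have cg : continuous (fun t => cos (x * t)).
  by move=> t; apply: differentiable_continuous; apply/derivable1_diffP; exact: ex_derive.
have g1 t : `|cos (x * t)| <= 1 by rewrite ler_norml cos_geN1 cos_le1.
rewrite (laplace_FTC cg g1 (is_derive_c1 x) (c1_bound x)).
by rewrite /c1 !mulr0 expR0 sin0 cos0; ring.
Qed.

Lemma Rintegral_exponential_sin x :
  Rintegral mu setT (fun t => exponential_pdf a t * sin (x * t)) = a * x / (a ^+ 2 + x ^+ 2).
Proof.
have cg : continuous (fun t => sin (x * t)).
  by move=> t; apply: differentiable_continuous; apply/derivable1_diffP; exact: ex_derive.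
have g1 t : `|sin (x * t)| <= 1 by rewrite ler_norml sin_geN1 sin_le1.
rewrite (laplace_FTC cg g1 (is_derive_s1 x) (s1_bound x)).
by rewrite /s1 !mulr0 expR0 sin0 cos0; ring.
Qed.

End laplace.

(** * Fubini's theorem for a bounded kernel *)

Section fubini.
Variable R : realType.
Local Notation mu := (@lebesgue_measure R).

Lemma Rintegral_swap (u w : R -> R) (k : R -> R -> R) :
  Rintegrable u -> Rintegrable w ->
  measurable_fun setT (fun p : R * R => k p.1 p.2) -> (forall x t, `|k x t| <= 1) ->
  Rintegral mu setT (fun x => u x * Rintegral mu setT (fun t => w t * k x t)) =
  Rintegral mu setT (fun t => w t * Rintegral mu setT (fun x => u x * k x t)).
Proof.
move=> Iu Iw mk k1.
have mu_ := Rintegrable_measurable Iu; have mw_ := Rintegrable_measurable Iw.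
have mk1 x : measurable_fun setT (k x) by exact: measurable_fun_pair2 mk.
have mk2 t : measurable_fun setT (k ^~ t) by exact: measurable_fun_pair1 mk.
pose f (p : measurableTypeR R * measurableTypeR R) := (u p.1 * (w p.2 * k p.1 p.2))%:E.
have mf : measurable_fun setT f.
  apply/measurable_EFinP; apply: measurable_funM; first exact: measurableT_comp mu_ _.
  apply: measurable_funM; first exact: measurableT_comp mw_ _.
  exact: mk.
have Iwk x : Rintegrable (fun t => w t * k x t) by exact: Rintegrable_Mbounded.
have Iuk t : Rintegrable (fun x => u x * k x t) by exact: Rintegrable_Mbounded.
have If : (mu \x mu)%E.-integrable setT f.
  apply/integrable12ltyP => //.
  have step x : (\int[mu]_t `|f (x, t)| <= (`|u x| * Rintegral mu setT (fun t => `|w t|))%:E)%E.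
    rewrite EFinM fineK; last exact: integrable_fin_num (Rintegrable_norm Iw).
    rewrite -integralZl//; last exact: Rintegrable_norm.
    apply: ge0_le_integral => //.
    - by apply: measurableT_comp => //; exact: measurable_fun_pair2 mf.
    - apply: measurable_EFin_lebesgue.
      by apply: measurable_funM => //; exact: measurableT_comp.
    - move=> t _; rewrite /= -EFinM lee_fin !normrM ler_wpM2l// -[leRHS]mulr1 ler_wpM2l//.
  have Iu' : Rintegrable (fun x => `|u x| * Rintegral mu setT (fun t => `|w t|)).
    have := RintegrableZ (Rintegral mu setT (fun t => `|w t|)) (Rintegrable_norm Iu).
    by apply: eq_integrable => // x _; rewrite /= mulrC.
  apply: (@le_lt_trans _ _ (\int[mu]_x (`|u x| * Rintegral mu setT (fun t => `|w t|))%:E)%E).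
    apply: ge0_le_integral => //.
    - by move=> x _; exact: integral_ge0.
    - by apply: (measurable_fun_fubini_tonelli_F (abse \o f)) => //=; exact: measurableT_comp.
    - exact: (measurable_int _ Iu').
  by rewrite -ge0_fin_numE ?integral_ge0//; [exact: integrable_fin_num Iu'|
    move=> x _; rewrite lee_fin mulr_ge0// Rintegral_ge0].
have inner1 x : (\int[mu]_t f (x, t))%E = (u x * Rintegral mu setT (fun t => w t * k x t))%:E.
  rewrite /f /=; under eq_integral do rewrite EFinM.
  rewrite integralZl//; last exact: Iwk.
  rewrite EFinM /Rintegral fineK//; exact: integrable_fin_num (Iwk x).
have inner2 t : (\int[mu]_x f (x, t))%E = (w t * Rintegral mu setT (fun x => u x * k x t))%:E.
  rewrite /f /=; under eq_integral do rewrite mulrCA EFinM.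
  rewrite integralZl//; last exact: Iuk.
  rewrite EFinM /Rintegral fineK//; exact: integrable_fin_num (Iuk t).
have E1 : (\int[mu]_x (u x * Rintegral mu setT (fun t => w t * k x t))%:E =
    \int[mu]_x \int[mu]_t f (x, t))%E.
  by apply: eq_integral => x _; rewrite inner1.
have E2 : (\int[mu]_t (w t * Rintegral mu setT (fun x => u x * k x t))%:E =
    \int[mu]_t \int[mu]_x f (x, t))%E.
  by apply: eq_integral => t _; rewrite inner2.
by rewrite {1}/Rintegral [in RHS]/Rintegral E1 E2 (Fubini If).
Qed.

End fubini.

(** * Integrals of odd and even functions *)

Section symmetric_integrals.
Variable R : realType.
Local Notation mu := (@lebesgue_measure R).
Implicit Types f : R -> R.

Lemma Rintegral_reflect f a b : a <= b -> continuous f ->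
  Rintegral mu `[- b, - a] f = Rintegral mu `[a, b] (fun x => f (- x)).
Proof.
move=> ab cf; rewrite /Rintegral integration_by_substitution_oppr//.
exact: continuous_subspaceT.
Qed.

Let cvg_symm f : Rintegrable f ->
  Rintegral mu `[- n%:R, n%:R] f @[n --> \oo] --> Rintegral mu setT f.
Proof.
move=> If; apply: Rintegral_cvg_sets => // x _; near=> n; rewrite /= in_itv/= -ler_norml.
by near: n; exact: nbhs_infty_ger.
Unshelve. all: by end_near. Qed.

Lemma Rintegral_odd f : continuous f -> Rintegrable f -> (forall x, f (- x) = - f x) ->
  Rintegral mu setT f = 0.
Proof.
move=> cf If fodd.
have In n : mu.-integrable `[- n%:R, n%:R] (EFin \o f).
  by apply: integrableS If.
have E n : Rintegral mu `[- n%:R, n%:R] f = 0.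
  have n0 : - n%:R <= n%:R :> R by rewrite (@le_trans _ _ 0) ?oppr_le0.
  have := Rintegral_reflect n0 cf; rewrite opprK.
  under [in RHS]eq_Rintegral do rewrite fodd -mulN1r.
  rewrite RintegralZl// mulN1r => /eqP.
  by rewrite -subr_eq0 opprK -mulr2n mulrn_eq0/= => /eqP.
have := cvg_symm If; under eq_fun do rewrite E.
by move=> h; apply: cvg_unique h _ => //; exact: cvg_cst.
Qed.

Lemma Rintegral_even f : continuous f -> Rintegrable f -> (forall x, f (- x) = f x) ->
  Rintegral mu setT f = 2 * Rintegral mu `[0, +oo[ f.
Proof.
move=> cf If feven.
have E n : Rintegral mu `[- n%:R, n%:R] f = 2 * Rintegral mu `[0, n%:R] f.
  have n0 : 0 <= n%:R :> R by [].
  have := Rintegral_reflect n0 cf; rewrite oppr0.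
  under [in RHS]eq_Rintegral do rewrite feven.
  have In : mu.-integrable `[- n%:R, n%:R] (EFin \o f) by apply: integrableS If.
  have := @Rintegral_itvB _ f (BLeft (- n%:R)) (BRight n%:R) 0 In.
  rewrite !bnd_simp oppr_le0 => /(_ n0 n0).
  rewrite Rintegral_itv_obnd_cbnd; last by apply: integrableS If.
  by move=> + h2; rewrite h2 => /eqP; rewrite subr_eq => /eqP ->; rewrite mulr_natl mulr2n.
have h1 := cvg_symm If.
have h2 : Rintegral mu `[0, n%:R] f @[n --> \oo] --> Rintegral mu `[0, +oo[ f.
  apply: Rintegral_cvg_sets => //.
    by move=> n x; rewrite /= !in_itv/= => /andP[->].
  move=> x; rewrite /= in_itv/= andbT => x0; near=> n; rewrite /= in_itv/= x0/=.
  by near: n; exact: nbhs_infty_ger.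
suff h3 : Rintegral mu `[- n%:R, n%:R] f @[n --> \oo] --> 2 * Rintegral mu `[0, +oo[ f.
  exact: cvg_unique h1 h3.
by under eq_fun do rewrite E; apply: cvgM => //; exact: cvg_cst.
Unshelve. all: by end_near. Qed.

Lemma Rintegrable_oneDsqrV : Rintegrable (fun x : R => (1 + x ^+ 2)^-1).
Proof.
have c : continuous (fun x : R => (1 + x ^+ 2)^-1) by exact: continuous_oneDsqrV.
have p x : 0 <= (1 + x ^+ 2)^-1 :> R by rewrite invr_ge0 addr_ge0// sqr_ge0.
apply/integrableP; split.
  by apply: measurable_EFin_lebesgue; exact: continuous_measurable_fun.
under eq_integral => x _ do rewrite /= ger0_norm ?p//.
rewrite ge0_symfun_integralT//; last by move=> x; rewrite /= sqrrN.
rewrite (_ : [set x | 0 <= x] = `[0, +oo[%classic); last first.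
  by apply/seteqP; split => x /=; rewrite in_itv/= andbT.
by rewrite integral0y_oneDsqr -EFinM ltry.
Qed.

End symmetric_integrals.

(** * Poisson integrals *)

Section poisson_kernel.
Variable R : realType.
Local Notation mu := (@lebesgue_measure R).
Implicit Types (u v : R -> R).

Lemma continuous_cosM (c : R) : continuous (fun x : R => cos (x * c)).
Proof. by move=> x; apply: differentiable_continuous; apply/derivable1_diffP; exact: ex_derive. Qed.

Lemma continuous_sinM (c : R) : continuous (fun x : R => sin (x * c)).
Proof. by move=> x; apply: differentiable_continuous; apply/derivable1_diffP; exact: ex_derive. Qed.

Lemma normr_cos (x : R) : `|cos x| <= 1.
Proof. by rewrite ler_norml cos_geN1 cos_le1. Qed.

Lemma normr_sin (x : R) : `|sin x| <= 1.
Proof. by rewrite ler_norml sin_geN1 sin_le1. Qed.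

Lemma Rintegrable_cos u (c : R) : Rintegrable u -> Rintegrable (fun x => u x * cos (x * c)).
Proof.
move=> Iu; apply: (Rintegrable_Mbounded Iu _ (fun x => normr_cos (x * c))).
by apply: continuous_measurable_fun; exact: continuous_cosM.
Qed.

Lemma Rintegrable_sin u (c : R) : Rintegrable u -> Rintegrable (fun x => u x * sin (x * c)).
Proof.
move=> Iu; apply: (Rintegrable_Mbounded Iu _ (fun x => normr_sin (x * c))).
by apply: continuous_measurable_fun; exact: continuous_sinM.
Qed.

Let measurable_shiftM (l : R) : measurable_fun setT (fun p : R * R => (p.1 - l) * p.2).
Proof.
apply: measurable_funM; last exact: measurable_snd.
by apply: measurable_funB => //; exact: measurable_fst.
Qed.

Lemma Rintegral_cos_shift u (l t : R) : Rintegrable u ->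
  Rintegral mu setT (fun x => u x * cos ((x - l) * t)) =
  cos (l * t) * Rintegral mu setT (fun x => u x * cos (x * t)) +
  sin (l * t) * Rintegral mu setT (fun x => u x * sin (x * t)).
Proof.
move=> Iu; have Ic := Rintegrable_cos t Iu; have Is := Rintegrable_sin t Iu.
rewrite -!RintegralZl// -RintegralD//; [|exact: RintegrableZ|exact: RintegrableZ].
by apply: eq_Rintegral => x _; rewrite mulrBl cosB; ring.
Qed.

Lemma Rintegral_sin_shift u (l t : R) : Rintegrable u ->
  Rintegral mu setT (fun x => u x * sin ((x - l) * t)) =
  cos (l * t) * Rintegral mu setT (fun x => u x * sin (x * t)) -
  sin (l * t) * Rintegral mu setT (fun x => u x * cos (x * t)).
Proof.
move=> Iu; have Ic := Rintegrable_cos t Iu; have Is := Rintegrable_sin t Iu.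
rewrite -!RintegralZl// -RintegralB//; [|exact: RintegrableZ|exact: RintegrableZ].
by apply: eq_Rintegral => x _; rewrite mulrBl sinB; ring.
Qed.

Section laplace_swap.
Variables (a l : R) (u : R -> R).
Hypotheses (a0 : 0 < a) (Iu : Rintegrable u).

(** Fubini applied to the Laplace representation of the kernel: the Poisson integrals of [u] are
    determined by its cosine and sine transforms. The kernel is normalised to have maximum 1, not
    mass 1. *)
Lemma Rintegral_poisson :
  Rintegral mu setT (fun x => u x * (a ^+ 2 / (a ^+ 2 + (x - l) ^+ 2))) =
  Rintegral mu setT (fun t => exponential_pdf a t *
     Rintegral mu setT (fun x => u x * cos ((x - l) * t))).
Proof.
rewrite -(@Rintegral_swap _ u (exponential_pdf a) (fun x t => cos ((x - l) * t)))//.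
- by apply: eq_Rintegral => x _; rewrite Rintegral_exponential_cos.
- exact: Rintegrable_exponential_pdf.
- apply: (measurableT_comp (f := cos)); last exact: measurable_shiftM.
  by apply: continuous_measurable_fun; exact: continuous_cos.
- by move=> *; exact: normr_cos.
Qed.

Lemma Rintegral_conj_poisson :
  Rintegral mu setT (fun x => u x * (a * (x - l) / (a ^+ 2 + (x - l) ^+ 2))) =
  Rintegral mu setT (fun t => exponential_pdf a t *
     Rintegral mu setT (fun x => u x * sin ((x - l) * t))).
Proof.
rewrite -(@Rintegral_swap _ u (exponential_pdf a) (fun x t => sin ((x - l) * t)))//.
- by apply: eq_Rintegral => x _; rewrite Rintegral_exponential_sin.
- exact: Rintegrable_exponential_pdf.
- apply: (measurableT_comp (f := sin)); last exact: measurable_shiftM.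
  by apply: continuous_measurable_fun; exact: continuous_sin.
- by move=> *; exact: normr_sin.
Qed.

End laplace_swap.

Lemma poisson_bound (a x : R) : 0 < a -> `|a ^+ 2 / (a ^+ 2 + x ^+ 2)| <= 1.
Proof.
move=> a0; have h : 0 < a ^+ 2 + x ^+ 2 by rewrite ltr_wpDr ?sqr_ge0// exprn_gt0.
by rewrite ger0_norm ?divr_ge0 ?sqr_ge0 ?(ltW h)// ler_pdivrMr// mul1r lerDl sqr_ge0.
Qed.

Lemma conj_poisson_bound (a x : R) : 0 < a -> `|a * x / (a ^+ 2 + x ^+ 2)| <= 1.
Proof.
move=> a0; have h : 0 < a ^+ 2 + x ^+ 2 by rewrite ltr_wpDr ?sqr_ge0// exprn_gt0.
rewrite normrM normfV (gtr0_norm h) ler_pdivrMr// mul1r ler_norml.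
by apply/andP; split; nra.
Qed.

Lemma continuous_poisson (a l : R) : 0 < a ->
  continuous (fun x : R => a ^+ 2 / (a ^+ 2 + (x - l) ^+ 2)).
Proof.
move=> a0 x; have h : a ^+ 2 + (x - l) ^+ 2 != 0.
  by rewrite gt_eqF// ltr_wpDr ?sqr_ge0// exprn_gt0.
apply: cvgM; first exact: cvg_cst.
apply: cvgV => //; apply: cvgD; first exact: cvg_cst.
by apply: cvgM; (apply: cvgB; [exact: cvg_id|exact: cvg_cst]).
Qed.

Lemma continuous_conj_poisson (a l : R) : 0 < a ->
  continuous (fun x : R => a * (x - l) / (a ^+ 2 + (x - l) ^+ 2)).
Proof.
move=> a0 x; have h : a ^+ 2 + (x - l) ^+ 2 != 0.
  by rewrite gt_eqF// ltr_wpDr ?sqr_ge0// exprn_gt0.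
apply: cvgM.
  by apply: cvgM; [exact: cvg_cst|apply: cvgB; [exact: cvg_id|exact: cvg_cst]].
apply: cvgV => //; apply: cvgD; first exact: cvg_cst.
by apply: cvgM; (apply: cvgB; [exact: cvg_id|exact: cvg_cst]).
Qed.

(* If [u x0 > 0], the Poisson integral of [u] at [x0 + i e] is bounded below
   by a positive constant as [e] tends to [0]. *)
Lemma poisson_integral_le0 u (x0 : R) : continuous u -> Rintegrable u ->
  (forall e, 0 < e ->
    Rintegral mu setT (fun x => u x * (e ^+ 2 / (e ^+ 2 + (x - x0) ^+ 2))) = 0) ->
  u x0 <= 0.
Proof.
move=> cu Iu Pu; rewrite leNgt; apply/negP => ux0.
set m := u x0 / 2; have m0 : 0 < m by rewrite divr_gt0.
have [d /= d0 ud] : exists2 d : R, 0 < d & forall x, `|x0 - x| < d -> m <= u x.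
  have /cvgrPdist_lt/(_ _ m0)/nbhs_ballP[d /= d0 ud] := cu x0.
  exists d => // x xd; have := ud x xd.
  rewrite ltr_norml => /andP[_]; rewrite /m; lra.
(* The kernel is at least 1/2 within distance [e] of [x0], nonnegative within distance [d], where
   [u >= m], and at most [e ^+ 2 / d ^+ 2] beyond. The vanishing integral is thus at least [m * e]
   minus a term of order [e ^+ 2]; division by [e] gives the claim. *)
have key e : 0 < e < d -> m <= e / d ^+ 2 * Rintegral mu setT (fun x => `|u x|).
  move=> /andP[e0 ed].
  have Iind : Rintegrable (\1_`[x0 - e, x0 + e] : R -> R) by exact: integrable_indic_itv.
  have Iabs := Rintegrable_norm Iu.
  have lb x : m / 2 * \1_`[x0 - e, x0 + e] x - (e ^+ 2 / d ^+ 2) * `|u x| <=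
      u x * (e ^+ 2 / (e ^+ 2 + (x - x0) ^+ 2)).
    have D0 : 0 < e ^+ 2 + (x - x0) ^+ 2 by rewrite ltr_wpDr ?sqr_ge0// exprn_gt0.
    have abs0 := normr_ge0 (u x).
    have ed0 : 0 <= e ^+ 2 / d ^+ 2 * `|u x| by rewrite mulr_ge0// divr_ge0// sqr_ge0.
    have q0 : 0 <= e ^+ 2 / (e ^+ 2 + (x - x0) ^+ 2) by rewrite divr_ge0 ?sqr_ge0// ltW.
    rewrite indicE; have [xe|xe] := boolP (x \in _).
      move: xe => /set_mem /=; rewrite in_itv/= => /andP[xe1 xe2].
      have xx0 : `|x - x0| <= e by rewrite ler_norml; apply/andP; split; lra.
      have ux : m <= u x by apply: ud; rewrite distrC (le_lt_trans xx0).
      have q2 : 1 / 2 <= e ^+ 2 / (e ^+ 2 + (x - x0) ^+ 2).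
        rewrite ler_pdivlMr// -[(x - x0) ^+ 2]real_normK ?num_real//.
        have : `|x - x0| ^+ 2 <= e ^+ 2 by rewrite lerXn2r ?nnegrE ?(ltW e0).
        lra.
      rewrite mulr1 (@le_trans _ _ (m / 2))//; first lra.
      by rewrite -[m / 2]mul1r mulrCA ler_pM//; lra.
    rewrite mulr0 sub0r.
    have [xd|xd] := ltP `|x0 - x| d.
      have ux := ud _ xd.
      by apply: (@le_trans _ _ 0); [rewrite oppr_le0|rewrite mulr_ge0//; lra].
    rewrite lerNl -mulNr (le_trans (ler_norm _))// normrM normrN mulrC ler_wpM2r//.
    rewrite ger0_norm// ler_wpM2l ?sqr_ge0// lef_pV2 ?posrE ?exprn_gt0//.
    rewrite -[(x - x0) ^+ 2]real_normK ?num_real// distrC.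
    have : d ^+ 2 <= `|x0 - x| ^+ 2 by rewrite lerXn2r ?nnegrE ?(ltW d0).
    have := sqr_ge0 e; lra.
  have := @le_Rintegral _ _ _ mu setT _ _ measurableT
    (RintegrableB (RintegrableZ (m / 2) Iind) (RintegrableZ (e ^+ 2 / d ^+ 2) Iabs))
    (Rintegrable_Mbounded Iu (continuous_measurable_fun (continuous_poisson (l := x0) e0))
      (fun x => poisson_bound (x - x0) e0)) (fun x _ => lb x).
  rewrite Pu// RintegralB//; [|exact: RintegrableZ|exact: RintegrableZ].
  rewrite !RintegralZl//.
  have -> : Rintegral mu setT (\1_`[x0 - e, x0 + e] : R -> R) = 2 * e.
    have muE : (\int[mu]_x (\1_`[x0 - e, x0 + e] x)%:E)%E = mu `[x0 - e, x0 + e]%classic.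
      by rewrite integral_indic//; congr (mu _); exact: setIT.
    have lt_e : x0 - e < x0 + e by lra.
    by rewrite /Rintegral muE lebesgue_measure_itv/= lte_fin lt_e -EFinB/=; ring.
  set I := Rintegral _ _ _ => h.
  have : m * e <= e ^+ 2 / d ^+ 2 * I by lra.
  have -> : e ^+ 2 / d ^+ 2 * I = (e / d ^+ 2 * I) * e by ring.
  by rewrite ler_pM2r.
set I := Rintegral mu setT (fun x => `|u x|) in key.
have I0 : 0 <= I by exact: Rintegral_ge0.
have d20 : 0 < d ^+ 2 by rewrite exprn_gt0.
have M0 : 0 < 2 * (I + 1) by rewrite mulr_gt0// ltr_wpDl.
(* The second entry makes the right-hand side of [key] at most m I / (2 (I + 1)), which is less than
   [m]; adding 1 to [I] avoids a zero denominator. *)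
pose e := Num.min (d / 2) (m * d ^+ 2 / (2 * (I + 1))).
have e0 : 0 < e by rewrite lt_min !divr_gt0//= mulr_gt0.
have ed : e < d by rewrite gt_min; apply/orP; left; lra.
have := key e; rewrite e0 ed => /(_ isT).
have em : e <= m * d ^+ 2 / (2 * (I + 1)) by rewrite ge_min lexx orbT.
move: em; rewrite ler_pdivlMr// => em; rewrite mulrAC ler_pdivlMr// => h.
have eI : 0 <= e * I by rewrite mulr_ge0// ltW.
by rewrite mulrCA mulrDr mulr1 in em; lra.
Qed.

(** If both transforms vanish, so do all Poisson integrals, and the one-sided conclusion of
    [poisson_integral_le0] is applied to [u] and to its negative. *)
Lemma fourier_transform_injective u : continuous u -> Rintegrable u ->
  (forall t, Rintegral mu setT (fun x => u x * cos (x * t)) = 0) ->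
  (forall t, Rintegral mu setT (fun x => u x * sin (x * t)) = 0) ->
  forall x, u x = 0.
Proof.
move=> cu Iu uc us x0.
have P e : 0 < e -> Rintegral mu setT (fun x => u x * (e ^+ 2 / (e ^+ 2 + (x - x0) ^+ 2))) = 0.
  move=> e0; rewrite Rintegral_poisson//.
  under eq_Rintegral do rewrite Rintegral_cos_shift// uc us !mulr0 addr0 mulr0.
  by rewrite Rintegral_cst// mul0r.
apply/eqP; rewrite eq_le poisson_integral_le0//=.
have cN : continuous (fun x => - u x) by move=> x; apply: cvgN; exact: cu.
have IN : Rintegrable (fun x => - u x).
  by have := RintegrableZ (-1) Iu; apply: eq_integrable => // x _; rewrite /= mulN1r.
have := @poisson_integral_le0 _ x0 cN IN; rewrite oppr_le0; apply => e e0.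
under eq_Rintegral do rewrite mulNr -mulN1r.
rewrite RintegralZl// ?P ?mulr0//.
apply: (Rintegrable_Mbounded Iu _ (fun x => poisson_bound (x - x0) e0)).
by apply: continuous_measurable_fun; exact: continuous_poisson.
Qed.

End poisson_kernel.

(** * Boundary values of functions on the upper half-plane *)

Section complex_integrals.
Variable R : realType.
Local Notation mu := (@lebesgue_measure R).
Local Notation Re := complex.Re.
Local Notation Im := complex.Im.
Implicit Types (g k : R -> R[i]) (z w : R[i]) (a l x t : R).

Lemma ReM z w : Re (z * w) = Re z * Re w - Im z * Im w.
Proof. by case: z w => ? ? []. Qed.

Lemma ImM z w : Im (z * w) = Re z * Im w + Im z * Re w.
Proof. by case: z w => ? ? []. Qed.

Lemma ReD z w : Re (z + w) = Re z + Re w.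
Proof. by case: z w => ? ? []. Qed.

Lemma ImD z w : Im (z + w) = Im z + Im w.
Proof. by case: z w => ? ? []. Qed.

Lemma eq_ReIm z w : Re z = Re w -> Im z = Im w -> z = w.
Proof. by case: z w => ? ? [? ?] /= -> ->. Qed.

Lemma eq_cintegrable g k : g =1 k -> cintegrable g -> cintegrable k.
Proof. by move=> /funext ->. Qed.

Lemma eq_cintegral g k : g =1 k -> cintegral g = cintegral k.
Proof. by move=> /funext ->. Qed.

Lemma cintegrable_le g (u : R -> R) : measurable_fun setT (fun x => Re (g x)) ->
  measurable_fun setT (fun x => Im (g x)) -> Rintegrable u ->
  (forall x, normc (g x) <= u x) -> cintegrable g.
Proof.
move=> mRe mIm Iu gu; split; apply: Rintegrable_le Iu => // x.
  exact: le_trans (normc_Re _) (gu x).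
exact: le_trans (normc_Im _) (gu x).
Qed.

Lemma cintegrableM g k (M : R) : cintegrable g -> measurable_fun setT (fun x => Re (k x)) ->
  measurable_fun setT (fun x => Im (k x)) -> (forall x, normc (k x) <= M) ->
  cintegrable (fun x => g x * k x).
Proof.
move=> [I1 I2] m1 m2 kM.
have b1 x : `|Re (k x)| <= M := le_trans (normc_Re _) (kM x).
have b2 x : `|Im (k x)| <= M := le_trans (normc_Im _) (kM x).
have R1 : Rintegrable (fun x => Re (g x)) := I1.
have R2 : Rintegrable (fun x => Im (g x)) := I2.
split.
- have := RintegrableB (Rintegrable_Mbounded R1 m1 b1) (Rintegrable_Mbounded R2 m2 b2).
  by apply: eq_integrable => // x _; rewrite /= ReM.
- have := RintegrableD (Rintegrable_Mbounded R1 m2 b2) (Rintegrable_Mbounded R2 m1 b1).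
  by apply: eq_integrable => // x _; rewrite /= ImM.
Qed.

Lemma cintegrableD g k : cintegrable g -> cintegrable k -> cintegrable (fun x => g x + k x).
Proof.
move=> [I1 I2] [J1 J2]; split.
- by have := RintegrableD I1 J1; apply: eq_integrable => // x _; rewrite /= ReD.
- by have := RintegrableD I2 J2; apply: eq_integrable => // x _; rewrite /= ImD.
Qed.

Lemma cintegralD g k : cintegrable g -> cintegrable k ->
  cintegral (fun x => g x + k x) = cintegral g + cintegral k.
Proof.
move=> [I1 I2] [J1 J2]; rewrite /cintegral; apply: eq_ReIm => /=.
- by rewrite -RintegralD//; apply: eq_Rintegral => x _; rewrite ReD.
- by rewrite -RintegralD//; apply: eq_Rintegral => x _; rewrite ImD.
Qed.

Lemma cintegrableZ z g : cintegrable g -> cintegrable (fun x => z * g x).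
Proof.
move=> Ig; have : cintegrable (fun x => g x * z) by exact: (@cintegrableM _ _ (normc z)).
by apply: eq_cintegrable => x; rewrite mulrC.
Qed.

Lemma cintegralZ z g : cintegrable g -> cintegral (fun x => z * g x) = z * cintegral g.
Proof.
move=> [I1 I2].
have Z c (u : R -> R) := @RintegrableZ _ c u.
apply: eq_ReIm; rewrite /cintegral ?ReM ?ImM/=.
- rewrite -!RintegralZl// -RintegralB//; [|exact: Z|exact: Z].
  by apply: eq_Rintegral => x _; rewrite ReM.
- rewrite -!RintegralZl// -RintegralD//; [|exact: Z|exact: Z].
  by apply: eq_Rintegral => x _; rewrite ImM.
Qed.

Lemma cintegral_dominated (g_ : nat -> R -> R[i]) g (u : R -> R) :
  (forall n, cintegrable (g_ n)) -> Rintegrable u ->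
  (forall x, cvgc (fun n => g_ n x) (g x)) -> (forall n x, normc (g_ n x) <= u x) ->
  cintegrable g /\ cvgc (fun n => cintegral (g_ n)) (cintegral g).
Proof.
move=> Ig_ Iu gg gu.
have [|||I1 l1] := @Rintegral_dominated _ (fun n x => Re (g_ n x)) (fun x => Re (g x)) u _ Iu.
- by move=> n; apply: Rintegrable_measurable; case: (Ig_ n).
- by move=> x; have /cvgc_ReIm[] := gg x.
- by move=> n x; exact: le_trans (normc_Re _) (gu n x).
have [|||I2 l2] := @Rintegral_dominated _ (fun n x => Im (g_ n x)) (fun x => Im (g x)) u _ Iu.
- by move=> n; apply: Rintegrable_measurable; case: (Ig_ n).
- by move=> x; have /cvgc_ReIm[] := gg x.
- by move=> n x; exact: le_trans (normc_Im _) (gu n x).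
by split=> //; apply/cvgc_ReIm.
Qed.

Lemma normc_expi t : normc (expi t) = 1.
Proof. by rewrite /= cos2Dsin2 sqrtr1. Qed.

Lemma expiD x y : expi (x + y) = expi x * expi y :> R[i].
Proof. by apply: eq_ReIm; rewrite ?ReM ?ImM/= ?cosD ?sinD; ring. Qed.

Lemma measurable_Re_expi t : measurable_fun setT (fun x => Re (expi (x * t))).
Proof. by apply: continuous_measurable_fun; exact: continuous_cosM. Qed.

Lemma measurable_Im_expi t : measurable_fun setT (fun x => Im (expi (x * t))).
Proof. by apply: continuous_measurable_fun; exact: continuous_sinM. Qed.

Lemma cintegrable_expi g t : cintegrable g -> cintegrable (fun x => g x * expi (x * t)).
Proof.
move=> Ig; apply: (@cintegrableM _ _ 1) => //.
- exact: measurable_Re_expi.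
- exact: measurable_Im_expi.
- by move=> x; rewrite normc_expi.
Qed.

(* The boundary value of [a / (a - i (z - l))], holomorphic and bounded by 1
   in the upper half-plane. *)
Definition poissonc a l x : R[i] := a%:C / (a +i* (l - x)).

Lemma poissoncE a l x : 0 < a -> poissonc a l x =
  (a ^+ 2 / (a ^+ 2 + (x - l) ^+ 2)) +i* (a * (x - l) / (a ^+ 2 + (x - l) ^+ 2)).
Proof.
move=> a0; have h : a ^+ 2 + (x - l) ^+ 2 != 0.
  by rewrite gt_eqF// ltr_wpDr ?sqr_ge0// exprn_gt0.
have h2 : a +i* (l - x) != 0.
  by rewrite eq_complex/= negb_and gt_eqF.
apply: (mulIf h2); rewrite /poissonc divfK//; apply: eq_ReIm; rewrite ?ReM ?ImM/=.
  by field.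
by field.
Qed.

Lemma normc_poissonc_le1 a l x : 0 < a -> normc (poissonc a l x) <= 1.
Proof.
move=> a0; rewrite /poissonc Normc.normcM Normc.normcV normc_real gtr0_norm//.
have h : a <= normc (a +i* (l - x)) by rewrite (le_trans _ (normc_Re _))//= ler_norm.
by rewrite ler_pdivrMr ?mul1r// (lt_le_trans a0).
Qed.

Lemma continuous_Re_poissonc a l : 0 < a -> continuous (fun x => Re (poissonc a l x)).
Proof. by move=> a0; under eq_fun do rewrite poissoncE//=; exact: continuous_poisson. Qed.

Lemma continuous_Im_poissonc a l : 0 < a -> continuous (fun x => Im (poissonc a l x)).
Proof. by move=> a0; under eq_fun do rewrite poissoncE//=; exact: continuous_conj_poisson. Qed.

(** The boundary values of the Hardy space H^1 of the upper half-plane, described on the Fourier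
    side: with [t = - (2 * pi * xi)] the condition says that the transform vanishes at negative
    frequencies [xi]. *)
Definition hardy g := cintegrable g /\
  forall t, 0 < t -> cintegral (fun x => g x * expi (x * t)) = 0.

Lemma eq_hardy g k : g =1 k -> hardy g -> hardy k.
Proof. by move=> /funext ->. Qed.

Lemma hardyZ z g : hardy g -> hardy (fun x => z * g x).
Proof.
move=> [Ig g0]; split=> [|t t0]; first exact: cintegrableZ.
under eq_cintegral do rewrite -mulrA.
by rewrite cintegralZ ?g0 ?mulr0//; exact: cintegrable_expi.
Qed.

Lemma hardyD g k : hardy g -> hardy k -> hardy (fun x => g x + k x).
Proof.
move=> [Ig g0] [Ik k0]; split=> [|t t0]; first exact: cintegrableD.
under eq_cintegral do rewrite mulrDl.
by rewrite cintegralD ?g0 ?k0 ?addr0//; exact: cintegrable_expi.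
Qed.

Lemma cintegrable_poissonc a l g : 0 < a -> cintegrable g ->
  cintegrable (fun x => g x * poissonc a l x).
Proof.
move=> a0 Ig; apply: (@cintegrableM _ _ 1) => //.
- by apply: continuous_measurable_fun; exact: continuous_Re_poissonc.
- by apply: continuous_measurable_fun; exact: continuous_Im_poissonc.
- by move=> x; exact: normc_poissonc_le1.
Qed.

(** The integral of g(x) a / (a - i (x - l)) is an average over t >= 0 of the integrals of g(x) exp
    (i (x - l) t), and each of these is 0. *)
Let Re_cintegral_poissonc a l g : 0 < a -> cintegrable g ->
  (forall t, 0 <= t -> cintegral (fun x => g x * expi (x * t)) = 0) ->
  Re (cintegral (fun x => g x * poissonc a l x)) = 0.
Proof.
move=> a0 [Iu Iv] g0.
set u := fun x => Re (g x); set v := fun x => Im (g x).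
have {}Iu : Rintegrable u by [].
have {}Iv : Rintegrable v by [].
have cs t : 0 <= t ->
    Rintegral mu setT (fun x => u x * cos (x * t)) = Rintegral mu setT (fun x => v x * sin (x * t)) /\
    Rintegral mu setT (fun x => u x * sin (x * t)) = - Rintegral mu setT (fun x => v x * cos (x * t)).
  move=> /g0 gt0; split.
  - have /= := congr1 (@complex.Re R) gt0; under eq_Rintegral do rewrite ReM/=.
    rewrite RintegralB//; [|exact: Rintegrable_cos|exact: Rintegrable_sin].
    by move/eqP; rewrite subr_eq0 => /eqP.
  - have /= := congr1 (@complex.Im R) gt0; under eq_Rintegral do rewrite ImM/=.
    rewrite RintegralD//; [|exact: Rintegrable_sin|exact: Rintegrable_cos].
    by move/eqP; rewrite addr_eq0 => /eqP.
have mb : measurable_fun setT (fun x => a ^+ 2 / (a ^+ 2 + (x - l) ^+ 2)).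
  by apply: continuous_measurable_fun; exact: continuous_poisson.
have mc : measurable_fun setT (fun x => a * (x - l) / (a ^+ 2 + (x - l) ^+ 2)).
  by apply: continuous_measurable_fun; exact: continuous_conj_poisson.
have bb x := poisson_bound (x - l) a0.
have bc x := conj_poisson_bound (x - l) a0.
(* The density vanishes for negative [t], so that information on [t >= 0] is enough. *)
have pdf_ge0 (F G : R -> R) : (forall t, 0 <= t -> F t = G t) ->
    Rintegral mu setT (fun t => exponential_pdf a t * F t) =
    Rintegral mu setT (fun t => exponential_pdf a t * G t).
  move=> FG; apply: eq_Rintegral => t _; have [t0|t0] := leP 0 t; first by rewrite FG.
  by rewrite lt0_exponential_pdf// !mul0r.
rewrite /=; under eq_Rintegral do rewrite ReM poissoncE//=.
rewrite RintegralB//; [|exact: Rintegrable_Mbounded|exact: Rintegrable_Mbounded].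
rewrite Rintegral_poisson// Rintegral_conj_poisson//.
apply/eqP; rewrite subr_eq0; apply/eqP/pdf_ge0 => t t0.
by rewrite Rintegral_cos_shift// Rintegral_sin_shift//; have [-> ->] := cs _ t0; ring.
Qed.

Lemma cintegral_poissonc a l g : 0 < a -> cintegrable g ->
  (forall t, 0 <= t -> cintegral (fun x => g x * expi (x * t)) = 0) ->
  cintegral (fun x => g x * poissonc a l x) = 0.
Proof.
move=> a0 Ig g0; apply: eq_ReIm; first exact: Re_cintegral_poissonc.
(* The real part of - i z is the imaginary part of z; hence the case of real parts, applied to - i
   g, yields the imaginary part. *)
pose h x := (0 -i* 1) * g x.
have : Re (cintegral (fun x => h x * poissonc a l x)) = 0.
  apply: Re_cintegral_poissonc => //; first exact: cintegrableZ.
  move=> t t0; under eq_cintegral do rewrite /h -mulrA.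
  by rewrite cintegralZ ?g0 ?mulr0//; exact: cintegrable_expi.
under eq_cintegral do rewrite /h -mulrA.
by rewrite cintegralZ ?ReM/= ?mul0r ?sub0r ?mulN1r ?opprK//; exact: cintegrable_poissonc.
Qed.

(** For [s > 0] the function g(x) exp (i x s) has vanishing integrals against all frequencies
    [t >= 0], the endpoint included, because [s + t] is still positive. *)
Lemma hardy_poissonc a l g : 0 < a -> hardy g -> hardy (fun x => g x * poissonc a l x).
Proof.
move=> a0 [Ig g0]; split=> [|s s0]; first exact: cintegrable_poissonc.
under eq_cintegral do rewrite mulrAC.
apply: cintegral_poissonc => //; first exact: cintegrable_expi.
move=> t t0; under eq_cintegral do rewrite -mulrA -expiD -mulrDr.
by apply: g0; rewrite ltr_wpDr.
Qed.

Lemma normc_poissonc_sqr a l x : 0 < a ->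
  normc (poissonc a l x) ^+ 2 = a ^+ 2 / (a ^+ 2 + (x - l) ^+ 2).
Proof.
move=> a0; rewrite normc_sqr poissoncE//=.
have h : a ^+ 2 + (x - l) ^+ 2 != 0.
  by rewrite gt_eqF// ltr_wpDr ?sqr_ge0// exprn_gt0.
by field.
Qed.

(** One factor decays only like 1 / |x|; a pair is integrable. The bound is the arithmetic-geometric
    mean inequality applied to the two squared moduli. *)
Lemma normc_poissonc_decay a b x : 0 < a -> 0 < b ->
  normc (poissonc a 0 x * poissonc b 0 x) <= (2 + a ^+ 2 + b ^+ 2) * (1 + x ^+ 2)^-1.
Proof.
move=> a0 b0; rewrite Normc.normcM.
have h c : 0 < c -> normc (poissonc c 0 x) ^+ 2 <= (1 + c ^+ 2) * (1 + x ^+ 2)^-1.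
  move=> c0; rewrite normc_poissonc_sqr// subr0.
  have p1 : 0 < c ^+ 2 + x ^+ 2 by rewrite ltr_wpDr ?sqr_ge0// exprn_gt0.
  have p2 : 0 < 1 + x ^+ 2 by rewrite ltr_wpDr ?sqr_ge0.
  rewrite ler_pdivrMr// mulrAC ler_pdivlMr//.
  have := sqr_ge0 x; have := sqr_ge0 (c ^+ 2); nra.
have := h a a0; have := h b b0; have := sqr_ge0 (normc (poissonc a 0 x) - normc (poissonc b 0 x)).
have := sqr_ge0 (normc (poissonc a 0 x)); have := sqr_ge0 (normc (poissonc b 0 x)).
rewrite sqrrB !mulrDl; lra.
Qed.

Lemma cintegrable_base a b : 0 < a -> 0 < b ->
  cintegrable (fun x => poissonc a 0 x * poissonc b 0 x).
Proof.
move=> a0 b0.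
have m1 c : 0 < c -> measurable_fun setT (fun x => Re (poissonc c 0 x)).
  by move=> c0; apply: continuous_measurable_fun; exact: continuous_Re_poissonc.
have m2 c : 0 < c -> measurable_fun setT (fun x => Im (poissonc c 0 x)).
  by move=> c0; apply: continuous_measurable_fun; exact: continuous_Im_poissonc.
apply: (@cintegrable_le _ (fun x => (2 + a ^+ 2 + b ^+ 2) * (1 + x ^+ 2)^-1)).
- by under eq_fun do rewrite ReM; apply: measurable_funB; apply: measurable_funM; auto.
- by under eq_fun do rewrite ImM; apply: measurable_funD; apply: measurable_funM; auto.
- by apply: RintegrableZ; exact: Rintegrable_oneDsqrV.
- by move=> x; exact: normc_poissonc_decay.
Qed.

Section base.
Variables (a b eta : R).
Hypotheses (a0 : 0 < a) (b0 : 0 < b) (ab : a != b) (eta0 : 0 < eta).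

Let P x := poissonc a 0 x * poissonc b 0 x.
(** The partial fraction decomposition of [P] on the transform side; [u] is the density of the sum
    of two independent exponential variables with rates [a] and [b], and lives on [y >= 0]. *)
Let u y := b / (b - a) * exponential_pdf a y - a / (b - a) * exponential_pdf b y.

Let Iu : Rintegrable u.
Proof. by apply: RintegrableB; apply: RintegrableZ; exact: Rintegrable_exponential_pdf. Qed.

Let ba : b - a != 0. Proof. by rewrite subr_eq0 eq_sym. Qed.

Let P_cos s : Rintegral mu setT (fun y => u y * cos (y * s)) = Re (P s).
Proof.
have E y : u y * cos (y * s) = b / (b - a) * (exponential_pdf a y * cos (s * y)) -
    a / (b - a) * (exponential_pdf b y * cos (s * y)).
  by rewrite /u [y * s]mulrC; ring.
under eq_Rintegral do rewrite E.
have Ic c : 0 < c -> Rintegrable (fun y => exponential_pdf c y * cos (s * y)).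
  move=> c0; have := Rintegrable_cos s (Rintegrable_exponential_pdf c0).
  by apply: eq_integrable => // x _; rewrite /= [s * x]mulrC.
rewrite RintegralB//; [|by apply: RintegrableZ; exact: Ic|by apply: RintegrableZ; exact: Ic].
rewrite !RintegralZl//; [|exact: Ic|exact: Ic].
rewrite !Rintegral_exponential_cos// /P ReM !poissoncE//= subr0.
have ha : a ^+ 2 + s ^+ 2 != 0 by rewrite gt_eqF// ltr_wpDr ?sqr_ge0// exprn_gt0.
have hb : b ^+ 2 + s ^+ 2 != 0 by rewrite gt_eqF// ltr_wpDr ?sqr_ge0// exprn_gt0.
by field; rewrite ha hb.
Qed.

Let P_sin s : Rintegral mu setT (fun y => u y * sin (y * s)) = Im (P s).
Proof.
have E y : u y * sin (y * s) = b / (b - a) * (exponential_pdf a y * sin (s * y)) -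
    a / (b - a) * (exponential_pdf b y * sin (s * y)).
  by rewrite /u [y * s]mulrC; ring.
under eq_Rintegral do rewrite E.
have Ic c : 0 < c -> Rintegrable (fun y => exponential_pdf c y * sin (s * y)).
  move=> c0; have := Rintegrable_sin s (Rintegrable_exponential_pdf c0).
  by apply: eq_integrable => // x _; rewrite /= [s * x]mulrC.
rewrite RintegralB//; [|by apply: RintegrableZ; exact: Ic|by apply: RintegrableZ; exact: Ic].
rewrite !RintegralZl//; [|exact: Ic|exact: Ic].
rewrite !Rintegral_exponential_sin// /P ImM !poissoncE//= subr0.
have ha : a ^+ 2 + s ^+ 2 != 0 by rewrite gt_eqF// ltr_wpDr ?sqr_ge0// exprn_gt0.
have hb : b ^+ 2 + s ^+ 2 != 0 by rewrite gt_eqF// ltr_wpDr ?sqr_ge0// exprn_gt0.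
by field; rewrite ha hb.
Qed.

Let phi s := Re (P s * expi (s * eta)).

(** By [P_cos] and [P_sin], [phi s] is the integral of [u y] against cos ((y + eta) s), so
    [Rintegral_poisson] read backwards, with centre [- eta], applies. *)
Let phi_poisson e : 0 < e ->
  Rintegral mu setT (fun s => exponential_pdf e s * phi s) =
  Rintegral mu setT (fun y => u y * (e ^+ 2 / (e ^+ 2 + (y - - eta) ^+ 2))).
Proof.
move=> e0; rewrite Rintegral_poisson//; apply: eq_Rintegral => s _.
rewrite Rintegral_cos_shift// P_cos P_sin /phi ReM/= mulNr cosN sinN [eta * s]mulrC; ring.
Qed.

Let Iphi : Rintegrable phi.
Proof. by have [] := cintegrable_expi eta (cintegrable_base a0 b0). Qed.

Let cvg_invS (M : R) : n.+1%:R^-1 * M @[n --> \oo] --> (0 : R).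
Proof. by rewrite -(mul0r M); apply: cvgM; [exact: cvg_harmonic|exact: cvg_cst]. Qed.

(* The Abel means of [phi] over the half-line are Poisson integrals of [u] at a
   point at distance at least [eta] from the support of [u]. *)
Let phi_half0 : Rintegral mu `[0, +oo[ phi = 0.
Proof.
pose e n : R := n.+1%:R^-1.
have e0 n : 0 < e n by rewrite invr_gt0.
have u0 y : y < 0 -> u y = 0 by move=> y0; rewrite /u !lt0_exponential_pdf// !mulr0 subr0.
(* Normalised so that on [s >= 0] it equals [expR (- e n * s) * phi s], which tends to [phi s] and
   stays below it in modulus. *)
pose f n s := (e n)^-1 * (exponential_pdf (e n) s * phi s).
have fE n s : f n s = if 0 <= s then expR (- e n * s) * phi s else 0.
  rewrite /f; case: ifPn => s0; last by rewrite lt0_exponential_pdf ?mul0r ?mulr0// ltNge.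
  by rewrite exponential_pdfE// !mulrA mulVf ?mul1r// gt_eqF.
have If n : Rintegrable (fun s => exponential_pdf (e n) s * phi s).
  have mphi := Rintegrable_measurable Iphi.
  have pb s : `|phi s| <= (2 + a ^+ 2 + b ^+ 2).
    rewrite (le_trans (normc_Re _))// Normc.normcM normc_expi mulr1.
    rewrite (le_trans (normc_poissonc_decay s a0 b0))// ler_piMr//.
      by rewrite !addr_ge0// sqr_ge0.
    by rewrite invf_le1 ?lerDl ?sqr_ge0// ltr_wpDr ?sqr_ge0.
  exact: (Rintegrable_Mbounded (Rintegrable_exponential_pdf (e0 n)) mphi pb).
have [_ cvgf] : Rintegrable (phi \_ `[0, +oo[) /\
    Rintegral mu setT (f n) @[n --> \oo] --> Rintegral mu setT (phi \_ `[0, +oo[).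
  apply: (@Rintegral_dominated _ _ _ (fun s => `|phi s|)).
  - by move=> n; apply: Rintegrable_measurable; exact: RintegrableZ.
  - exact: Rintegrable_norm.
  - move=> s; rewrite patchE; under eq_fun do rewrite fE.
    have [s0|s0] := leP 0 s; last first.
      by rewrite memNset ?(ltNge _ _)//=; [exact: cvg_cst|rewrite in_itv/= andbT; apply/negP; rewrite -ltNge].
    rewrite mem_set/= ?in_itv/= ?s0//.
    suff : expR (- e n * s) * phi s @[n --> \oo] --> 1 * phi s by rewrite mul1r.
    apply: cvgM; last exact: cvg_cst.
    rewrite -expR0; apply: continuous_cvg; first exact: continuous_expR.
    by rewrite -oppr0; under eq_fun do rewrite mulNr; apply: cvgN; exact: cvg_invS.
  - move=> n s; rewrite fE; case: ifP => s0; last by rewrite normr0.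
    rewrite normrM ger0_norm ?expR_ge0// ler_piMl//.
    by rewrite expR_le1 mulNr oppr_le0 mulr_ge0// ltW.
rewrite -Rintegral_mkcond in cvgf.
set K := Rintegral mu setT (fun y => `|u y|).
suff cvg0 : Rintegral mu setT (f n) @[n --> \oo] --> (0 : R) by exact: cvg_unique cvgf cvg0.
apply/norm_cvg0P; apply: (@squeeze_cvgr _ _ _ _ (cst 0) (fun n => n.+1%:R^-1 * (K / eta ^+ 2))).
- apply: nearW => n; rewrite normr_ge0/=.
  have -> : Rintegral mu setT (f n) =
      (e n)^-1 * Rintegral mu setT (fun s => exponential_pdf (e n) s * phi s).
    by rewrite -RintegralZl//; exact: If.
  rewrite phi_poisson// normrM gtr0_norm ?invr_gt0// mulrC ler_pdivrMr//.
  rewrite -/(e n).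
  have -> : e n * (K / eta ^+ 2) * e n = e n ^+ 2 / eta ^+ 2 * K by ring.
  rewrite /K -RintegralZl//; last exact: Rintegrable_norm.
  apply: normr_Rintegral_le; last 1 first.
  + move=> y; rewrite normrM mulrC.
    have [y0|y0] := leP 0 y; last by rewrite u0// normr0 !mulr0.
    rewrite ler_wpM2r// ger0_norm ?divr_ge0 ?addr_ge0 ?sqr_ge0//.
    rewrite ler_wpM2l ?sqr_ge0// lef_pV2 ?posrE ?exprn_gt0//; last first.
      by rewrite ltr_wpDr ?sqr_ge0// exprn_gt0.
    have := sqr_ge0 (e n); have : eta ^+ 2 <= (y - - eta) ^+ 2.
      have ye : 0 <= y * eta := mulr_ge0 y0 (ltW eta0).
      by rewrite opprK; have := sqr_ge0 y; rewrite sqrrD; lra.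
      lra.
    exact: ltW.
  + apply: (Rintegrable_Mbounded Iu _ (fun y => poisson_bound (y - - eta) (e0 n))).
    by apply: continuous_measurable_fun; exact: continuous_poisson.
  + by apply: RintegrableZ; exact: Rintegrable_norm.
- exact: cvg_cst.
- exact: cvg_invS.
Qed.

Let cvg_Re_Im : continuous phi /\ continuous (fun s => Im (P s * expi (s * eta))).
Proof.
have cM (f g : R -> R) : continuous f -> continuous g -> continuous (fun x => f x * g x).
  by move=> cf cg x; apply: cvgM; [exact: cf|exact: cg].
have cD (f g : R -> R) : continuous f -> continuous g -> continuous (fun x => f x + g x).
  by move=> cf cg x; apply: cvgD; [exact: cf|exact: cg].
have cB (f g : R -> R) : continuous f -> continuous g -> continuous (fun x => f x - g x).
  by move=> cf cg x; apply: cvgB; [exact: cf|exact: cg].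
have Ra := @continuous_Re_poissonc a 0 a0; have Ia := @continuous_Im_poissonc a 0 a0.
have Rb := @continuous_Re_poissonc b 0 b0; have Ib := @continuous_Im_poissonc b 0 b0.
have cR : continuous (fun s => Re (P s)).
  rewrite (_ : (fun s => _) = (fun s => Re (poissonc a 0 s) * Re (poissonc b 0 s) -
    Im (poissonc a 0 s) * Im (poissonc b 0 s))); last by apply/funext => s; rewrite /P ReM.
  exact: cB (cM _ _ Ra Rb) (cM _ _ Ia Ib).
have cI : continuous (fun s => Im (P s)).
  rewrite (_ : (fun s => _) = (fun s => Re (poissonc a 0 s) * Im (poissonc b 0 s) +
    Im (poissonc a 0 s) * Re (poissonc b 0 s))); last by apply/funext => s; rewrite /P ImM.
  exact: cD (cM _ _ Ra Ib) (cM _ _ Ia Rb).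
have cc := @continuous_cosM R eta; have cs := @continuous_sinM R eta.
have -> : phi = (fun s => Re (P s) * cos (s * eta) - Im (P s) * sin (s * eta)).
  by apply/funext => s; rewrite /phi ReM.
have -> : (fun s => Im (P s * expi (s * eta))) =
    (fun s => Re (P s) * sin (s * eta) + Im (P s) * cos (s * eta)).
  by apply/funext => s; rewrite ImM.
by split; [exact: cB (cM _ _ cR cc) (cM _ _ cI cs)|exact: cD (cM _ _ cR cs) (cM _ _ cI cc)].
Qed.

Let P_even s : Re (P (- s)) = Re (P s).
Proof. by rewrite /P !poissoncE// !ReM/= !subr0 !sqrrN; ring. Qed.

Let P_odd s : Im (P (- s)) = - Im (P s).
Proof. by rewrite /P !poissoncE// !ImM/= !subr0 !sqrrN; ring. Qed.

(** Since P(-s) is the conjugate of P(s), the integrand has an odd imaginary part and an even real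
    part; the latter reduces to the half-line integral of [phi]. *)
Lemma cintegral_base : cintegral (fun x => poissonc a 0 x * poissonc b 0 x * expi (x * eta)) = 0.
Proof.
have [cRe cIm] := cvg_Re_Im.
have [I1 I2] := cintegrable_expi eta (cintegrable_base a0 b0).
apply: eq_ReIm => /=.
- rewrite -[LHS]/(Rintegral mu setT phi) Rintegral_even// ?phi_half0 ?mulr0// => s.
  have phiE r : phi r = Re (P r) * cos (r * eta) - Im (P r) * sin (r * eta) by rewrite /phi ReM.
  by rewrite !phiE P_even P_odd mulNr cosN sinN; ring.
- pose psi s := Im (P s * expi (s * eta)).
  rewrite -[LHS]/(Rintegral mu setT psi); apply: Rintegral_odd => // s; rewrite /psi.
  have psiE r : Im (P r * expi (r * eta)) = Re (P r) * sin (r * eta) + Im (P r) * cos (r * eta).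
    by rewrite ImM.
  by rewrite [LHS]psiE [in RHS]psiE P_even P_odd mulNr cosN sinN; ring.
Qed.

End base.

Lemma hardy_base a b : 0 < a -> 0 < b -> a != b ->
  hardy (fun x => poissonc a 0 x * poissonc b 0 x).
Proof.
move=> a0 b0 ab; split; first exact: cintegrable_base.
by move=> t t0; exact: cintegral_base.
Qed.

Lemma hardy_dominated (g_ : nat -> R -> R[i]) g (v : R -> R) :
  (forall n, hardy (g_ n)) -> Rintegrable v ->
  (forall x, cvgc (fun n => g_ n x) (g x)) -> (forall n x, normc (g_ n x) <= v x) -> hardy g.
Proof.
move=> Hg Iv gg gv; split.
  by case: (@cintegral_dominated g_ g v) => // n; case: (Hg n).
move=> t t0.
have [|||_ l] := @cintegral_dominated (fun n x => g_ n x * expi (x * t))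
    (fun x => g x * expi (x * t)) v _ Iv.
- by move=> n; apply: cintegrable_expi; case: (Hg n).
- by move=> x; under eq_fun do rewrite mulrC; rewrite mulrC; exact: cvgcZ.
- by move=> n x; rewrite Normc.normcM normc_expi mulr1.
apply: cvgc_unique l _; under eq_fun do rewrite (proj2 (Hg _) t t0); exact: cvgc_cst.
Qed.

End complex_integrals.

(** * The half-Laplacian of boundary values *)

Section half_laplacian_boundary_values.
Variable R : realType.
Local Notation mu := (@lebesgue_measure R).
Local Notation Re := complex.Re.
Local Notation Im := complex.Im.
Implicit Types (f g : R -> R[i]) (u v : R -> R).

Lemma derive1nZ (k : R) u : (forall n x, derivable (derive1n n u) x 1) ->
  forall n, derive1n n (fun x => k * u x) = (fun x => k * derive1n n u x).
Proof.
move=> du; elim=> [//|n ih]; rewrite derive1nS ih; apply/funext => x.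
rewrite derive1nS !derive1E.
by have := deriveZ k (du n x); rewrite /GRing.scale/= => <-.
Qed.

Lemma derivable_continuous u : (forall x, derivable u x 1) -> continuous u.
Proof. by move=> du x; apply: differentiable_continuous; apply/derivable1_diffP. Qed.

Lemma is_derive_derive1 u x : derivable u x 1 -> is_derive x (1 : R) u (derive1 u x).
Proof. by move=> du; rewrite derive1E; split. Qed.

Definition smooth_real u := forall n x, derivable (derive1n n u) x 1.

Lemma smoothE f : smooth f <->
  smooth_real (fun x => Re (f x)) /\ smooth_real (fun x => Im (f x)).
Proof.
split=> [sf|[s1 s2] n x]; last exact: conj (s1 n x) (s2 n x).
by split=> n x; [exact: (proj1 (sf n x))|exact: (proj2 (sf n x))].
Qed.

Lemma smooth_real_derive1 u : smooth_real u -> smooth_real (derive1 u).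
Proof. by move=> su n x; rewrite -derive1Sn. Qed.

Lemma smooth_realZ (k : R) u : smooth_real u -> smooth_real (fun x => k * u x).
Proof. by move=> su n x; rewrite derive1nZ//; exact: derivableZ (su n x). Qed.

Lemma smooth_real_continuous u : smooth_real u -> continuous u.
Proof. by move=> su; apply: derivable_continuous; exact: (su 0%N). Qed.

(** The operator with symbol [xi], which agrees with [|xi|] on the spectrum of a [hardy]
    function. *)
Definition half_deriv f x : R[i] := ((2 * pi) *i)^-1 * cderive1n 1 f x.

Lemma invc_im (k : R) : k != 0 -> (k *i)^-1 = 0 -i* k^-1.
Proof.
move=> k0; have ki : k *i != 0 by rewrite eq_complex/= negb_and k0 orbT.
by apply: (mulIf ki); rewrite mulVf//; apply: eq_ReIm; rewrite ?ReM ?ImM/=; field.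
Qed.

Lemma half_derivE f x : half_deriv f x =
  ((2 * pi)^-1 * derive1 (fun t => Im (f t)) x) +i*
  (- (2 * pi)^-1 * derive1 (fun t => Re (f t)) x).
Proof.
have p0 : 2 * pi != 0 :> R by rewrite mulf_neq0// gt_eqF// pi_gt0.
by rewrite /half_deriv /cderive1n invc_im//; apply: eq_ReIm; rewrite ?ReM ?ImM/=; ring.
Qed.

Lemma smooth_half_deriv f : smooth f -> smooth (half_deriv f).
Proof.
move=> /smoothE[s1 s2]; apply/smoothE; split.
- under eq_fun do rewrite half_derivE/=.
  by apply: smooth_realZ; exact: smooth_real_derive1.
- under eq_fun do rewrite half_derivE/=.
  by apply: smooth_realZ; exact: smooth_real_derive1.
Qed.

Lemma cderive1n_half_deriv f n x : smooth f ->
  cderive1n n (half_deriv f) x = ((2 * pi) *i)^-1 * cderive1n n.+1 f x.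
Proof.
move=> /smoothE[s1 s2].
have p0 : 2 * pi != 0 :> R by rewrite mulf_neq0// gt_eqF// pi_gt0.
have E1 : (fun t => Re (half_deriv f t)) =
    (fun x => (2 * pi)^-1 * derive1 (fun t => Im (f t)) x).
  by apply/funext => t; rewrite half_derivE.
have E2 : (fun t => Im (half_deriv f t)) =
    (fun x => (- (2 * pi)^-1) * derive1 (fun t => Re (f t)) x).
  by apply/funext => t; rewrite half_derivE.
rewrite /cderive1n E1 E2 (derive1nZ _ (smooth_real_derive1 s2)) (derive1nZ _ (smooth_real_derive1 s1)).
rewrite -!derive1Sn; move: (derive1n _ _ x) (derive1n _ _ x) => A B.
by rewrite invc_im//; apply: eq_ReIm; rewrite ?ReM ?ImM/=; ring.
Qed.

Let is_derive_cosM (s x : R) : is_derive x (1 : R) (fun x => cos (x * s)) (- s * sin (x * s)).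
Proof. by apply: is_derive_eq; rewrite /GRing.scale/=; ring. Qed.

Let is_derive_sinM (s x : R) : is_derive x (1 : R) (fun x => sin (x * s)) (s * cos (x * s)).
Proof. by apply: is_derive_eq; rewrite /GRing.scale/=; ring. Qed.

(** Integration by parts. The boundary terms are controlled along the integers only, which suffices
    because the integrals converge absolutely. *)
Lemma cintegral_derive f (s : R) : smooth f -> cintegrable f -> cintegrable (cderive1n 1 f) ->
  normc (f n%:R) @[n --> \oo] --> (0 : R) -> normc (f (- n%:R)) @[n --> \oo] --> (0 : R) ->
  cintegral (fun x => cderive1n 1 f x * expi (x * s)) =
  (0 -i* s) * cintegral (fun x => f x * expi (x * s)).
Proof.
move=> /smoothE[s1 s2] If If' f1 f2.
set u := fun x => Re (f x) in s1; set v := fun x => Im (f x) in s2.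
have cu' : continuous (derive1 u) by exact/smooth_real_continuous/smooth_real_derive1.
have cv' : continuous (derive1 v) by exact/smooth_real_continuous/smooth_real_derive1.
have cu := smooth_real_continuous s1; have cv := smooth_real_continuous s2.
have cc := @continuous_cosM R s; have cs := @continuous_sinM R s.
have [Ie1 Ie2] := cintegrable_expi s If.
have [Id1 Id2] := cintegrable_expi s If'.
have cM (p q : R -> R) : continuous p -> continuous q -> continuous (fun x => p x * q x).
  by move=> cp cq x; apply: cvgM; [exact: cp|exact: cq].
have cD (p q : R -> R) : continuous p -> continuous q -> continuous (fun x => p x + q x).
  by move=> cp cq x; apply: cvgD; [exact: cp|exact: cq].
have cB (p q : R -> R) : continuous p -> continuous q -> continuous (fun x => p x - q x).
  by move=> cp cq x; apply: cvgB; [exact: cp|exact: cq].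
have cK (k : R) (p : R -> R) : continuous p -> continuous (fun x => k * p x).
  by move=> cp x; apply: cvgM; [exact: cvg_cst|exact: cp].
have bnd (pr : R[i] -> R) : (forall z, `|pr z| <= normc z) ->
    pr (f n%:R * expi (n%:R * s)) - pr (f (- n%:R) * expi (- n%:R * s)) @[n --> \oo] --> (0 : R).
  move=> prn; rewrite -(subrr 0); apply: cvgB; apply/norm_cvg0P.
  + apply: squeeze_cvgr (cvg_cst 0) f1; apply: nearW => n; rewrite normr_ge0/=.
    by rewrite (le_trans (prn _))// Normc.normcM normc_expi mulr1.
  + apply: squeeze_cvgr (cvg_cst 0) f2; apply: nearW => n; rewrite normr_ge0/=.
    by rewrite (le_trans (prn _))// Normc.normcM normc_expi mulr1.
have ReE x : Re (f x * expi (x * s)) = u x * cos (x * s) - v x * sin (x * s) by rewrite ReM.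
have ImE x : Im (f x * expi (x * s)) = u x * sin (x * s) + v x * cos (x * s) by rewrite ImM.
have RedE x : Re (cderive1n 1 f x * expi (x * s)) = derive1 u x * cos (x * s) - derive1 v x * sin (x * s).
  by rewrite ReM.
have ImdE x : Im (cderive1n 1 f x * expi (x * s)) = derive1 u x * sin (x * s) + derive1 v x * cos (x * s).
  by rewrite ImM.
have du x : is_derive x (1 : R) u (derive1 u x) by apply: is_derive_derive1; exact: (s1 0%N).
have dv x : is_derive x (1 : R) v (derive1 v x) by apply: is_derive_derive1; exact: (s2 0%N).
have Re0 : Rintegral mu setT (fun x => Re (cderive1n 1 f x * expi (x * s)) -
    s * Im (f x * expi (x * s))) = 0.
  apply: (@Rintegral_derivative _ _ (fun x => u x * cos (x * s) - v x * sin (x * s))).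
  - under eq_fun do rewrite RedE ImE.
    exact: cB (cB _ _ (cM _ _ cu' cc) (cM _ _ cv' cs)) (cK _ _ (cD _ _ (cM _ _ cu cs) (cM _ _ cv cc))).
  - by apply: RintegrableB => //; exact: RintegrableZ.
  - move=> x; have := is_deriveB (is_deriveM (du x) (is_derive_cosM s x))
      (is_deriveM (dv x) (is_derive_sinM s x)).
    by move=> h; apply: (is_derive_eq h); rewrite RedE ImE /GRing.scale/=; ring.
  - have := bnd (@complex.Re R) (@normc_Re R).
    by under eq_fun do rewrite !ReE.
have Im0 : Rintegral mu setT (fun x => Im (cderive1n 1 f x * expi (x * s)) +
    s * Re (f x * expi (x * s))) = 0.
  apply: (@Rintegral_derivative _ _ (fun x => u x * sin (x * s) + v x * cos (x * s))).
  - under eq_fun do rewrite ImdE ReE.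
    exact: cD (cD _ _ (cM _ _ cu' cs) (cM _ _ cv' cc)) (cK _ _ (cB _ _ (cM _ _ cu cc) (cM _ _ cv cs))).
  - by apply: RintegrableD => //; exact: RintegrableZ.
  - move=> x; have := is_deriveD (is_deriveM (du x) (is_derive_sinM s x))
      (is_deriveM (dv x) (is_derive_cosM s x)).
    by move=> h; apply: (is_derive_eq h); rewrite ImdE ReE /GRing.scale/=; ring.
  - have := bnd (@complex.Im R) (@normc_Im R).
    by under eq_fun do rewrite !ImE.
have Z k p := @RintegrableZ R k p.
apply: eq_ReIm; rewrite ?ReM ?ImM /cintegral /= ?mul0r.
- move: Re0; rewrite RintegralB//; last exact: Z.
  by rewrite RintegralZl// => /eqP; rewrite subr_eq0 => /eqP ->; rewrite sub0r mulNr opprK.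
- move: Im0; rewrite RintegralD//; last exact: Z.
  by rewrite RintegralZl// => /eqP; rewrite addr_eq0 => /eqP ->; rewrite add0r mulNr.
Qed.

Lemma fourierE f xi : fourier f xi = cintegral (fun x => f x * expi (x * - (2 * pi * xi))).
Proof. by apply: eq_cintegral => x; congr (_ * expi _); ring. Qed.

Lemma fourier_injective f : continuous (fun x => Re (f x)) ->
  continuous (fun x => Im (f x)) -> cintegrable f -> (forall xi, fourier f xi = 0) ->
  forall x, f x = 0.
Proof.
move=> s1 s2 [I1 I2] f0.
set u := fun x => Re (f x) in s1; set v := fun x => Im (f x) in s2.
have {}I1 : Rintegrable u by [].
have {}I2 : Rintegrable v by [].
have p0 : 2 * pi != 0 :> R by rewrite mulf_neq0// gt_eqF// pi_gt0.
have J t : cintegral (fun x => f x * expi (x * t)) = 0.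
  rewrite -(f0 (- t / (2 * pi))) fourierE; apply: eq_cintegral => x.
  by rewrite mulrCA divff// mulr1 opprK.
have cs t :
    Rintegral mu setT (fun x => u x * cos (x * t)) = Rintegral mu setT (fun x => v x * sin (x * t)) /\
    Rintegral mu setT (fun x => u x * sin (x * t)) = - Rintegral mu setT (fun x => v x * cos (x * t)).
  split.
  - have /= := congr1 (@complex.Re R) (J t); under eq_Rintegral do rewrite ReM/=.
    rewrite RintegralB//; [|exact: Rintegrable_cos|exact: Rintegrable_sin].
    by move/eqP; rewrite subr_eq0 => /eqP.
  - have /= := congr1 (@complex.Im R) (J t); under eq_Rintegral do rewrite ImM/=.
    rewrite RintegralD//; [|exact: Rintegrable_sin|exact: Rintegrable_cos].
    by move/eqP; rewrite addr_eq0 => /eqP.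
have cosNE w t : Rintegral mu setT (fun x => w x * cos (x * - t)) =
    Rintegral mu setT (fun x => w x * cos (x * t)).
  by apply: eq_Rintegral => x _; rewrite mulrN cosN.
have sinNE w t : Rintegrable w -> Rintegral mu setT (fun x => w x * sin (x * - t)) =
    - Rintegral mu setT (fun x => w x * sin (x * t)).
  move=> Iw; rewrite -[RHS]mulN1r -RintegralZl//; last exact: Rintegrable_sin.
  by apply: eq_Rintegral => x _; rewrite mulrN sinN; ring.
(* Comparing [t] with [- t] decouples [u] from [v]: the cosine transforms are even in [t], the sine
   transforms odd. *)
have [u1 v1] : (forall x, u x = 0) /\ (forall x, v x = 0).
  split; apply: fourier_transform_injective => //.
  - by move=> t; have [a _] := cs t; have [b _] := cs (- t); rewrite cosNE sinNE// in b; lra.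
  - by move=> t; have [_ a] := cs t; have [_ b] := cs (- t); rewrite cosNE sinNE// in b; lra.
  - by move=> t; have [_ a] := cs t; have [_ b] := cs (- t); rewrite cosNE sinNE// in b; lra.
  - by move=> t; have [a _] := cs t; have [b _] := cs (- t); rewrite cosNE sinNE// in b; lra.
by move=> x; apply: eq_ReIm; [exact: u1|exact: v1].
Qed.

Theorem half_laplacian_hardy f : smooth f -> hardy f -> cintegrable (cderive1n 1 f) ->
  normc (f n%:R) @[n --> \oo] --> (0 : R) -> normc (f (- n%:R)) @[n --> \oo] --> (0 : R) ->
  half_laplacian f = half_deriv f.
Proof.
move=> sf [If Hf] If' f1 f2.
have p0 : 2 * pi != 0 :> R by rewrite mulf_neq0// gt_eqF// pi_gt0.
have Ih : cintegrable (half_deriv f) by exact: cintegrableZ.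
have sh := smooth_half_deriv sf.
have Fh xi : fourier (half_deriv f) xi = `|xi|%:C * fourier f xi.
  rewrite !fourierE; set s := - (2 * pi * xi).
  under eq_cintegral do rewrite /half_deriv -mulrA.
  rewrite cintegralZ; last exact: cintegrable_expi.
  rewrite cintegral_derive//.
  (* For negative [xi] the frequency [s] is positive and both sides vanish by the [hardy] condition;
     for the others [|xi|] is [xi]. *)
  have [xi0|xi0] := leP 0 xi; last by rewrite Hf ?mulr0// /s oppr_gt0 pmulr_rlt0// mulr_gt0// pi_gt0.
  rewrite mulrA; congr (_ * _); rewrite ger0_norm//.
  rewrite invc_im// /s; move: p0; move: (2 * pi) => k k0.
  by apply: eq_ReIm; rewrite ?ReM ?ImM/=; field.
(* [half_deriv f] lies in the defining set, so the default value is not taken; any other member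
   differs from it by a continuous integrable function with zero transform. *)
rewrite /half_laplacian; apply: xget_unique; first by split.
move=> g [sg Ig Fg]; apply/funext => x.
pose d x := g x + (- 1) * half_deriv f x.
have IN : cintegrable (fun x => (-1) * half_deriv f x) by exact: cintegrableZ.
have d0 : d x = 0.
  have /smoothE[/smooth_real_continuous g1 /smooth_real_continuous g2] := sg.
  have /smoothE[/smooth_real_continuous h1 /smooth_real_continuous h2] := sh.
  apply: fourier_injective.
  - move=> y; under eq_fun do rewrite /d ReD mulN1r.
    by apply: cvgD; [exact: g1|]; under eq_fun do rewrite raddfN/=; apply: cvgN; exact: h1.
  - move=> y; under eq_fun do rewrite /d ImD mulN1r.
    by apply: cvgD; [exact: g2|]; under eq_fun do rewrite raddfN/=; apply: cvgN; exact: h2.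
  - exact: cintegrableD.
  - move=> xi; rewrite fourierE; under eq_cintegral do rewrite /d mulrDl.
    rewrite cintegralD; [|exact: cintegrable_expi|exact: cintegrable_expi].
    have -> : cintegral (fun x => -1 * half_deriv f x * expi (x * - (2 * pi * xi))) =
        -1 * cintegral (fun x => half_deriv f x * expi (x * - (2 * pi * xi))).
      rewrite -cintegralZ; last exact: cintegrable_expi.
      by apply: eq_cintegral => y; rewrite mulrA.
    by rewrite -!fourierE Fg Fh mulN1r subrr.
by move: d0; rewrite /d mulN1r => /eqP; rewrite subr_eq0 => /eqP.
Qed.

End half_laplacian_boundary_values.

(** * Enumeration of sets of finite density *)

Section enumeration.
Variable R : realType.
Implicit Types (alpha r x y C : R) (A B : set R) (lam : nat -> R).

Lemma upper_density_cell alpha A : (upper_density alpha A < +oo)%E ->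
  exists2 r : R, 0 < r & exists K : nat, forall B, is_interval B -> lebesgue_measure B = r%:E ->
    finite_set ((Gpow alpha @` A) `&` B) /\
    (size (finmap.enum_fset (fset_set ((Gpow alpha @` A) `&` B))) <= K)%N.
Proof.
move=> /ereal_inf_lt[_ [V [M [_ MV]] <-] supV].
(* A positive length beyond [M], hence in the neighbourhood [V] of infinity on which the densities
   have a finite supremum. One such length is enough. *)
pose r := Num.max M 0 + 1.
have r0 : 0 < r by rewrite ltr_wpDl// le_max lexx orbT.
have Vr : V r by apply: MV; rewrite ltr_pwDr// le_max lexx.
exists r => //.
have [c cP] : exists c : R, forall B, is_interval B -> lebesgue_measure B = r%:E ->
    (counting ((Gpow alpha @` A) `&` B) * (r^-1)%:E <= c%:E)%E.
  set sr := ereal_sup _ in supV.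
  have cnt0 (X : set R) : (0 <= counting (R := R) X)%E.
    by rewrite /counting; case: ifP => _; rewrite ?leey// lee_fin.
  have bnd B : is_interval B -> lebesgue_measure B = r%:E ->
      (counting (R := R) ((Gpow alpha @` A) `&` B) * (r^-1)%:E <= sr)%E.
    move=> iB mB; apply: le_trans (ereal_sup_ubound (imageP _ Vr)).
    by apply: ereal_sup_ubound; exists B.
  case: sr supV bnd => [c _ bnd| // |_ bnd]; first by exists c.
  by exists 0 => B iB mB; apply: le_trans (bnd B iB mB) _; exact: leNye.
exists (Num.truncn `|c * r|).+1 => B iB mB.
have := cP B iB mB; rewrite /counting; case: ifPn => [/asboolP fB|_]; last first.
  by rewrite gt0_mulye ?lte_fin ?invr_gt0// leye_eq.
rewrite -EFinM lee_fin ler_pdivrMr// => h; split=> //.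
rewrite ltnW// -(ltr_nat R) (le_lt_trans h)// (le_lt_trans (ler_norm _))//.
exact: truncnS_gt.
Qed.

Definition Gpow_inv alpha y : R := Num.sg y * `|y| `^ alpha.

Lemma normr_sg_powR (s y : R) : s != 0 -> `|Num.sg y * `|y| `^ s| = `|y| `^ s.
Proof.
move=> s0; rewrite normrM normr_sg [`|_ `^ _|]ger0_norm ?powR_ge0//.
have [->|y0] := eqVneq y 0; first by rewrite normr0 powR0// mulr0.
by rewrite mul1r.
Qed.

Lemma GpowK alpha : 0 < alpha -> cancel (@Gpow R alpha) (Gpow_inv alpha).
Proof.
move=> a0 x; rewrite /Gpow_inv normr_sg_powR ?invr_eq0 ?gt_eqF//.
rewrite -powRrM mulVf ?gt_eqF// powRr1// /Gpow sgrM sgr_id.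
have [->|x0] := eqVneq x 0; first by rewrite normr0 mulr0.
by rewrite [Num.sg (_ `^ _)]gtr0_sg ?mulr1 ?mulr_sg_norm// powR_gt0// normr_gt0.
Qed.

(** A polynomial bound on the counting function, in inverted form: it bounds the index by the
    modulus, so that at most [C * (1 + r) ^+ N] indices have [|lam k| <= r]. Repetitions are
    allowed. *)
Definition poly_growth lam := exists C (N : nat), forall k, k.+1%:R <= C * (1 + `|lam k|) ^+ N.

(** The image of [A] under [Gpow alpha] has boundedly many points per cell of length [r]; listing it
    cell by cell, by increasing modulus, gives linear growth, and pulling back by [Gpow_inv] changes
    only the degree. The sequence may take values outside [A], which only adds zeros. *)
Lemma upper_density_enum alpha A : 0 < alpha -> (upper_density alpha A < +oo)%E ->
  exists2 lam, poly_growth lam & forall x, A x -> exists k, lam k = x.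
Proof.
move=> a0 /upper_density_cell[r r0 [K KP]].
set GA := Gpow alpha @` A in KP.
(* Mirror-image half-open cells that cover the line; points of both cells of index [m] have modulus
   at least [m%:R * r]. *)
pose Bp (m : nat) := `[m%:R * r, m.+1%:R * r[%classic.
pose Bn (m : nat) := `](- (m.+1%:R * r)), (- (m%:R * r))]%classic.
have mlt (m : nat) : m%:R * r < m.+1%:R * r by rewrite ltr_pM2r// ltr_nat.
have Kp m : finite_set (GA `&` Bp m) /\ (size (finmap.enum_fset (fset_set (GA `&` Bp m))) <= K)%N.
  apply: KP; first exact: interval_is_interval.
  by rewrite lebesgue_measure_itv/= lte_fin mlt -EFinB -mulrBl -natr1 addrAC subrr add0r mul1r.
have Kn m : finite_set (GA `&` Bn m) /\ (size (finmap.enum_fset (fset_set (GA `&` Bn m))) <= K)%N.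
  apply: KP; first exact: interval_is_interval.
  rewrite lebesgue_measure_itv/= lte_fin ltrN2 mlt -EFinB opprK addrC -mulrBl -natr1 addrAC subrr.
  by rewrite add0r mul1r.
pose s m := finmap.enum_fset (fset_set (GA `&` Bp m)) ++ finmap.enum_fset (fset_set (GA `&` Bn m)).
have ss m : (size (s m) <= K + K)%N by rewrite size_cat leq_add//; [case: (Kp m)|case: (Kn m)].
have sP m y : (y \in s m) = (y \in GA) && ((y \in Bp m) || (y \in Bn m)).
  have e1 : (y \in finmap.enum_fset (fset_set (GA `&` Bp m))) = (y \in GA `&` Bp m).
    by rewrite -(in_fset_set (proj1 (Kp m))).
  have e2 : (y \in finmap.enum_fset (fset_set (GA `&` Bn m))) = (y \in GA `&` Bn m).
    by rewrite -(in_fset_set (proj1 (Kn m))).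
  by rewrite mem_cat e1 e2 !in_setI; case: (y \in GA).
(* A pair of cells holds at most [K + K] points; the successor keeps the block length positive for
   division with remainder. *)
pose L := (K + K).+1.
(* Blocks are padded by the default value [m%:R * r], whose modulus also satisfies the bound
   [y_ge]. *)
pose y k := nth ((k %/ L)%:R * r) (s (k %/ L)%N) (k %% L)%N.
have y_ge k : (k %/ L)%:R * r <= `|y k|.
  rewrite /y; set m := (k %/ L)%N; have mr0 : 0 <= m%:R * r by rewrite mulr_ge0// ltW.
  have [kl|kl] := ltnP (k %% L)%N (size (s m)); last by rewrite nth_default// ler_norm.
  have := mem_nth (m%:R * r) kl; rewrite sP /Bp /Bn.
  move=> /andP[_ /orP[]] /set_mem/=; rewrite in_itv/= => /andP[y1 y2].
    by rewrite (le_trans y1)// ler_norm.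
  have y0 : nth (m%:R * r) (s m) (k %% L) <= 0 by apply: le_trans y2 _; rewrite oppr_le0.
  by rewrite (ler0_norm y0) lerNr.
exists (fun k => Gpow_inv alpha (y k)).
(* [N] is an integer above [alpha^-1], the power by which [Gpow alpha] raises moduli. *)
- pose N := (Num.truncn alpha^-1).+1; exists (L%:R * (1 + r^-1)), N => k.
  set m := (k %/ L)%N; set b := `|Gpow_inv alpha (y k)|.
  have b0 : 0 <= b by exact: normr_ge0.
  have yb : `|y k| <= (1 + b) ^+ N.
    have -> : `|y k| = b `^ alpha^-1.
      by rewrite /b normr_sg_powR ?gt_eqF// -powRrM divff ?gt_eqF// powRr1.
    rewrite -powR_mulrn ?addr_ge0//.
    apply: (@le_trans _ _ ((1 + b) `^ alpha^-1)).
      by apply: ge0_ler_powR; rewrite ?nnegrE ?addr_ge0 ?invr_ge0 ?(ltW a0)// lerDr.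
    by apply: ler_powR; [rewrite lerDl|rewrite ltW// truncnS_gt].
  have mN : m%:R <= r^-1 * (1 + b) ^+ N.
    by rewrite mulrC ler_pdivlMr// (le_trans (y_ge k)).
  apply: (@le_trans _ _ (L%:R * m.+1%:R)).
    by rewrite -natrM ler_nat mulnC ltn_ceil.
  rewrite -mulrA ler_wpM2l// -nat1r mulrDl mul1r lerD//.
  by rewrite exprn_ege1// lerDl.
- move=> x Ax; pose m := Num.truncn (`|Gpow alpha x| / r).
  have Gx : Gpow alpha x \in s m.
    have /andP[m1 m2] := truncn_itv (divr_ge0 (normr_ge0 (Gpow alpha x)) (ltW r0)).
    rewrite -/m ler_pdivlMr// in m1; rewrite -/m ltr_pdivrMr// in m2.
    rewrite sP; apply/andP; split; first by apply/mem_set; exists x.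
    have [g0|g0] := leP 0 (Gpow alpha x).
      rewrite (ger0_norm g0) in m1 m2.
      by apply/orP; left; apply/mem_set; rewrite /Bp /= in_itv/= m1 m2.
    rewrite (ltr0_norm g0) in m1 m2.
    by apply/orP; right; apply/mem_set; rewrite /Bn /= in_itv/= ltrNl lerNr m1 m2.
  pose i := index (Gpow alpha x) (s m).
  have iL : (i < L)%N by rewrite ltnS (leq_trans _ (ss m))// ltnW// index_mem.
  exists (m * L + i)%N; rewrite -[RHS](GpowK a0); congr (Gpow_inv _ _).
  by rewrite /y divnMDl// modnMDl divn_small// modn_small// addn0 nth_index.
Qed.

Definition interleave (T : Type) (u v : nat -> T) k := if odd k then v k./2 else u k./2.

Lemma interleave_even T (u v : nat -> T) k : interleave u v k.*2 = u k.
Proof. by rewrite /interleave odd_double doubleK. Qed.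

Lemma interleave_odd T (u v : nat -> T) k : interleave u v k.*2.+1 = v k.
Proof. by rewrite /interleave /= odd_double uphalf_double. Qed.

Lemma poly_growth_interleave lam1 lam2 : poly_growth lam1 -> poly_growth lam2 ->
  poly_growth (interleave lam1 lam2).
Proof.
move=> [C1 [N1 h1]] [C2 [N2 h2]]; exists (2 * (`|C1| + `|C2|)), (N1 + N2)%N => k.
have key (C : R) N N' x : `|C| <= `|C1| + `|C2| -> (N <= N')%N ->
    (k./2).+1%:R <= C * (1 + `|x|) ^+ N -> k.+1%:R <= 2 * (`|C1| + `|C2|) * (1 + `|x|) ^+ N'.
  move=> CC NN h.
  apply: (@le_trans _ _ (2 * (k./2).+1%:R)).
    by rewrite -natrM ler_nat mul2n doubleS -[in X in (X <= _)%N](odd_double_half k); case: (odd k).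
  rewrite -mulrA ler_pM2l// (le_trans h)//.
  have p : 1 <= 1 + `|x| by rewrite lerDl.
  apply: (@le_trans _ _ (`|C| * (1 + `|x|) ^+ N)).
    by rewrite ler_wpM2r ?ler_norm// exprn_ge0// addr_ge0.
  by rewrite ler_pM// ?exprn_ge0 ?addr_ge0// ler_weXn2l.
rewrite /interleave; case: ifP => _.
  by apply: (key C2 N2) => //; [rewrite lerDr|rewrite leq_addl].
by apply: (key C1 N1) => //; [rewrite lerDl|rewrite leq_addr].
Qed.

End enumeration.

(** * Convergence of the series of inverse powers, and points outside a sequence *)

Section summability.
Variable R : realType.

(** The integral test as a telescoping sum: [T] is the antiderivative up to a constant, and its
    decrements are bounded below by means of ln (1 - q) <= - q and exp z >= 1 + z. *)
Lemma sum_invr_powR (s : R) n : 1 < s ->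
  \sum_(0 <= k < n) (k.+1%:R `^ s)^-1 <= 1 + (s - 1)^-1.
Proof.
move=> s1; have d0 : 0 < s - 1 by rewrite subr_gt0.
pose T k : R := (k.+1%:R `^ (s - 1))^-1.
have T0 k : 0 <= T k by rewrite invr_ge0 powR_ge0.
have step k : (k.+2%:R `^ s)^-1 <= (s - 1)^-1 * (T k - T k.+1).
  have k2 : 0 < k.+2%:R :> R by [].
  have k1 : 0 < k.+1%:R :> R by [].
  set q := (k.+2%:R)^-1 : R.
  have q0 : 0 < q by rewrite invr_gt0.
  have Tk1 : 0 < T k.+1 by rewrite invr_gt0 powR_gt0.
  have -> : (k.+2%:R `^ s)^-1 = q * T k.+1.
    by rewrite /q /T -invfM -{2}(powRr1 (ltW k2)) -powRD ?subrKC// ?(gt_eqF k2) ?implybT//.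
  rewrite [leRHS]mulrC ler_pdivlMr// -mulrA mulrC -mulrA.
  have ratio : T k = T k.+1 * expR ((s - 1) * - ln (1 - q)).
    have e : 1 - q = k.+1%:R / k.+2%:R.
      rewrite /q; apply: (mulIf (lt0r_neq0 k2)); rewrite divfK ?gt_eqF// mulrBl.
      by rewrite mulVf ?gt_eqF// mul1r -[k.+2%:R]natr1 addrK.
    rewrite e /T ln_div ?posrE// mulrN expRN -[k.+1%:R `^ _](@lnK R) ?posrE ?powR_gt0//.
    rewrite -[k.+2%:R `^ _](@lnK R) ?posrE ?powR_gt0// !ln_powR -!expRN -expRD; congr expR; ring.
  have -> : T k - T k.+1 = T k.+1 * (expR ((s - 1) * - ln (1 - q)) - 1) by rewrite {1}ratio; ring.
  rewrite ler_wpM2l//.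
  have h1 : ln (1 - q) <= - q.
    by apply: le_ln1Dx; rewrite ltrN2 /q invf_lt1// ltr1n.
  rewrite lerBrDr addrC; apply: le_trans (expR_ge1Dx _).
  by rewrite lerD2l ler_wpM2l ?(ltW d0)// lerNr.
case: n => [|n]; first by rewrite big_nil addr_ge0// invr_ge0 ltW.
rewrite big_nat_recl//= powR1 invr1 lerD2l.
apply: (@le_trans _ _ (\sum_(0 <= k < n) (s - 1)^-1 * (T k - T k.+1))).
  by apply: ler_sum => k _; exact: step.
rewrite -mulr_sumr ler_piMr ?invr_ge0 ?(ltW d0)//.
rewrite (telescope_sumr_eq (fun k => - T k))//; last by move=> k _; rewrite opprK addrC.
by rewrite opprK addrC /T powR1 invr1 gerDl oppr_le0.
Qed.

Lemma sum_half (u : nat -> R) m : \sum_(0 <= n < m.*2) u n./2 = 2 * \sum_(0 <= k < m) u k.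
Proof.
elim: m => [|m ih]; first by rewrite !big_nil mulr0.
by rewrite doubleS !big_nat_recr//= ih doubleK uphalf_double; ring.
Qed.

Lemma summable_tail (d : nat -> R) (D e : R) : (forall k, 0 <= d k) ->
  (forall n, \sum_(0 <= k < n) d k <= D) -> 0 < e ->
  exists m, forall n, (m <= n)%N -> \sum_(m <= k < n) d k <= e.
Proof.
move=> d0 dD e0.
have cvg_d : cvgn (series d).
  apply: nondecreasing_is_cvgn; first by apply: nondecreasing_series => n _ _; exact: d0.
  by exists D => _ [n _ <-]; rewrite /series/=; exact: dD.
have nd : nondecreasing_seq (series d) by apply: nondecreasing_series => n _ _; exact: d0.
have /cvgrPdist_le/(_ _ e0)[m _ mP] : series d @ \oo --> limn (series d) by [].
exists m => n mn.
have := mP m (leqnn m) => /=.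
have le1 := nondecreasing_cvgn_le nd cvg_d n.
have le2 := nondecreasing_cvgn_le nd cvg_d m.
rewrite ger0_norm ?subr_ge0// => h.
have -> : \sum_(m <= k < n) d k = series d n - series d m.
  by rewrite /series/= [X in X - _](big_cat_nat (n := m))//= addrAC subrr add0r.
lra.
Qed.

Lemma exists_notin_range (lam : nat -> R) : exists x, forall k, lam k != x.
Proof.
apply: contrapT => h.
have all x : exists k, lam k = x.
  apply: contrapT => hx; apply: h; exists x => k; apply/eqP => kx; apply: hx; by exists k.
have c01 : countable (`[0, 1]%classic : set R).
  apply: card_le_trans (subset_card_le _) (card_image_le lam setT).
  by move=> x _; have [k <-] := all x; exists k.
have := countable_lebesgue_measure0 c01.
rewrite lebesgue_measure_itv/= lte_fin ltr01 -EFinB subr0.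
by move/eqP; rewrite eqe oner_eq0.
Qed.

End summability.

(** * The infinite product *)

Section construction.
Variables (R : realType) (s : R) (lam : nat -> R) (C : R) (N : nat).
Local Notation Re := complex.Re.
Local Notation Im := complex.Im.
Hypothesis s12 : 1 < s <= 2.
Hypothesis C1 : 1 <= C.
Hypothesis lam_growth : forall k, k.+1%:R <= C * (1 + `|lam k|) ^+ N.
Implicit Types (x t : R) (n k : nat).

Definition scale k : R := k.+1%:R `^ s.

(* Even factors produce the decay, odd factors the zeros:
   [1 - poissonc e l x = (x - l) / (x - l + i e)]. *)
Definition factor n x : R[i] :=
  if odd n then 1 - poissonc (scale n./2)^-1 (lam n./2) x else poissonc (scale n./2) 0 x.

(** Common notation for both parities: with [rho n] = i c / (x - l + i c), [factor n] is [rho n] or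
    [1 - rho n], and its only pole is l - i c. *)
Let c n := if odd n then (scale n./2)^-1 else scale n./2.
Let l n := if odd n then lam n./2 else 0.
Let rho n x := poissonc (c n) (l n) x.
Let v n x := if odd n then rho n x else - rho n x.
Let w n x : R[i] := (x - l n) +i* c n.
Let d n := (scale n./2)^-1.
(* [kappa x] bounds the indices [k] with [|lam k| <= |x| + 1], so that the
   poles [x - w n x] are at distance at least [kappa x ^- 2] from [x]; squaring this
   distance makes the perturbation of an odd factor on the disc of radius [rad x]
   around [x] at most [d n]. *)
Let kappa x := C * (2 + `|x|) ^+ N.
Let rad x := (kappa x ^+ 4)^-1 / 2.
Let g x n := if odd n then 1 else normc (poissonc (scale n./2) 0 x).

Lemma scale_ge1 k : 1 <= scale k.
Proof.
have /andP[s1 _] := s12.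
apply: (@le_trans _ _ (k.+1%:R `^ 0)); first by rewrite powRr0.
by rewrite /scale ler_powR ?ler1n// ltW// (lt_trans _ s1).
Qed.

Lemma scale_gt0 k : 0 < scale k. Proof. exact: lt_le_trans (scale_ge1 k). Qed.

Let c_gt0 n : 0 < c n.
Proof. by rewrite /c; case: odd; rewrite ?invr_gt0 scale_gt0. Qed.

Let d_gt0 n : 0 < d n. Proof. by rewrite invr_gt0 scale_gt0. Qed.

Let wE n x : w n x = 'i * (c n +i* (l n - x)).
Proof. by apply: eq_ReIm; rewrite ?ReM ?ImM/=; ring. Qed.

Let normc_w n x : normc (w n x) = normc (c n +i* (l n - x)).
Proof. by rewrite wE Normc.normcM (_ : normc 'i = 1) ?mul1r//= expr0n/= add0r expr1n sqrtr1. Qed.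

Let c_le_w n x : c n <= normc (w n x).
Proof. by rewrite (le_trans _ (normc_Im _))//= ler_norm. Qed.

Let w_gt0 n x : 0 < normc (w n x). Proof. exact: lt_le_trans (c_le_w n x). Qed.

Let w_shift n x t : w n (x + t) = w n x + t%:C.
Proof. by apply: eq_ReIm; rewrite /=; ring. Qed.

Let rhoE n x : rho n x = 'i * (c n)%:C / w n x.
Proof.
rewrite /rho /poissonc wE invfM.
have i0 : 'i != 0 :> R[i] by rewrite eq_complex/= negb_and oner_eq0 orbT.
by rewrite mulrACA divff ?mul1r.
Qed.

Let normc_rho n x : normc (rho n x) = c n / normc (w n x).
Proof. by rewrite /rho /poissonc Normc.normcM Normc.normcV normc_real gtr0_norm// normc_w. Qed.

Let factorE n x : factor n x = if odd n then 1 - rho n x else rho n x.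
Proof. by rewrite /factor /rho /c /l; case: odd. Qed.

Let one_rhoE n x : 1 - rho n x = (x - l n)%:C / w n x.
Proof.
have w0 : w n x != 0 by rewrite -normc_gt0.
rewrite rhoE; apply: (mulIf w0); rewrite mulrBl !divfK// mul1r.
by apply: eq_ReIm; rewrite /=; ring.
Qed.

Let normc_one_rho n x : normc (1 - rho n x) = `|x - l n| / normc (w n x).
Proof. by rewrite one_rhoE Normc.normcM Normc.normcV normc_real. Qed.

Lemma normc_factor_le1 n x : normc (factor n x) <= 1.
Proof.
rewrite factorE; case: odd; last by rewrite normc_rho ler_pdivrMr// mul1r.
by rewrite normc_one_rho ler_pdivrMr// mul1r (le_trans _ (normc_Re _)).
Qed.

Let oddS k : odd k.*2.+1 = true. Proof. by rewrite /= odd_double. Qed.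

Lemma normc_factor_zero k x : normc (factor k.*2.+1 x) <= scale k * `|x - lam k|.
Proof.
rewrite factorE oddS normc_one_rho ler_pdivrMr// {1}/l oddS /= uphalf_double.
have h : (scale k)^-1 <= normc (w k.*2.+1 x).
  by have := c_le_w k.*2.+1 x; rewrite {1}/c oddS /= uphalf_double.
rewrite mulrAC ler_peMl// -[leLHS](divff (lt0r_neq0 (scale_gt0 k))) ler_wpM2l//.
by rewrite ltW// scale_gt0.
Qed.

Let factor_shift n x t : factor n (x + t) = factor n x + v n x * t%:C / (w n x + t%:C).
Proof.
have w0 : w n x != 0 by rewrite -normc_gt0.
have wt0 : w n x + t%:C != 0 by rewrite -w_shift -normc_gt0.
have E : rho n (x + t) = rho n x - rho n x * t%:C / (w n x + t%:C).
  by rewrite !rhoE w_shift; field; rewrite w0 wt0.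
by rewrite !factorE /v; case: odd; rewrite E; ring.
Qed.

Let kappa_ge1 x : 1 <= kappa x.
Proof.
by rewrite -[leLHS]mulr1 ler_pM// exprn_ege1// -[leLHS]addr0 lerD// ler1n.
Qed.

Let kappa_gt0 x : 0 < kappa x. Proof. exact: lt_le_trans (kappa_ge1 x). Qed.

Let lam_near k x : `|lam k| <= `|x| + 1 -> k.+1%:R <= kappa x.
Proof.
move=> h; apply: le_trans (lam_growth k) _; rewrite ler_pM2l ?(lt_le_trans _ C1)//.
by rewrite lerXn2r ?nnegrE ?addr_ge0//; lra.
Qed.

Let k2_ge1 x : 1 <= kappa x ^+ 2. Proof. by rewrite exprn_ege1. Qed.

Let w_far n x : odd n -> `|x| + 1 < `|lam n./2| -> 1 <= normc (w n x).
Proof.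
move=> no far; apply: le_trans (normc_Re _); rewrite /w/= /l no distrC.
by have := lerB_dist (lam n./2) x; lra.
Qed.

Let w_even n x : ~~ odd n -> scale n./2 <= normc (w n x).
Proof. by move=> no; have := c_le_w n x; rewrite {1}/c (negbTE no). Qed.

(** Even factors, and odd ones with [lam n./2] far from [x], have their pole at distance at least 1.
    For the remaining ones the height of the pole decides. *)
Let w_ge n x : (kappa x ^+ 2)^-1 <= normc (w n x).
Proof.
have k2' : (kappa x ^+ 2)^-1 <= 1 by rewrite invf_le1// (lt_le_trans _ (k2_ge1 x)).
have [no|ne] := boolP (odd n); last first.
  by apply: le_trans k2' _; apply: le_trans (scale_ge1 _) (w_even _ ne).
have [near|far] := leP `|lam n./2| (`|x| + 1); last exact: le_trans k2' (w_far no far).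
apply: le_trans (c_le_w n x); rewrite /c no lef_pV2 ?posrE ?exprn_gt0 ?scale_gt0//.
(* [s <= 2] bounds [scale k] by the square of [k.+1], hence by [kappa x ^+ 2]. *)
have /andP[_ s2] := s12.
apply: (@le_trans _ _ (n./2.+1%:R `^ 2%:R)); first by rewrite ler_powR// ler1n.
by rewrite powR_mulrn// lerXn2r ?nnegrE ?(ltW (kappa_gt0 x))//; exact: lam_near.
Qed.

Let rad_gt0 x : 0 < rad x.
Proof. by rewrite /rad divr_gt0// invr_gt0 exprn_gt0. Qed.

Let rad2 x : 2 * rad x = (kappa x ^+ 4)^-1.
Proof. by rewrite /rad mulrC divfK. Qed.

Let rad2_gt0 x : 0 < 2 * rad x. Proof. by rewrite mulr_gt0. Qed.

Let rad_w_ge0 n x : 0 <= 2 * rad x / normc (w n x).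
Proof. by apply: divr_ge0; [exact: ltW|exact: normc_ge0]. Qed.

Let c_w_ge0 n x : 0 <= c n / normc (w n x).
Proof. by apply: divr_ge0; [exact: ltW|exact: normc_ge0]. Qed.

Let rad_w2 n x : 2 * rad x <= normc (w n x) ^+ 2.
Proof.
rewrite rad2 -[4%N]/((2 * 2)%N) exprM -exprVn.
by rewrite lerXn2r ?nnegrE ?invr_ge0 ?exprn_ge0 ?(ltW (kappa_gt0 x)) ?normc_ge0.
Qed.

Let rad_le_half x : 2 * rad x <= 1.
Proof. by rewrite rad2 invf_le1 ?exprn_gt0// exprn_ege1. Qed.

Let rad_w n x : 2 * rad x <= normc (w n x).
Proof.
apply: le_trans (w_ge n x); rewrite rad2 lef_pV2 ?posrE ?exprn_gt0//.
by rewrite ler_weXn2l.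
Qed.

Let rad_lt_w n x : rad x < normc (w n x).
Proof. by have := rad_w n x; have := rad_gt0 x; lra. Qed.

Let ratio_le n x : rad x / (normc (w n x) - rad x) <= 2 * rad x / normc (w n x).
Proof.
have h := rad_lt_w n x; have h2 := rad_w n x; have h3 := rad_gt0 x.
rewrite ler_pdivrMr ?subr_gt0// mulrAC ler_pdivlMr//.
have := mulr_ge0 (ltW h3) (normc_ge0 (w n x)); nra.
Qed.

Let normc_v n x : normc (v n x) = c n / normc (w n x).
Proof. by rewrite /v; case: odd; rewrite ?normcN normc_rho. Qed.

Let gE n x : ~~ odd n -> g x n = normc (rho n x).
Proof. by move=> no; rewrite /g /rho /c /l (negbTE no). Qed.

(** For an even factor the perturbation has to be small relative to [g x n], which may itself be
    small; this works because [v n x] has the same modulus as the factor. *)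
Let factor_norm n x : normc (factor n x) + normc (v n x) * (rad x / (normc (w n x) - rad x)) <=
  g x n * (1 + d n).
Proof.
have w0 := w_gt0 n x; have r0 := rad_gt0 x.
apply: (@le_trans _ _ (normc (factor n x) + normc (v n x) * (2 * rad x / normc (w n x)))).
  by rewrite lerD2l ler_wpM2l ?normc_ge0.
have [no|ne] := boolP (odd n).
  rewrite /g no mul1r lerD ?normc_factor_le1// normc_v /c no -/(d n).
  have -> : d n / normc (w n x) * (2 * rad x / normc (w n x)) = d n * (2 * rad x / normc (w n x) ^+ 2).
    by field; rewrite gt_eqF.
  by rewrite ler_piMr ?(ltW (d_gt0 n))// ler_pdivrMr ?exprn_gt0// mul1r.
rewrite gE// factorE (negbTE ne) normc_v -normc_rho mulrDr mulr1 lerD2l ler_wpM2l ?normc_ge0//.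
rewrite ler_pdivrMr// (le_trans (rad_le_half x))// mulrC /d.
by rewrite ler_pdivlMr ?scale_gt0// mul1r w_even.
Qed.

Let near1_idx x := (Num.truncn (kappa x)).+1.*2.

Let far_idx n x : (near1_idx x <= n)%N -> odd n -> `|x| + 1 < `|lam n./2|.
Proof.
move=> xn no; rewrite ltNge; apply/negP => /lam_near; apply/negP; rewrite -ltNge.
apply: lt_trans (truncnS_gt _) _; rewrite ltr_nat ltnS -[X in (X <= _)%N]doubleK.
exact: half_leq.
Qed.

(** An even factor differs from 1 by [|x| / normc (w n x)], at most [|x| * d n], an odd one by at
    most [d n]; the second summand costs at most [d n] more. *)
Let factor_near1 n x : (near1_idx x <= n)%N ->
  normc (factor n x - 1) + normc (v n x) * (rad x / (normc (w n x) - rad x)) <=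
  (`|x| + 2) * d n.
Proof.
move=> xn; have w0 := w_gt0 n x; have r0 := rad_gt0 x.
apply: (@le_trans _ _ (normc (factor n x - 1) + normc (v n x) * (2 * rad x / normc (w n x)))).
  by rewrite lerD2l ler_wpM2l ?normc_ge0.
have [no|ne] := boolP (odd n).
  have w1 := w_far no (far_idx xn no).
  have rd : c n / normc (w n x) <= d n.
    by rewrite /c no ler_pdivrMr// ler_peMr// ltW// d_gt0.
  rewrite factorE no addrAC subrr add0r normcN normc_v normc_rho.
  have : c n / normc (w n x) * (2 * rad x / normc (w n x)) <= d n.
    rewrite -[leRHS]mulr1; apply: ler_pM rd _.
    - exact: c_w_ge0.
    - exact: rad_w_ge0.
    - by rewrite ler_pdivrMr// mul1r rad_w.
  have := mulr_ge0 (normr_ge0 x) (ltW (d_gt0 n)); rewrite mulrDl; lra.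
rewrite factorE (negbTE ne) normcB normc_one_rho normc_v {1}/l (negbTE ne) subr0.
have wd : (normc (w n x))^-1 <= d n by rewrite lef_pV2 ?posrE ?scale_gt0// w_even.
have h1 : `|x| / normc (w n x) <= `|x| * d n by rewrite ler_wpM2l.
have h2 : c n / normc (w n x) * (2 * rad x / normc (w n x)) <= d n.
  have q1 : c n / normc (w n x) <= 1 by rewrite ler_pdivrMr// mul1r.
  have q2 : 2 * rad x / normc (w n x) <= d n.
    rewrite -[leRHS]mul1r; apply: ler_pM (rad_le_half x) wd.
    - exact: ltW (rad2_gt0 x).
    - by rewrite invr_ge0 ltW.
  rewrite -[leRHS]mul1r; apply: ler_pM q1 q2.
  - exact: c_w_ge0.
  - exact: rad_w_ge0.
have := d_gt0 n; rewrite mulrDl; lra.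
Qed.

(** Twice the bound on the series of the 1 / a_k, since [d] takes each value for one even and one
    odd index. *)
Let D := 2 * (1 + (s - 1)^-1).

Let sum_d n : \sum_(0 <= k < n) d k <= D.
Proof.
have /andP[s1 _] := s12.
apply: (@le_trans _ _ (\sum_(0 <= k < n.*2) d k)).
  rewrite [leRHS](big_cat_nat (n := n))//=; last by rewrite -addnn leq_addr.
  by rewrite lerDl sumr_ge0// => k _; rewrite ltW.
rewrite (sum_half (fun k => (scale k)^-1)) ler_wpM2l//; exact: sum_invr_powR.
Qed.

Let g01 x n : 0 <= g x n <= 1.
Proof.
rewrite /g; case: odd; first by rewrite ler01 lexx.
by rewrite normc_ge0 normc_poissonc_le1// scale_gt0.
Qed.

Definition partial_prod x n : R[i] := \prod_(0 <= j < n) factor j x.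

Lemma local_series x : exists a : nat -> R[i],
  (forall M n, wsum (rad x) a n <= expR D * \prod_(0 <= k < M) g x k) /\
  (forall t, `|t| < rad x -> exists2 z, cvgc (partial_prod (x + t)) z & cvgc (psum a t) z).
Proof.
have [a [aK al]] := @moebius_product_series _ (fun n => factor n x) (v ^~ x) (w ^~ x)
  (rad x) D (`|x| + 2) (g x) d (near1_idx x) (rad_gt0 x) (rad_lt_w ^~ x) (g01 x)
  (fun k => ltW (d_gt0 k)) sum_d (fun k => factor_norm k x) (fun k => @factor_near1 k x).
exists a; split=> // t /al[z z1 z2]; exists z => //.
suff -> : partial_prod (x + t) = prodval (fun n => factor n x) (v ^~ x) (w ^~ x) t by [].
by apply/funext => n; apply: eq_bigr => j _; rewrite factor_shift.
Qed.

Lemma partial_prod_cvg : exists f : R -> R[i], forall x, cvgc (partial_prod x) (f x).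
Proof.
have ex x : exists z, cvgc (partial_prod x) z.
  have [a [_ /(_ 0)]] := local_series x; rewrite normr0 addr0 => /(_ (rad_gt0 x))[z z1 _].
  by exists z.
by have [f fP] := choice ex; exists f.
Qed.

Lemma partial_prod_decr m n x : (m <= n)%N ->
  normc (partial_prod x n) <= normc (partial_prod x m).
Proof.
move=> mn; rewrite /partial_prod (big_cat_nat (n := m))//= Normc.normcM ler_piMr ?normc_ge0//.
rewrite normc_prod big_nat; apply: prodr_ile1 => k _.
by rewrite normc_ge0 normc_factor_le1.
Qed.

Lemma partial_prod_le_factor k x : normc (partial_prod x k.+1) <= normc (factor k x).
Proof.
rewrite /partial_prod big_nat_recr//= Normc.normcM ler_piMl ?normc_ge0//.
by have := partial_prod_decr x (leq0n k); rewrite {2}/partial_prod big_nil Normc.normc1.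
Qed.

Lemma partial_prod_le_factors j k x : (j < k)%N ->
  normc (partial_prod x k.+1) <= normc (factor j x) * normc (factor k x).
Proof.
move=> jk; rewrite {1}/partial_prod big_nat_recr//= Normc.normcM ler_wpM2r ?normc_ge0//.
exact: le_trans (partial_prod_decr x jk) (partial_prod_le_factor j x).
Qed.

Variable f : R -> R[i].
Hypothesis f_cvg : forall x, cvgc (partial_prod x) (f x).

Lemma product_le_partial n x : normc (f x) <= normc (partial_prod x n).
Proof. by apply: (cvgc_le (f_cvg x)); exists n => // m /= nm; exact: partial_prod_decr. Qed.

Let local_series_f x : exists a : nat -> R[i],
  (forall M n, wsum (rad x) a n <= expR D * \prod_(0 <= k < M) g x k) /\
  (forall t, `|t| < rad x -> cvgc (psum a t) (f (x + t))).
Proof.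
have [a [aK al]] := local_series x; exists a; split=> // t /al[z z1 z2].
by rewrite (cvgc_unique (f_cvg (x + t)) z1).
Qed.

Lemma real_analytic_product : real_analytic f.
Proof.
move=> x; have [a [_ al]] := local_series_f x; exists (rad x) => //; exists a => y xy.
by have := al _ xy; rewrite subrKC.
Qed.

Let local_pseries_Re x a : (forall t, `|t| < rad x -> cvgc (psum a t) (f (x + t))) ->
  local_pseries (fun t => Re (f t)) x (rad x) (fun k => Re (a k)) /\
  local_pseries (fun t => Im (f t)) x (rad x) (fun k => Im (a k)).
Proof.
have psumRe (b : nat -> R[i]) t n : Re (psum b t n) = pseries (fun k => Re (b k)) t n.
  rewrite /psum /pseries /series/=; elim: n => [|n ih]; first by rewrite !big_nil.
  by rewrite !big_nat_recr//= ReD ih -rmorphXn/= ReM/= mulr0 subr0.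
have psumIm (b : nat -> R[i]) t n : Im (psum b t n) = pseries (fun k => Im (b k)) t n.
  rewrite /psum /pseries /series/=; elim: n => [|n ih]; first by rewrite !big_nil.
  by rewrite !big_nat_recr//= ImD ih -rmorphXn/= ImM/= mulr0 add0r.
move=> al; split=> t /al /cvgc_ReIm[h1 h2].
  by rewrite (_ : pseries _ t = (fun n => Re (psum a t n))) //; apply/funext => n; rewrite psumRe.
by rewrite (_ : pseries _ t = (fun n => Im (psum a t n))) //; apply/funext => n; rewrite psumIm.
Qed.

Lemma smooth_product : smooth f.
Proof.
move=> n x; have [a [_ /local_pseries_Re[h1 h2]]] := local_series_f x.
by split; [exact: derivable_local_pseries (rad_gt0 x) h1|exact: derivable_local_pseries (rad_gt0 x) h2].
Qed.

(** Cauchy's estimate on the disc of radius [rad x], whose inverse is [2 * kappa x ^+ 4]. The number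
    [M] of retained factors stays free, to be chosen according to [x]. *)
Lemma normc_cderive_product n x M : normc (cderive1n n f x) <=
  n`!%:R * (2 * kappa x ^+ 4) ^+ n * expR D * \prod_(0 <= k < M) g x k.
Proof.
have [a [aK /local_pseries_Re[h1 h2]]] := local_series_f x.
rewrite /cderive1n (local_pseries_derive1n0 n (rad_gt0 x) h1) (local_pseries_derive1n0 n (rad_gt0 x) h2).
have -> : (n`!%:R * Re (a n)) +i* (n`!%:R * Im (a n)) = (n`!%:R)%:C * a n.
  by apply: eq_ReIm; rewrite ?ReM ?ImM/=; ring.
rewrite Normc.normcM normc_real ger0_norm// -!mulrA ler_wpM2l//.
have := normc_coef_le n (ltW (rad_gt0 x)) (aK M).
by rewrite -ler_pdivlMr ?exprn_gt0// -exprVn /rad invf_div invrK mulrC.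
Qed.

Lemma normc_poissonc_decr k x : scale k <= `|x| ->
  normc (poissonc (scale k) 0 x) <= expR (- (1 / 4)).
Proof.
move=> kx; have a0 := scale_gt0 k.
rewrite -(ler_pXn2r (n := 2))// ?nnegrE ?normc_ge0 ?expR_ge0//.
rewrite normc_poissonc_sqr// subr0 -expRM_natl.
(* The squared modulus is at most 1/2, and 1/2 = 1 - 1/2 <= exp (- 1/2); this is the origin of the
   exponent 1/4. *)
apply: (@le_trans _ _ (1 / 2)).
  have x2 : scale k ^+ 2 <= x ^+ 2.
    by rewrite -[x ^+ 2]real_normK ?num_real// lerXn2r ?nnegrE ?(ltW a0).
  have p : 0 < scale k ^+ 2 + x ^+ 2 by rewrite ltr_wpDr ?sqr_ge0// exprn_gt0.
  by rewrite ler_pdivrMr//; lra.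
by apply: le_trans (expR_ge1Dx _); lra.
Qed.

Lemma prod_norm_decay x M : (forall k, (k < M)%N -> scale k <= `|x|) ->
  \prod_(0 <= n < M.*2) g x n <= expR (- (1 / 4)) ^+ M.
Proof.
elim: M => [|M ih] h; first by rewrite big_nil expr0.
have g1 : g x M.*2.+1 = 1 by rewrite /g oddS.
have g0 : g x M.*2 = normc (poissonc (scale M) 0 x) by rewrite /g odd_double doubleK.
rewrite doubleS !big_nat_recr//= g1 g0 mulr1 exprSr.
apply: ler_pM; rewrite ?normc_ge0//.
- by apply: prodr_ge0 => n _; case/andP: (g01 x n).
- by apply: ih => k kM; apply: h; exact: ltnW.
- by apply: normc_poissonc_decr; exact: h.
Qed.

Let s0 : 0 < s. Proof. by case/andP: s12 => s1 _; lra. Qed.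

(** About |x|^(1/s) of the a_k are at most |x|, and each of their factors contributes exp (- 1/4).
    The constant [expR (1 / 4)] pays for rounding down. *)
Lemma product_decay_aux x :
  \prod_(0 <= n < (Num.truncn (`|x| `^ s^-1)).*2) g x n <= expR (1 / 4) * expR (- (`|x| `^ s^-1 / 4)).
Proof.
set y := `|x| `^ s^-1; set M := Num.truncn y.
have y0 : 0 <= y by exact: powR_ge0.
apply: (@le_trans _ _ (expR (- (1 / 4)) ^+ M)).
  apply: prod_norm_decay => k kM.
  have -> : `|x| = y `^ s by rewrite /y -powRrM mulVf ?gt_eqF// powRr1.
  apply: ge0_ler_powR; rewrite ?nnegrE ?(ltW s0)//.
  by rewrite (@le_trans _ _ M%:R)// ?ler_nat// truncn_le.
rewrite -expRM_natl -expRD ler_expR.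
have := truncnS_gt y; rewrite -/M -natr1; lra.
Qed.

Lemma poly_le_expR m : exists K, forall x,
  (2 + `|x|) ^+ m <= K * expR (`|x| `^ s^-1 / 8).
Proof.
(* With y = |x|^(1/s) and [s <= 2], 2 + |x| <= 3 (1 + y)^2; then z^q / q! <= exp z is used at z = (1
   + y) / 8 and q = 2 m. *)
exists (3 ^+ m * (8 ^+ (m * 2) * (m * 2)`!%:R * expR (1 / 8))) => x.
set y := `|x| `^ s^-1; have y0 : 0 <= y by exact: powR_ge0.
have xy : `|x| <= (1 + y) ^+ 2.
  have -> : `|x| = y `^ s by rewrite /y -powRrM mulVf ?gt_eqF// powRr1.
  apply: (@le_trans _ _ ((1 + y) `^ s)).
    by apply: ge0_ler_powR; rewrite ?nnegrE ?addr_ge0 ?(ltW s0)// lerDr.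
  by rewrite -powR_mulrn ?addr_ge0// ler_powR ?lerDl//; case/andP: s12.
apply: (@le_trans _ _ ((3 * (1 + y) ^+ 2) ^+ m)).
  rewrite lerXn2r ?nnegrE ?addr_ge0 ?mulr_ge0 ?exprn_ge0 ?addr_ge0//.
  have : 1 <= (1 + y) ^+ 2 by rewrite exprn_ege1// lerDl.
  lra.
rewrite exprMn -exprM mulnC -!mulrA ler_wpM2l ?exprn_ge0//.
have e1 : 1 + y = 8 * ((1 + y) / 8) by field.
rewrite [X in X ^+ _]e1 exprMn ler_wpM2l ?exprn_ge0//.
rewrite -expRD -mulrDl.
have z0 : 0 <= (1 + y) / 8 by rewrite divr_ge0// addr_ge0.
case: (m * 2)%N => [|q].
  by rewrite expr0 fact0 mul1r; apply: le_trans (expR_ge1Dx _); rewrite lerDl.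
have := expR_ge1Dxn q z0.
have f0 : 0 < q.+1`!%:R :> R by rewrite ltr0n fact_gt0.
rewrite -lerBrDl => h; rewrite [leRHS]mulrC -ler_pdivrMr//.
apply: le_trans h _; lra.
Qed.

(** Weights and inverse radii are powers of [2 + |x|]; half of the exponent 1/4 absorbs them and the
    rate 1/8 remains. *)
Theorem cderive_product_decay n m : exists K, forall x,
  (2 + `|x|) ^+ m * normc (cderive1n n f x) <= K * expR (- (`|x| `^ s^-1 / 8)).
Proof.
have [K KP] := poly_le_expR (m + 4 * N * n).
exists (n`!%:R * (2 * C ^+ 4) ^+ n * expR D * expR (1 / 4) * K) => x.
set y := `|x| `^ s^-1.
have x2 : 0 <= 2 + `|x| by rewrite addr_ge0.
have C0 : 0 <= C by rewrite (le_trans _ C1).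
have pos : 0 <= n`!%:R * (2 * C ^+ 4) ^+ n * expR D.
  by rewrite !mulr_ge0 ?expR_ge0 ?exprn_ge0// mulr_ge0// exprn_ge0.
apply: (@le_trans _ _ ((2 + `|x|) ^+ m * (n`!%:R * (2 * kappa x ^+ 4) ^+ n * expR D *
   (expR (1 / 4) * expR (- (y / 4)))))).
  rewrite ler_wpM2l ?exprn_ge0//; apply: le_trans (normc_cderive_product n x _) _.
  apply: ler_wpM2l (product_decay_aux x).
  by rewrite !mulr_ge0 ?expR_ge0 ?exprn_ge0// mulr_ge0// exprn_ge0// ltW.
have -> : (2 + `|x|) ^+ m * (n`!%:R * (2 * kappa x ^+ 4) ^+ n * expR D *
   (expR (1 / 4) * expR (- (y / 4)))) =
   n`!%:R * (2 * C ^+ 4) ^+ n * expR D * expR (1 / 4) *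
   ((2 + `|x|) ^+ (m + 4 * N * n) * expR (- (y / 4))).
  have -> : (2 * kappa x ^+ 4) ^+ n = (2 * C ^+ 4) ^+ n * (2 + `|x|) ^+ (4 * N * n).
    by rewrite {1}/kappa [X in 2 * X]exprMn mulrA [LHS]exprMn -!exprM; congr (_ * _ ^+ _); lia.
  by rewrite exprD; ring.
have c0 : 0 <= (2 * C ^+ 4) ^+ n by rewrite exprn_ge0// mulr_ge0// exprn_ge0.
rewrite -[leRHS]mulrA ler_wpM2l ?mulr_ge0 ?expR_ge0//.
have -> : - (y / 4) = - (y / 8) - y / 8 by field.
rewrite expRD mulrA ler_wpM2r ?expR_ge0//.
by rewrite expRN ler_pdivrMr ?expR_gt0//; exact: KP.
Qed.

Lemma product_zero k : f (lam k) = 0.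
Proof.
apply: Normc.eq0_normc; apply/eqP; rewrite eq_le normc_ge0 andbT.
apply: le_trans (product_le_partial k.*2.+2 _) _.
apply: le_trans (partial_prod_le_factor _ _) _.
by apply: le_trans (normc_factor_zero _ _) _; rewrite subrr normr0 mulr0.
Qed.

(** Two different factors vanish at the point and all others are bounded by 1; hence f is of order
    h^2 there and its difference quotients tend to 0. *)
Lemma product_double_zero j k : j != k -> lam j = lam k -> cderive1n 1 f (lam k) = 0.
Proof.
wlog jk : j k / (j < k)%N => [hw|_ jkE].
  rewrite neq_ltn => /orP[jk|kj] e; first by apply: (hw j) => //; rewrite ltn_eqF.
  by rewrite -e; apply: (hw k); rewrite ?ltn_eqF.
set y := lam k in jkE *.
have fsq h : normc (f (y + h)) <= scale j * scale k * h ^+ 2.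
  apply: le_trans (product_le_partial k.*2.+2 _) _.
  have jk2 : (j.*2.+1 < k.*2.+1)%N by rewrite ltnS ltn_double.
  apply: le_trans (partial_prod_le_factors _ jk2) _.
  have := normc_factor_zero j (y + h); have := normc_factor_zero k (y + h).
  rewrite jkE -/y addrAC subrr add0r => h1 h2.
  apply: le_trans (ler_pM (normc_ge0 _) (normc_ge0 _) h2 h1) _.
  by rewrite -real_normK ?num_real// expr2 mulrACA.
have fy : f y = 0 by exact: product_zero.
have D0 (pr : R[i] -> R) : (forall z, `|pr z| <= normc z) -> pr 0 = 0 ->
    derive1 (fun t => pr (f t)) y = 0.
  move=> prn pr0; rewrite /derive1; apply: cvg_lim => //.
  apply/norm_cvg0P.
  have lim0 : (fun h : R => scale j * scale k * `|h|) h @[h --> 0^'] --> (0 : R).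
    have id0 : h @[h --> (0 : R)^'] --> (0 : R) by exact: nbhs_dnbhs.
    suff : scale j * scale k * `|h| @[h --> (0 : R)^'] --> scale j * scale k * `|0 : R|.
      by rewrite normr0 mulr0.
    by apply: cvgM; [exact: cvg_cst|exact: cvg_norm id0].
  apply: squeeze_cvgr (cvg_cst 0) lim0.
  near=> h; rewrite normr_ge0/= fy pr0 subr0 normrM normfV.
  have h0 : h != 0 by near: h; exact: nbhs_dnbhs_neq.
  rewrite mulrC ler_pdivrMr ?normr_gt0// addrC (le_trans (prn _))// (le_trans (fsq h))//.
  by rewrite -[h ^+ 2]real_normK ?num_real// expr2 mulrA.
rewrite /cderive1n /= -/(derive1 _) -/(derive1 _).
by apply: eq_ReIm; rewrite /= D0//; [exact: normc_Re|exact: normc_Im].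
Unshelve. all: by end_near. Qed.

Lemma product_neq0 : exists x, f x != 0.
Proof.
have [x xP] := exists_notin_range lam; exists x.
have fac0 n : factor n x != 0.
  rewrite -normc_gt0 factorE; have [no|ne] := boolP (odd n).
    rewrite normc_one_rho divr_gt0// normr_gt0 subr_eq0 /l no eq_sym; exact: xP.
  by rewrite normc_rho divr_gt0.
have V0 n : partial_prod x n != 0.
  elim: n => [|n ih]; first by rewrite /partial_prod big_nil oner_neq0.
  by rewrite /partial_prod big_nat_recr//= mulf_neq0// fac0.
pose B := `|x| + 2.
have B0 : 0 < B by rewrite ltr_wpDl.
have d0 k : 0 <= d k by exact: ltW.
(* Chosen so that [B] times the tail of [d] is at most 1/2. *)
have e0 : 0 < (2 * B)^-1 by rewrite invr_gt0 mulr_gt0.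
have [m mP] := summable_tail d0 sum_d e0.
pose m0 := maxn m (near1_idx x).
have tail n : (m0 <= n)%N -> \sum_(m0 <= k < n) d k <= (2 * B)^-1.
  move=> mn; apply: le_trans (mP n _); last by rewrite (leq_trans _ mn)// leq_maxl.
  rewrite [leRHS](big_cat_nat (n := m0))//= ?leq_maxl// lerDr.
  by apply: sumr_ge0.
(* The inequality that a product of terms 1 - b_k is at least 1 minus the sum of the b_k. The
   monotonicity of the partial products in modulus makes the induction work. *)
have lower n : (m0 <= n)%N ->
    normc (partial_prod x m0) * (1 - B * \sum_(m0 <= k < n) d k) <= normc (partial_prod x n).
  move=> mn; rewrite -(subnK mn); elim: (n - m0)%N => [|q ih].
    by rewrite add0n big_geq// mulr0 subr0 mulr1.
  have mq : (m0 <= q + m0)%N by rewrite leq_addl.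
  rewrite addSn big_nat_recr//= /partial_prod [X in _ <= normc X]big_nat_recr//=.
  rewrite -/(partial_prod x _) Normc.normcM.
  have f1 : 1 - B * d (q + m0)%N <= normc (factor (q + m0) x).
    have near : (near1_idx x <= q + m0)%N by rewrite (leq_trans _ mq)// leq_maxr.
    have h1 := factor_near1 near.
    have h2 : 0 <= normc (v (q + m0) x) * (rad x / (normc (w (q + m0) x) - rad x)).
      by rewrite mulr_ge0 ?normc_ge0// divr_ge0 ?subr_ge0 ?(ltW (rad_gt0 _)) ?(ltW (rad_lt_w _ _)).
    have h3 := ler_normc_sub 1 (factor (q + m0) x).
    rewrite normcB Normc.normc1 in h3.
    rewrite -/B in h1; lra.
  have S0 : 0 <= \sum_(m0 <= k < q + m0) d k by apply: sumr_ge0.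
  have Bd0 : 0 <= B * d (q + m0)%N by rewrite mulr_ge0// ltW.
  have Vq1 := partial_prod_decr x mq.
  have Vm0 := normc_ge0 (partial_prod x m0).
  have Vq0 := normc_ge0 (partial_prod x (q + m0)).
  apply: (@le_trans _ _ (normc (partial_prod x (q + m0)) * (1 - B * d (q + m0)%N))); last first.
    by rewrite ler_wpM2l.
  rewrite mulrBr mulr1; have := ler_wpM2r Bd0 Vq1; rewrite mulrBr mulr1 in ih.
  move=> h; rewrite [leRHS]mulrBr mulr1 !mulrDr; lra.
rewrite -normc_gt0; apply: (@lt_le_trans _ _ (normc (partial_prod x m0) / 2)).
  by rewrite divr_gt0// normc_gt0.
apply: (cvgc_ge (f_cvg x)); exists m0 => // n /= mn.
apply: le_trans (lower n mn); rewrite ler_wpM2l ?normc_ge0//.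
have := ler_wpM2l (ltW B0) (tail n mn).
have -> : B * (2 * B)^-1 = 2^-1 by field; rewrite gt_eqF.
lra.
Qed.

(** Three factors are the fewest that include two decaying ones, those of indices 0 and 2, as
    integrability demands; [hardy_base] starts the induction from this pair. *)
Let hardy_partial n : hardy (fun x => partial_prod x (n + 3)).
Proof.
have mul_b a y h : 0 < a -> hardy h -> hardy (fun x => h x * (1 - poissonc a y x)).
  move=> a0 Hh; have := hardyD Hh (hardyZ (-1) (hardy_poissonc y a0 Hh)).
  by apply: eq_hardy => x; ring.
elim: n => [|n ih].
  have s01 : scale 0 != scale 1.
    have s1 : 1 <= s by case/andP: s12 => /ltW.
    by rewrite /scale powR1 lt_eqF// (lt_le_trans _ (le1r_powR _ s1)) ?ltr1n ?ler1n.
  have := mul_b (scale 0)^-1 (lam 0%N) _ _ (hardy_base (scale_gt0 0) (scale_gt0 1) s01).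
  rewrite invr_gt0 scale_gt0 => /(_ isT).
  apply: eq_hardy => x; rewrite add0n /partial_prod !big_nat_recr//= big_nil mul1r /factor/=; ring.
have Hp : hardy (fun x => partial_prod x (n + 3) * factor (n + 3) x).
  have [no|ne] := boolP (odd (n + 3)).
    have := mul_b (scale (n + 3)./2)^-1 (lam (n + 3)./2) _ _ ih.
    rewrite invr_gt0 scale_gt0 => /(_ isT).
    by apply: eq_hardy => x; rewrite /factor no.
  have := hardy_poissonc 0 (scale_gt0 (n + 3)./2) ih.
  by apply: eq_hardy => x; rewrite /factor (negbTE ne).
by apply: eq_hardy Hp => x; rewrite addSn /partial_prod [RHS]big_nat_recr.
Qed.

Lemma hardy_product : hardy f.
Proof.
apply: (@hardy_dominated _ (fun n x => partial_prod x (n + 3)) _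
  (fun x => (2 + scale 0 ^+ 2 + scale 1 ^+ 2) * (1 + x ^+ 2)^-1)).
- exact: hardy_partial.
- by apply: RintegrableZ; exact: Rintegrable_oneDsqrV.
- by move=> x; have := f_cvg x; rewrite /cvgc -(cvg_shiftn 3).
- move=> n x; apply: le_trans (partial_prod_decr x (leq_addl n 3)) _.
  apply: le_trans (partial_prod_le_factors x (isT : (0 < 2)%N)) _.
  by rewrite -Normc.normcM; exact: normc_poissonc_decay (scale_gt0 0) (scale_gt0 1).
Qed.

End construction.

(** * Consequences of stretched exponential decay *)

Section decaying_functions.
Variable R : realType.
Implicit Types (f h : R -> R[i]).

Lemma cderive1n0 f x : cderive1n 0 f x = f x.
Proof. by rewrite /cderive1n /=; case: (f x). Qed.

(** Since |x|^p <= 1 + |x|^p', the weight exceeds the inverse of the decay by a factor of at most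
    [expR (1 / 8)]. *)
Lemma weighted_sup_lty h (p p' K : R) : 0 < p < p' ->
  (forall x, normc (h x) <= K * expR (- (`|x| `^ p' / 8))) ->
  (weighted_sup h (1 / 8) p < +oo)%E.
Proof.
move=> /andP[p0 pp'] hK.
have K0 : 0 <= K.
  have := hK 0; have := expR_gt0 (- (`|0 : R| `^ p' / 8)); have := normc_ge0 (h 0).
  move=> a b c; have := le_trans a c; rewrite pmulr_lge0//.
apply: (@le_lt_trans _ _ (K * expR (1 / 8))%:E); last by rewrite ltry.
apply: ub_ereal_sup => _ [x _ <-]; rewrite lee_fin.
have xp : `|x| `^ p <= 1 + `|x| `^ p'.
  have [x1|x1] := leP 1 `|x|.
    apply: (@le_trans _ _ (`|x| `^ p')); first by rewrite ler_powR// ltW.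
    by rewrite lerDr.
  apply: (@le_trans _ _ 1); last by rewrite lerDl powR_ge0.
  have [->|x0] := eqVneq `|x| 0; first by rewrite powR0 ?gt_eqF.
  have := @ger_powR _ `|x| _ 0 p (ltW p0); rewrite powRr0; apply.
  by rewrite lt_neqAle eq_sym x0 normr_ge0 ltW.
apply: (@le_trans _ _ (K * expR (- (`|x| `^ p' / 8)) * expR (1 / 8 * `|x| `^ p))).
  by rewrite ler_wpM2r ?expR_ge0.
by rewrite -mulrA ler_wpM2l// -expRD ler_expR; lra.
Qed.

Lemma schwartz_decay f (y : R) : smooth f -> (forall n m, exists K, forall x,
    (2 + `|x|) ^+ m * normc (cderive1n n f x) <= K * expR (- (`|x| `^ y / 8))) ->
  schwartz f.
Proof.
move=> sf fK; split=> // m n; have [K KP] := fK n m; exists `|K| => x.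
apply: (@le_trans _ _ ((2 + `|x|) ^+ m * normc (cderive1n n f x))).
  by rewrite ler_wpM2r ?normc_ge0// lerXn2r ?nnegrE ?addr_ge0// lerDr.
apply: le_trans (KP x) _; apply: le_trans (ler_wpM2r (expR_ge0 _) (ler_norm K)) _.
by rewrite ler_piMr// expR_le1 oppr_le0 divr_ge0// powR_ge0.
Qed.

Lemma schwartz_cvg0 f : schwartz f ->
  normc (f n%:R) @[n --> \oo] --> (0 : R) /\ normc (f (- n%:R)) @[n --> \oo] --> (0 : R).
Proof.
move=> [_ fS]; have [K1 h1] := fS 1%N 0%N; have [K0 h0] := fS 0%N 0%N.
have bnd x n : `|x| = n%:R -> normc (f x) <= n.+1%:R^-1 * (K0 + K1).
  move=> xn; have := h1 x; have := h0 x; rewrite !cderive1n0 expr0 expr1 mul1r xn => a b.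
  by rewrite mulrC ler_pdivlMr// mulrC -natr1 mulrDl mul1r; lra.
have lim : n.+1%:R^-1 * (K0 + K1) @[n --> \oo] --> (0 : R).
  by rewrite -(mul0r (K0 + K1)); apply: cvgM; [exact: cvg_harmonic|exact: cvg_cst].
split; apply: squeeze_cvgr (cvg_cst 0) lim; apply: nearW => n; rewrite normc_ge0/=.
  by apply: bnd; rewrite ger0_norm.
by apply: bnd; rewrite normrN ger0_norm.
Qed.

Lemma cintegrable_schwartz_derive f : schwartz f -> cintegrable (cderive1n 1 f).
Proof.
move=> [sf fS]; have [K0 h0] := fS 0%N 1%N; have [K2 h2] := fS 2%N 1%N.
have /smoothE[s1 s2] := sf.
apply: (@cintegrable_le _ _ (fun x => (K0 + K2) * (1 + x ^+ 2)^-1)).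
- apply: continuous_measurable_fun.
  exact: smooth_real_continuous (smooth_real_derive1 s1).
- apply: continuous_measurable_fun.
  exact: smooth_real_continuous (smooth_real_derive1 s2).
- by apply: RintegrableZ; exact: Rintegrable_oneDsqrV.
- move=> x; have := h0 x; have := h2 x; rewrite expr0 mul1r real_normK ?num_real// => a b.
  rewrite ler_pdivlMr; last by rewrite ltr_wpDr ?sqr_ge0.
  by rewrite mulrC mulrDl mul1r; lra.
Qed.

End decaying_functions.

Theorem theorem1p4 (R : realType) (alpha p q : R)
    (halpha : 0 < alpha < 1) (hp : 0 < p < 1) (hq : 0 < q < 1)
    (Lambda M : set R)
    (hLambda : discrete_subset Lambda) (hM : discrete_subset M)
    (hdLambda : (upper_density alpha Lambda < +oo)%E)
    (hdM : (upper_density alpha M < +oo)%E) :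
  nonuniqueness_pair Lambda M
    (half_space p q `&` [set f | real_analytic f]).
Proof.
have /andP[alpha0 _] := halpha; have /andP[p0 p1] := hp; have /andP[q0 q1] := hq.
have [lam1 g1 L1] := upper_density_enum alpha0 hdLambda.
have [lam2 g2 L2] := upper_density_enum alpha0 hdM.
(* The points of [M] are listed at two different indices, which produces their double zeros. *)
pose lam := interleave lam1 (interleave lam2 lam2).
have [C0 [N lamC0]] : poly_growth lam.
  by apply: poly_growth_interleave => //; exact: poly_growth_interleave.
(* [C >= 1] makes [kappa] at least 1 everywhere. *)
pose C := Num.max C0 1.
have C1 : 1 <= C by rewrite le_max lexx orbT.
have lamC k : k.+1%:R <= C * (1 + `|lam k|) ^+ N.
  apply: le_trans (lamC0 k) _; rewrite ler_wpM2r ?exprn_ge0 ?addr_ge0//.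
  by rewrite le_max lexx.
(* The midpoint between the larger exponent and 1 exceeds both [p] and [q] and lies in [1/2, 1), so
   that its inverse [s] lies in (1, 2]. *)
pose p' := (1 + Num.max p q) / 2.
have pp' : p < p' by have : p <= Num.max p q by [rewrite le_max lexx]; rewrite /p'; lra.
have qp' : q < p' by have : q <= Num.max p q by [rewrite le_max lexx orbT]; rewrite /p'; lra.
have p'1 : p' < 1 by have : Num.max p q < 1 by [rewrite gt_max p1 q1]; rewrite /p'; lra.
have p'0 : 0 < p' by lra.
have p'2 : 1 / 2 <= p'.
  by have : 0 <= Num.max p q by [rewrite le_max (ltW p0)]; rewrite /p'; lra.
pose s := p'^-1.
have s12 : 1 < s <= 2.
  rewrite /s invf_gt1// p'1/= -[2]invrK lef_pV2 ?posrE ?invr_gt0//; lra.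
have [f fP] := partial_prod_cvg s12 C1 lamC.
have sf := smooth_product s12 C1 lamC fP.
have decay n m := cderive_product_decay s12 C1 lamC fP n m.
rewrite /s invrK in decay.
have Sf : schwartz f by exact: schwartz_decay decay.
have [f1 f2] := schwartz_cvg0 Sf.
have hlE : half_laplacian f = half_deriv f.
  apply: half_laplacian_hardy => //; first exact: (hardy_product s12 fP).
  exact: cintegrable_schwartz_derive.
have hdecay n m : exists K, forall x,
    (2 + `|x|) ^+ m * normc (cderive1n n (half_deriv f) x) <= K * expR (- (`|x| `^ p' / 8)).
  have [K KP] := decay n.+1 m; exists (normc ((2 * pi) *i : R[i])^-1 * K) => x.
  by rewrite cderive1n_half_deriv// Normc.normcM mulrCA -mulrA ler_wpM2l ?normc_ge0.
have bound (h : R -> R[i]) : (forall n m, exists K, forall x,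
    (2 + `|x|) ^+ m * normc (cderive1n n h x) <= K * expR (- (`|x| `^ p' / 8))) ->
    exists K, forall x, normc (h x) <= K * expR (- (`|x| `^ p' / 8)).
  by move=> /(_ 0%N 0%N)[K KP]; exists K => x; have := KP x; rewrite expr0 mul1r cderive1n0.
exists f; split.
- split; last exact: (real_analytic_product s12 C1 lamC fP).
  split; first exact: Sf.
    by rewrite hlE; apply: schwartz_decay hdecay; exact: smooth_half_deriv.
  rewrite hlE.
  exists (1 / 8); first by rewrite divr_gt0.
  have [K KP] := bound f decay; have [K' KP'] := bound _ hdecay.
  apply: lte_add_pinfty; [apply: weighted_sup_lty KP|apply: weighted_sup_lty KP'].
    by rewrite p0.
  by rewrite q0.
- exact: (product_neq0 s12 C1 lamC fP).
- move=> l /L1[k <-].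
  have <- : lam k.*2 = lam1 k by exact: interleave_even.
  exact: (product_zero s12 fP).
- move=> m /L2[k <-]; rewrite hlE /half_deriv.
  (* The two copies of [lam2 k] sit at the indices 4 k + 1 and 4 k + 3. *)
  have e1 : lam k.*2.*2.+1 = lam2 k by rewrite /lam interleave_odd interleave_even.
  have e2 : lam k.*2.+1.*2.+1 = lam2 k by rewrite /lam interleave_odd interleave_odd.
  rewrite -e1 (product_double_zero s12 fP (j := k.*2.+1.*2.+1)) ?mulr0//.
    by rewrite eqSS (inj_eq double_inj) gtn_eqF.
  by rewrite e1 e2.
Qed.
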